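(* Consider families of discretizations (with discretization widths $\delta_s,\delta_\varphi,\delta_x>0$) as described in the context. If $\delta_s\to 0$, $\frac{\delta_\varphi}{\delta_s}\to 0$ and $\frac{\delta_x}{\delta_s}\to 0$, then $\mathcal{R}_{\delta_s,\delta_\varphi}^{\delta_x}$ converges to $\mathcal{R}$ in the operator norm for linear and continuous mappings $L^2(\Omega)\to L^2(\Omega')$. If additionally $\delta_\varphi=\mathcal{O}(\delta_s^{1+\epsilon})$ and $\delta_x=\mathcal{O}(\delta_s^{1+\epsilon})$ for some $0<\epsilon\le\frac12$, then $\|\mathcal{R}_{\delta_s,\delta_\varphi}^{\delta_x}-\mathcal{R}\|=\mathcal{O}(\delta_s^{\epsilon})$ as $\delta_s\to 0$.
   Context: Let $\Omega=B(0,1)\subset\mathbb{R}^2$ be the unit ball and $\Omega'={]{-1,1}[}\times S^1$; functions on $\Omega$ (resp. $\Omega'$) are extended by zero to $\mathbb{R}^2$ (resp. $\mathbb{R}\times S^1$). $S^1$ is identified with $[-\pi,\pi[$ via $\vartheta(\varphi)=(\cos\varphi,\sin\varphi)$ (angles modulo $2\pi$, arc-length measure); $\vartheta(\varphi)^\perp=(-\sin\varphi,\cos\varphi)$. Radon transform: $[\mathcal{R}f](s,\varphi)=\int_{\mathbb{R}} f\bigl(s\vartheta(\varphi)+t\vartheta(\varphi)^\perp\bigr)\,dt$, defined for continuous compactly supported $f$ and extended to a linear continuous operator $\mathcal{R}:L^2(\Omega)\to L^2(\Omega')$. Discretization. Offsets: $P\in\mathbb{N}$, $\delta_s>0$, $s_p=\delta_s\bigl(p-\frac{P+1}{2}\bigr)$,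 $S_p=[s_p-\frac{\delta_s}{2},s_p+\frac{\delta_s}{2}[$, $p=1,\dots,P$. Angles: $\varphi_1<\dots<\varphi_Q$ in $[-\pi,\pi[$, $\varphi_0=\varphi_Q-2\pi$, $\varphi_{Q+1}=\varphi_1+2\pi$, $\Phi_q=[\frac{\varphi_{q-1}+\varphi_q}{2},\frac{\varphi_q+\varphi_{q+1}}{2}[$ modulo $2\pi$, $\delta_\varphi=\max_{q=1,\dots,Q}(\varphi_{q+1}-\varphi_q)$. Image grid: $N,M\in\mathbb{N}$, $\delta_x>0$, $x_{ij}=\delta_x\bigl(i-\frac{N+1}{2},j-\frac{M+1}{2}\bigr)$, $X_{ij}=x_{ij}+[-\frac{\delta_x}{2},\frac{\delta_x}{2}[^2$, $i=1,\dots,N$, $j=1,\dots,M$. It is always assumed that $\Omega$ is contained in the union of all $X_{ij}$ and $\Omega'$ is contained in the union of all $S_p\times\Phi_q$. Let $w_{\delta_s}(t)=\max(0,\delta_s-|t|)$. Fully discrete Radon transform: for $f\in L^2(\Omega)$, $$[\mathcal{R}_{\delta_s,\delta_\varphi}^{\delta_x}f](s,\varphi)=\frac{1}{\delta_s^2}\sum_{q=1}^Q\sum_{p=1}^P\chi_{S_p}(s)\chi_{\Phi_q}(\varphi)\sum_{i=1}^{N}\sum_{j=1}^{M}w_{\delta_s}\bigl(x_{ij}\cdot\vartheta(\varphi_q)-s_p\bigr)\int_{X_{ij}}f(x)\,dx ,$$ regarded as an operator $L^2(\Omega)\to L^2(\Omega')$. *)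

(* Defs.v *)
From HB Require Import structures.
From mathcomp Require Import all_boot all_order all_algebra.
From mathcomp Require Import all_classical all_reals all_analysis.
From mathcomp Require Import measurable_realfun.

Set Implicit Arguments.
Unset Strict Implicit.
Unset Printing Implicit Defensive.
Import Order.TTheory GRing.Theory Num.Theory.
Import numFieldNormedType.Exports.

Local Open Scope classical_set_scope.
Local Open Scope ring_scope.

Notation plane R := (measurableTypeR R * measurableTypeR R)%type.

Section L2_spaces.
Context {R : realType}.

Definition leb2 : {measure set (plane R) -> \bar R} :=
  (@lebesgue_measure R \x @lebesgue_measure R)%E.

Definition disk : set (plane R) := [set x | x.1 ^+ 2 + x.2 ^+ 2 < 1].

(* S^1 is identified with [-pi, pi[; its arc length is Lebesgue measure there. *)
Definition cylinder : set (plane R) := `]-1, 1[ `*` `[- pi, pi[.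

Lemma measurable_disk : measurable disk.
Proof.
have mq : measurable_fun [set: plane R] (fun x => x.1 ^+ 2 + x.2 ^+ 2).
  by apply: measurable_funD; apply: measurable_funX.
rewrite (_ : disk = setT `&` (fun x => x.1 ^+ 2 + x.2 ^+ 2) @^-1` `]-oo, 1[).
  exact: mq.
by rewrite setTI; apply/seteqP; split=> x; rewrite /disk /= in_itv.
Qed.

Lemma measurable_cylinder : measurable cylinder.
Proof. by apply: measurableX. Qed.

Definition disk_measure : {measure set (plane R) -> \bar R} :=
  mrestr leb2 measurable_disk.

Definition cylinder_measure : {measure set (plane R) -> \bar R} :=
  mrestr leb2 measurable_cylinder.

Lemma one_le_two : (1 <= 2%:E :> \bar R)%E.
Proof. by rewrite lee_fin ler1n. Qed.

End L2_spaces.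

(* Square-integrable functions before identification modulo null sets; the
   equality of L^2 is a.e. equality for the restricted measure, so the values
   of an element of L2disk outside disk (and of L2cyl outside cylinder) do not
   matter. *)
Notation L2disk R := (LfunType (@disk_measure R) one_le_two).
Notation L2cyl R := (LfunType (@cylinder_measure R) one_le_two).

Section operators.
Context {R : realType}.

Definition norm_disk (f : L2disk R) : \bar R :=
  ('N[disk_measure]_(2%:E)[EFin \o f])%E.

Definition norm_cyl (g : L2cyl R) : \bar R :=
  ('N[cylinder_measure]_(2%:E)[EFin \o g])%E.

Definition operator_norm (T : L2disk R -> L2cyl R) : \bar R :=
  ereal_sup [set norm_cyl (T f) | f in [set f | (norm_disk f <= 1)%E]].

(* Linearity is only meaningful almost everywhere, cf. L2disk. *)
Definition linear_operator (T : L2disk R -> L2cyl R) : Prop :=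
  forall (a : R) (f g : L2disk R),
    T (a *: f + g) = a *: T f + T g %[ae cylinder_measure].

Definition continuous_operator (T : L2disk R -> L2cyl R) : Prop :=
  forall (f : L2disk R) (e : R), 0 < e ->
  exists2 h : R, 0 < h &
    forall g : L2disk R, (norm_disk (g - f)%R < h%:E)%E ->
      (norm_cyl (T g - T f)%R < e%:E)%E.

End operators.

Section radon.
Context {R : realType}.

(* Here u = (s, phi) and the line is s (cos phi, sin phi) + t (-sin phi, cos phi). *)
Definition radon_integral (f : R * R -> R) (u : R * R) : R :=
  \int[lebesgue_measure]_t
    f (u.1 * cos u.2 - t * sin u.2, u.1 * sin u.2 + t * cos u.2).

Definition continuous_compactly_supported (f : R * R -> R) : Prop :=
  continuous f /\
  exists K : set (R * R),
    [/\ compact K, K `<=` disk & forall x, ~ K x -> f x = 0].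

Definition radon_extension (T : L2disk R -> L2cyl R) : Prop :=
  [/\ linear_operator T, continuous_operator T &
      forall f : L2disk R, continuous_compactly_supported f ->
        (T f : R * R -> R) = radon_integral f %[ae cylinder_measure]].

(* The continuous extension is unique up to null sets. If there were none, this
   would be the zero operator; existence is a mathematical fact that is not
   assumed here. *)
Definition radon : L2disk R -> L2cyl R :=
  xget (fun=> 0) [set T | radon_extension T].

End radon.

Section discretization.
Context {R : realType}.

(* Node number k of n equispaced nodes of width h centred at 0, 1 <= k <= n. *)
Definition grid_node (h : R) (n k : nat) : R := h * (k%:R - (n%:R + 1) / 2).

Definition cell (h c : R) : set R := `[c - h / 2, c + h / 2[.

Definition cell2 (h : R) (c : R * R) : set (plane R) :=
  cell h c.1 `*` cell h c.2.

(* phi_0 and phi_(Q+1) are phi_Q and phi_1 shifted by a full turn. *)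
Definition wrap_angles (Q : nat) (phi : nat -> R) (q : nat) : R :=
  if q == 0%N then phi Q - 2 * pi
  else if q == Q.+1 then phi 1%N + 2 * pi
  else phi q.

(* A subset of S^1, given as a 2pi-periodic subset of R. *)
Definition angle_cell (Q : nat) (phi : nat -> R) (q : nat) : set R :=
  [set a | exists k : int,
    a + k%:~R * (2 * pi) \in
      `[(wrap_angles Q phi q.-1 + wrap_angles Q phi q) / 2,
        (wrap_angles Q phi q + wrap_angles Q phi q.+1) / 2[ ].

(* The default 0 plays no role: all gaps are positive and Q > 0 below. *)
Definition angle_width (Q : nat) (phi : nat -> R) : R :=
  \big[Num.max/0]_(1 <= q < Q.+1)
    (wrap_angles Q phi q.+1 - wrap_angles Q phi q).

End discretization.

(* All indices start at 1; only the values angle 1, ..., angle nangle of the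
   sequence angle are relevant. *)
Record discretization (R : realType) := Discretization {
  noffset : nat;
  ds : R;
  ds_gt0 : 0 < ds;
  nangle : nat;
  angle : nat -> R;
  angle_range : forall q, (1 <= q <= nangle)%N -> - pi <= angle q < pi;
  angle_incr : forall q r, (1 <= q)%N -> (q < r)%N -> (r <= nangle)%N ->
    angle q < angle r;
  nrow : nat;
  ncol : nat;
  dx : R;
  dx_gt0 : 0 < dx;
  disk_covered : disk `<=`
    \bigcup_(ij in [set ij : nat * nat |
                     (1 <= ij.1 <= nrow)%N /\ (1 <= ij.2 <= ncol)%N])
      cell2 dx (grid_node dx nrow ij.1, grid_node dx ncol ij.2);
  cylinder_covered : cylinder `<=`
    \bigcup_(pq in [set pq : nat * nat |
                     (1 <= pq.1 <= noffset)%N /\ (1 <= pq.2 <= nangle)%N])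
      (cell ds (grid_node ds noffset pq.1) `*` angle_cell nangle angle pq.2)
}.

Definition dphi (R : realType) (D : discretization R) : R :=
  angle_width (nangle D) (angle D).

Section discrete_radon.
Context {R : realType}.
Variable D : discretization R.

Definition offset (p : nat) : R := grid_node (ds D) (noffset D) p.

Definition offset_cell (p : nat) : set R := cell (ds D) (offset p).

Definition pixel_center (i j : nat) : R * R :=
  (grid_node (dx D) (nrow D) i, grid_node (dx D) (ncol D) j).

Definition pixel (i j : nat) : set (plane R) := cell2 (dx D) (pixel_center i j).

Definition hat (t : R) : R := Num.max 0 (ds D - `|t|).

(* f \_ disk is the extension of f by zero. *)
Definition discrete_radon_coef (f : R * R -> R) (p q : nat) : R :=
  \sum_(1 <= i < (nrow D).+1) \sum_(1 <= j < (ncol D).+1)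
    hat ((pixel_center i j).1 * cos (angle D q)
         + (pixel_center i j).2 * sin (angle D q) - offset p)
    * (\int[leb2]_(x in pixel i j) (f \_ disk) x).

Definition discrete_radon_fun (f : R * R -> R) (u : plane R) : R :=
  (ds D ^+ 2)^-1 *
  \sum_(1 <= q < (nangle D).+1) \sum_(1 <= p < (noffset D).+1)
    \1_(offset_cell p) u.1 * \1_(angle_cell (nangle D) (angle D) q) u.2
    * discrete_radon_coef f p q.

Lemma measurable_angle_cell Q (phi : nat -> R) q :
  measurable (angle_cell Q phi q : set (measurableTypeR R)).
Proof.
rewrite /angle_cell; set a := (_ / 2 : R) ; set b := (_ / 2 : R).
rewrite (_ : mkset _ = \bigcup_(k : int)
   [set` `[a - k%:~R * (2 * pi), b - k%:~R * (2 * pi)[ ]); last first.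
  by apply/seteqP; split=> [x [k /=]|x [k _ /=]]; rewrite ?in_itv/=;
    rewrite -?lerBlDr -?ltrBrDr => h; exists k => //=;
    rewrite in_itv/= -?lerBlDr -?ltrBrDr.
by apply: countable_bigcupT_measurable => // k; exact: measurable_itv.
Qed.

(* The cylinder has finite measure, so bounded measurable functions are in L2cyl. *)
Lemma indic_L2cyl (A : set (plane R)) : measurable A ->
  (\1_A : plane R -> R) \in Lfun (@cylinder_measure R) 2%:E.
Proof.
move=> mA; rewrite inE; apply/andP; split; rewrite inE /=.
  exact: measurable_indic.
rewrite /finite_norm unlock poweR_lty //.
apply: (@le_lt_trans _ _ (\int[cylinder_measure]_x cst 1 x)%E).
  apply: ge0_le_integral => //=.
  - apply/measurable_EFinP.
    apply: (@measurableT_comp _ _ _ _ _ _ (fun x : R => x `^ 2)) => //.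
    apply: measurableT_comp => //; exact: measurable_indic.
  - move=> x _; rewrite lee_fin indicE.
    by case: (x \in A); rewrite ?normr1 ?normr0 ?powR1 ?powR0.
rewrite integral_cst //= mul1e /mrestr setTI.
rewrite /leb2 /cylinder product_measure1E //= !lebesgue_measure_itv /=.
by rewrite !lte_fin; do 2?case: ifP; rewrite -?EFinM ?mule0 ?mul0e ?ltry.
Qed.

Lemma discrete_radon_L2cyl (f : R * R -> R) :
  discrete_radon_fun f \in Lfun (@cylinder_measure R) 2%:E.
Proof.
rewrite (_ : discrete_radon_fun f = (ds D ^+ 2)^-1 *:
  \sum_(1 <= q < (nangle D).+1) \sum_(1 <= p < (noffset D).+1)
    discrete_radon_coef f p q *:
      (\1_(offset_cell p `*` angle_cell (nangle D) (angle D) q)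
        : plane R -> R)); last first.
  apply/funext => u; rewrite /discrete_radon_fun /=.
  rewrite [RHS]/GRing.scale /=; congr (_ * _).
  rewrite fct_sumE; apply: eq_bigr => q _.
  rewrite fct_sumE; apply: eq_bigr => p _.
  rewrite [RHS]/GRing.scale /= mulrC; congr (_ * _).
  by rewrite !indicE in_setX -natrM mulnb.
have p1 := @one_le_two R.
apply: rpredZ; apply: rpred_sum => q _; apply: rpred_sum => p _.
apply: rpredZ; apply: indic_L2cyl; apply: measurableX.
  exact: measurable_itv.
exact: measurable_angle_cell.
Qed.

Definition discrete_radon (f : L2disk R) : L2cyl R :=
  Lfun_Sub one_le_two (discrete_radon_L2cyl f).

End discrete_radon.

(* Main.v *)
(* Let f >= 0 have squared norm N and let g(p, s) be its integral over the line
   of angle p and offset s. By Tonelli and rotation invariance,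
   int_s g(p, s) g(p, s + h) = int_v Gamma(rotation by p of (h, v)), where Gamma
   is the autocorrelation of f and 0 <= Gamma <= N. After integration over p
   only the circular integrals M(r) <= 2 pi N of Gamma remain, so that
   int_p int_s (g(p, s + h) - g(p, s))^2
     = 4 int_(v > 0) (M(v) - M(sqrt(h^2 + v^2))) <= 8 pi |h| N,
   because v |-> sqrt(h^2 + v^2) is a contraction of ]0, +oo[ onto ]|h|, +oo[.
   This estimate replaces the H^(1/2) smoothing of the Radon transform, which
   would need the Fourier slice theorem.

   Moving a point inside its pixel and an angle inside its cell changes the
   argument of the hat function by at most eta = dx + dphi, and the integral of
   the hat function is ds^2. Hence the discrete transform at (s, p) differs from
   g(p, s) by at most ds^-2 times the integral over |h| <= 4 ds of
   eta g(p, s + h) + ds |g(p, s + h) - g(p, s)|, and Cauchy-Schwarz bounds the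
   squared norm of the error by 512 pi N ((eta / ds)^2 + 8 ds). Splitting f into
   its positive and negative parts costs a factor 2.

   The operator radon is only known as some continuous extension; it is the
   operator of line integrals since continuous functions with compact support in
   the disk are dense. *)

From HB Require Import structures.
Require Import Defs.
From mathcomp Require Import all_boot all_order all_algebra.
From mathcomp Require Import all_classical all_reals all_analysis.
From mathcomp Require Import measurable_realfun ring lra.

Set Implicit Arguments.
Unset Strict Implicit.
Unset Printing Implicit Defensive.
Import Order.TTheory GRing.Theory Num.Theory.
Import numFieldNormedType.Exports.

Local Open Scope classical_set_scope.
Local Open Scope ring_scope.

(** * Translations, rotations and rearrangement estimates *)

(** No regularity is available at a single angle: g(p, .) can be as rough as f itself. Only the
    integral over p makes the correlation depend on the radius alone, so the increment estimate
    exists for the whole circle and not for its points. The identity for the increments subtracts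
    infinite quantities unless the correlations are finite. They are, because f vanishes off the
    disk: every line carries a chord of length at most 2, and Cauchy-Schwarz bounds the squared norm
    of g(p, .) by 2 N for each p. With f >= 0, Tonelli justifies every exchange of integrals. The
    two terms of the final bound mirror the hypotheses. The term eta / ds asks for dx and dphi to be
    o(ds) and decays like ds^eps. The increments enter the squared norm with |h| <= 4 ds, hence the
    norm with sqrt ds; this is the origin of eps <= 1/2. Density is used through a class of
    functions rather than through approximants: the functions on which two extensions agree are
    closed under linear combinations and dominated limits, so that indicators of rectangles generate
    all of them. *)

Section lebesgue_line.
Context {R : realType}.
Local Notation mu := (@lebesgue_measure R).
Local Open Scope ereal_scope.

Lemma lebesgue_measure_translate (a : R) (A : set (measurableTypeR R)) : measurable A ->
  pushforward mu (fun x : measurableTypeR R => (x + a)%R : measurableTypeR R) A = mu A.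
Proof.
move=> mA.
have mf : measurable_fun [set: measurableTypeR R]
    (fun x : measurableTypeR R => (x + a)%R : measurableTypeR R).
  by apply: measurable_funD.
apply/esym/lebesgue_measure_unique => //= _ [[b c]] _ <-.
rewrite /pushforward.
rewrite (_ : _ @^-1` _ = `](b - a)%R, (c - a)%R]%classic); last first.
  by apply/seteqP; split => x /=; rewrite !in_itv/= ltrBlDr lerBrDr.
rewrite !lebesgue_measure_itv/= !lte_fin ltrD2r.
by case: ifP => // _; rewrite -!EFinB; congr (_%:E); ring.
Qed.

Lemma ge0_integral_translate (a : R) (f : R -> \bar R) :
  measurable_fun [set: measurableTypeR R] f -> (forall x, 0 <= f x) ->
  \int[mu]_x f (x + a)%R = \int[mu]_x f x.
Proof.
move=> mf f0.
have mt : measurable_fun [set: measurableTypeR R]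
    (fun x : measurableTypeR R => (x + a)%R : measurableTypeR R).
  by apply: measurable_funD.
transitivity (\int[pushforward mu (fun x : measurableTypeR R => (x + a)%R : measurableTypeR R)]_x f x).
  by rewrite ge0_integral_pushforward.
by apply: eq_measure_integral => A mA _; exact: lebesgue_measure_translate.
Qed.

Lemma ge0_integral_opp (f : R -> \bar R) :
  measurable_fun [set: measurableTypeR R] f -> (forall x, 0 <= f x) ->
  \int[mu]_x f (- x)%R = \int[mu]_x f x.
Proof.
move=> mf f0.
transitivity (\int[pushforward mu (-%R : _ -> measurableTypeR R)]_x f x).
  by rewrite ge0_integral_pushforward.
by apply: eq_measure_integral => A mA _; exact: lebesgue_measureN.
Qed.

End lebesgue_line.

Section plane_integrals.
Context {R : realType}.
Local Notation mu := (@lebesgue_measure R).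
Local Open Scope ereal_scope.

Lemma measurable_plane_pair d (T : measurableType d) (f g : T -> R) :
  measurable_fun [set: T] f -> measurable_fun [set: T] g ->
  measurable_fun [set: T] (fun x => (f x, g x) : plane R).
Proof. by move=> mf mg; apply: measurable_fun_pair. Qed.

Ltac measurable_real := repeat first
  [ by [] | apply: measurable_plane_pair | apply: measurable_funD
  | apply: measurable_funB | apply: measurable_funM | apply: measurableT_comp ].

Lemma tonelli_leb2 (f : plane R -> \bar R) :
  measurable_fun setT f -> (forall x, 0 <= f x) ->
  \int[leb2]_x f x = \int[mu]_x \int[mu]_y f (x, y).
Proof. by move=> mf f0; exact: (fubini_tonelli1 (m1 := mu) (m2 := mu)). Qed.

Lemma tonelli_leb2_sym (f : plane R -> \bar R) :
  measurable_fun setT f -> (forall x, 0 <= f x) ->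
  \int[leb2]_x f x = \int[mu]_y \int[mu]_x f (x, y).
Proof. by move=> mf f0; exact: (fubini_tonelli2 (m1 := mu) (m2 := mu)). Qed.

Lemma ge0_integral_shear1 (a : R) (f : plane R -> \bar R) :
  measurable_fun setT f -> (forall x, 0 <= f x) ->
  \int[leb2]_x f ((x.1 + a * x.2)%R, x.2) = \int[leb2]_x f x.
Proof.
move=> mf f0.
have ms : measurable_fun setT (fun x : plane R => f ((x.1 + a * x.2)%R, x.2)).
  by apply: (measurableT_comp mf); measurable_real.
rewrite !tonelli_leb2_sym//; apply: eq_integral => y _;
rewrite (ge0_integral_translate (a * y) (f := fun x => f (x, y)))//.
exact: measurableT_comp.
Qed.

Lemma ge0_integral_shear2 (a : R) (f : plane R -> \bar R) :
  measurable_fun setT f -> (forall x, 0 <= f x) ->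
  \int[leb2]_x f (x.1, (x.2 + a * x.1)%R) = \int[leb2]_x f x.
Proof.
move=> mf f0.
have ms : measurable_fun setT (fun x : plane R => f (x.1, (x.2 + a * x.1)%R)).
  by apply: (measurableT_comp mf); measurable_real.
rewrite !tonelli_leb2//; apply: eq_integral => y _;
rewrite (ge0_integral_translate (a * y) (f := fun x => f (y, x)))//.
exact: measurableT_comp.
Qed.

Lemma ge0_integral_plane_translate (a : plane R) (f : plane R -> \bar R) :
  measurable_fun setT f -> (forall x, 0 <= f x) ->
  \int[leb2]_x f ((x.1 + a.1)%R, (x.2 + a.2)%R) = \int[leb2]_x f x.
Proof.
move=> mf f0.
have ms : measurable_fun setT (fun x : plane R => f ((x.1 + a.1)%R, (x.2 + a.2)%R)).
  by apply: (measurableT_comp mf); measurable_real.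
rewrite !tonelli_leb2//=.
rewrite -[RHS](ge0_integral_translate a.1); last 2 first.
- exact: (measurable_fun_fubini_tonelli_F (m2 := mu) f).
- by move=> x; exact: integral_ge0.
apply: eq_integral => y _.
rewrite (ge0_integral_translate a.2 (f := fun x => f (y + a.1, x)%R))//.
exact: measurableT_comp.
Qed.

Lemma ge0_integral_plane_opp (f : plane R -> \bar R) :
  measurable_fun setT f -> (forall x, 0 <= f x) ->
  \int[leb2]_x f ((- x.1)%R, (- x.2)%R) = \int[leb2]_x f x.
Proof.
move=> mf f0.
have ms : measurable_fun setT (fun x : plane R => f ((- x.1)%R, (- x.2)%R)).
  by apply: (measurableT_comp mf); measurable_real.
rewrite !tonelli_leb2//=.
rewrite -[RHS]ge0_integral_opp; last 2 first.
- exact: (measurable_fun_fubini_tonelli_F (m2 := mu) f).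
- by move=> x; exact: integral_ge0.
apply: eq_integral => y _.
rewrite (ge0_integral_opp (f := fun x => f (- y, x)%R))//.
exact: measurableT_comp.
Qed.

(* A rotation which is not the half turn is a product of three shears. *)
Lemma ge0_integral_rotation (c s : R) (f : plane R -> \bar R) :
  (c ^+ 2 + s ^+ 2 = 1)%R ->
  measurable_fun setT f -> (forall x, 0 <= f x) ->
  \int[leb2]_x f ((x.1 * c - x.2 * s)%R, (x.1 * s + x.2 * c)%R) = \int[leb2]_x f x.
Proof.
move=> cs mf f0.
have [c1|c1] := eqVneq c (- 1)%R.
  have s0 : s = 0%R by apply/eqP; rewrite -sqrf_eq0; apply/eqP; rewrite c1 in cs; lra.
  rewrite -[RHS]ge0_integral_plane_opp//; apply: eq_integral => x _.
  by rewrite c1 s0; congr (f (_, _)); ring.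
have c1' : (1 + c != 0)%R by rewrite addrC addr_eq0.
(* For the angle with cosine [c] and sine [s] this is minus the tangent of half the angle: the
   coefficient of the two outer shears, the inner one having coefficient [s]. *)
pose p : R := (- s / (1 + c))%R.
rewrite -[RHS](ge0_integral_shear1 p)//.
have m1 : measurable_fun setT (fun x : plane R => f ((x.1 + p * x.2)%R, x.2)).
  by apply: (measurableT_comp mf); measurable_real.
rewrite -[RHS](ge0_integral_shear2 s)//=.
have m2 : measurable_fun setT (fun x : plane R => f ((x.1 + p * (x.2 + s * x.1))%R, (x.2 + s * x.1)%R)).
  by apply: (measurableT_comp mf); measurable_real.
rewrite -[RHS](ge0_integral_shear1 p)//=.
have p1c : (p * (1 + c) = - s)%R by rewrite /p mulfVK.
have ps : (p * s = c - 1)%R.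
  apply: (mulfI c1'); rewrite mulrA (mulrC _ p) p1c.
  by nra.
have cE : (c = 1 + p * s)%R by rewrite ps addrC subrK.
rewrite {}cE in p1c *.
apply: eq_integral => x _; congr (f (_, _)); last by ring.
by rewrite -[(x.2 * s)%R]opprK -mulrN -p1c; ring.
Qed.

End plane_integrals.

(** * Images of Lebesgue measure under contractions of the line *)

Section contractions.
Context {R : realType}.
Local Notation mu := (@lebesgue_measure R).
Local Open Scope ereal_scope.

Lemma lebesgue_stieltjes_measure_itvoc (f : cumulative R R) (a b : R) : (a <= b)%R ->
  lebesgue_stieltjes_measure f `]a, b]%classic = (f b - f a)%:E.
Proof.
move=> ab; rewrite /lebesgue_stieltjes_measure/= /measure_extension/=.
rewrite measurable_mu_extE//; last exact: is_ocitv.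
exact: wlength_itv_bnd.
Qed.

(* [s] is a generalized inverse of [b + rho b], whose Stieltjes measure
   dominates Lebesgue measure as [rho] is nondecreasing. *)
Lemma le_lebesgue_measure_preimage (s rho : R -> R) :
  measurable_fun [set: measurableTypeR R] (s : measurableTypeR R -> measurableTypeR R) ->
  {homo rho : x y / (x <= y)%R} -> continuous rho ->
  (forall v b, (s v <= b)%R = (v <= b + rho b)%R) ->
  forall A : set (measurableTypeR R), measurable A ->
    mu A <= pushforward mu (s : measurableTypeR R -> measurableTypeR R) A.
Proof.
move=> ms nd cr sE A mA.
have cumulative_pack (g : R -> R) : {homo g : x y / (x <= y)%R} -> continuous g ->
    exists c : cumulative R R, (c : R -> R) = g.
  move=> ndg cg.
  pose cg' := isCumulative.Build R _ R g ndg (right_continuousW cg).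
  by exists (HB.pack_for (cumulative R R) g cg').
have [c1 c1E] := cumulative_pack _ nd cr.
pose tau x := (x + rho x)%R.
have ndt : {homo tau : x y / (x <= y)%R} by move=> x y xy; rewrite lerD// nd.
have [|c2 c2E] := cumulative_pack _ ndt.
  by move=> x; apply: cvgD; [exact: cvg_id|exact: cr].
have ocitvE (X : set R) : ocitv X -> exists2 y, (y.1 <= y.2)%R & X = `]y.1, y.2]%classic.
  case=> -[a b] _ <-; have [ab|ba] := leP a b; first by exists (a, b).
  exists (0%R, 0%R) => //=; rewrite set_itvoc0 set_itv_ge//.
  by rewrite bnd_simp/= -leNgt ltW.
pose p : {measure set (measurableTypeR R) -> \bar R} := pushforward mu (s : measurableTypeR R -> measurableTypeR R).
pose q : {measure set (measurableTypeR R) -> \bar R} :=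
  measure_add mu (lebesgue_stieltjes_measure c1).
have qE B : q B = mu B + lebesgue_stieltjes_measure c1 B by exact: measure_addE.
(* Both measures are identified with the Stieltjes measure of [tau] by their values on half-open
   intervals: the preimage of ]a, b] under [s] is ]tau a, tau b]. *)
have -> : pushforward mu (s : measurableTypeR R -> measurableTypeR R) A = q A.
  transitivity (lebesgue_stieltjes_measure c2 A).
    apply/esym; apply: (lebesgue_stieltjes_measure_unique (f := c2) (mu := p ms)) => // _ /ocitvE[[a b]/= ab ->].
    rewrite lebesgue_stieltjes_measure_itvoc// c2E/= /p/= /pushforward.
    rewrite (_ : _ @^-1` _ = `]tau a, tau b]%classic).
      rewrite lebesgue_measure_itv/= lte_fin lt_neqAle ndt// andbT.
      by have [->|_ /=] := eqVneq; rewrite ?subrr.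
    by apply/seteqP; split => x /=; rewrite !in_itv/= !ltNge !sE.
  apply: (lebesgue_stieltjes_measure_unique (f := c2) (mu := q)) => // _ /ocitvE[[a b]/= ab ->].
  rewrite qE !lebesgue_stieltjes_measure_itvoc// c2E c1E lebesgue_measure_itv/=.
  rewrite lte_fin -EFinB (_ : (if _ then _ else _) = (b - a)%:E); last first.
    by case: ltgtP ab => // ->; rewrite subrr.
  by rewrite -EFinD; congr (_%:E); rewrite /tau; ring.
by rewrite qE leeDl.
Qed.

(** The conditions on [rho] make [s] a nondecreasing contraction, since its generalized inverse
    grows with slope at least 1. Such a map can only increase the mass that Lebesgue measure puts on
    a set. *)
Lemma le_integral_comp_contraction (s rho : R -> R) (f : R -> \bar R) :
  measurable_fun [set: measurableTypeR R] (s : measurableTypeR R -> measurableTypeR R) ->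
  {homo rho : x y / (x <= y)%R} -> continuous rho ->
  (forall v b, (s v <= b)%R = (v <= b + rho b)%R) ->
  measurable_fun [set: measurableTypeR R] f -> (forall x, 0 <= f x) ->
  \int[mu]_x f x <= \int[mu]_x f (s x).
Proof.
move=> ms nd cr sE mf f0.
apply: (@le_trans _ _ (\int[pushforward mu (s : measurableTypeR R -> measurableTypeR R)]_x f x)).
  by apply: ge0_le_measure_integral => // A mA; exact: (le_lebesgue_measure_preimage ms nd cr sE mA).
by rewrite ge0_integral_pushforward.
Qed.

End contractions.

Section half_line_integrals.
Context {R : realType}.
Local Notation mu := (@lebesgue_measure R).
Local Open Scope ereal_scope.

(** With a = sqrt (x^2 - h^2) one has x - a = h^2 / (x + a), which decreases in x. The proof
    compares the products (x - a)(x + a) and (y - b)(y + b), both equal to h^2, and so needs no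
    division. It provides the monotonicity of [rho] in [le_integral_hypot]. *)
Lemma sqrtB_nondecreasing (h x y : R) : (0 < h)%R -> (h <= x)%R -> (x <= y)%R ->
  (Num.sqrt (x ^+ 2 - h ^+ 2) - x <= Num.sqrt (y ^+ 2 - h ^+ 2) - y)%R.
Proof.
move=> h0 hx xy.
set a := Num.sqrt _; set b := Num.sqrt (y ^+ 2 - _).
have a0 : (0 <= a)%R by exact: sqrtr_ge0.
have b0 : (0 <= b)%R by exact: sqrtr_ge0.
have a2 : (a ^+ 2 = x ^+ 2 - h ^+ 2)%R by rewrite sqr_sqrtr//; nra.
have b2 : (b ^+ 2 = y ^+ 2 - h ^+ 2)%R by rewrite sqr_sqrtr//; nra.
have ab : (a <= b)%R by rewrite ler_wsqrtr// lerD2r; nra.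
have ax : (a <= x)%R by nra.
rewrite leNgt; apply/negP => lt.
have : (0 < (x - a - (y - b)) * - (y + b))%R by nra.
have : (0 <= (x - a) * (y + b - (x + a)))%R by apply: mulr_ge0; lra.
nra.
Qed.

Lemma le_integral_hypot (h : R) (M : R -> \bar R) : (0 < h)%R ->
  measurable_fun [set: measurableTypeR R] M -> (forall r, 0 <= M r) ->
  \int[mu]_(r in `]h, +oo[) M r <=
  \int[mu]_(v in `]0%R, +oo[) M (Num.sqrt (h ^+ 2 + v ^+ 2)).
Proof.
move=> h0 mM M0.
(* The contraction has to live on the whole line: for v <= 0 it is continued by h + v, whose values
   do not exceed h and therefore miss the domain ]h, +oo[. Accordingly r + [rho] r is sqrt (r^2 -
   h^2) for r > h and r - h otherwise. *)
pose s (v : R) : R := (Num.sqrt (h ^+ 2 + Num.max 0 v ^+ 2) + Num.min 0 v)%R.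
pose rho (r : R) : R := (Num.sqrt (Num.max h r ^+ 2 - h ^+ 2) - Num.max h r)%R.
have maxc (a : R) : continuous (fun v : R => Num.max a v).
  by move=> x; apply: continuous_max => //; exact: cvg_cst.
have cs : continuous s.
  move=> x; apply: cvgD.
    apply: (@continuous_comp _ _ _ (fun v : R => h ^+ 2 + Num.max 0 v ^+ 2)%R); last exact: sqrt_continuous.
    apply: cvgD; first exact: cvg_cst.
    by apply: cvgM; exact: maxc.
  by apply: (@continuous_min _ _ (fun=> 0%R) id) => //; exact: cvg_cst.
have cr : continuous rho.
  move=> x; apply: cvgB; last exact: maxc.
  apply: (@continuous_comp _ _ _ (fun v : R => Num.max h v ^+ 2 - h ^+ 2)%R); last exact: sqrt_continuous.
  apply: cvgB; last exact: cvg_cst.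
  by apply: cvgM; exact: maxc.
rewrite integral_mkcond [leRHS]integral_mkcond.
pose f := M \_ `]h, +oo[%classic.
have mf : measurable_fun [set: measurableTypeR R] f.
  by apply/(measurable_restrictT M) => //; exact: measurable_funTS.
apply: (@le_trans _ _ (\int[mu]_x f (s x))).
  apply: (@le_integral_comp_contraction _ s rho) => //.
  - exact: continuous_measurable_fun.
  - move=> x y xy; apply: sqrtB_nondecreasing => //; first by rewrite le_max lexx.
    by rewrite ge_max !le_max lexx xy !orbT.
  - move=> v b; rewrite /s /rho.
    have [v0|v0] := ltP 0%R v; have [hb|bh] := ltP h b.
    + rewrite addr0 subrKC.
      have bh0 : (0 <= b ^+ 2 - h ^+ 2)%R by nra.
      have := sqrtr_ge0 (b ^+ 2 - h ^+ 2); have := sqr_sqrtr bh0.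
      have hv0 : (0 <= h ^+ 2 + v ^+ 2)%R by nra.
      have := sqrtr_ge0 (h ^+ 2 + v ^+ 2); have := sqr_sqrtr hv0.
      move: (Num.sqrt _) (Num.sqrt _) => p q p2 p0 q2 q0.
      by apply/idP/idP => pb; nra.
    + rewrite addr0 subrr sqrtr0 add0r.
      have hv0 : (0 <= h ^+ 2 + v ^+ 2)%R by nra.
      have := sqrtr_ge0 (h ^+ 2 + v ^+ 2); have := sqr_sqrtr hv0.
      move: (Num.sqrt _) => p p2 p0.
      have ? : (h <= p)%R by nra.
      by apply/idP/idP => pb; nra.
    + rewrite expr0n/= addr0 sqrtr_sqr (gtr0_norm h0) subrKC.
      have := sqrtr_ge0 (b ^+ 2 - h ^+ 2); move: (Num.sqrt _) => p p0.
      by apply/idP/idP => pb; lra.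
    + rewrite expr0n/= addr0 sqrtr_sqr (gtr0_norm h0) subrr sqrtr0.
      by apply/idP/idP => pb; lra.
  - by move=> x; rewrite /f/patch; case: ifP.
rewrite le_eqVlt; apply/orP; left; apply/eqP; apply: eq_integral => v _.
rewrite /f /patch !mem_setE !in_itv/= !andbT /s.
have [v0|v0] := ltP 0%R v.
  rewrite addr0 ifT//.
  have hv0 : (0 <= h ^+ 2 + v ^+ 2)%R by nra.
  have := sqrtr_ge0 (h ^+ 2 + v ^+ 2); have := sqr_sqrtr hv0.
  by move: (Num.sqrt _) => p p2 p0; nra.
rewrite expr0n/= addr0 sqrtr_sqr (gtr0_norm h0) ifF//.
by apply/negbTE; rewrite -leNgt; lra.
Qed.

Lemma ge0_integral_even (k : R -> \bar R) : measurable_fun [set: measurableTypeR R] k ->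
  (forall r, 0 <= k r) -> (forall r, k (- r)%R = k r) ->
  \int[mu]_x k x = \int[mu]_(x in `]0%R, +oo[) k x + \int[mu]_(x in `]0%R, +oo[) k x.
Proof.
move=> mk k0 ek.
have -> : \int[mu]_(x in `]0%R, +oo[) k x = \int[mu]_(x in `[0%R, +oo[) k x.
  by rewrite integral_itv_obnd_cbnd//; exact: measurable_funTS.
rewrite {2}ge0_integration_by_substitution0//.
under [X in _ = _ + X]eq_integral do rewrite ek.
rewrite -integral_itv_obnd_cbnd; last exact: measurable_funTS.
rewrite addeC -ge0_integral_setU//=.
- congr integral; apply/seteqP; split => // x _ /=; rewrite !in_itv/= andbT.
  by case: ltP; [right|left].
- exact: measurable_funTS.
- rewrite disj_set2E; apply/eqP; rewrite -subset0 => x [/=].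
  by rewrite !in_itv/= andbT => /le_lt_trans /[apply]; rewrite ltxx.
Qed.

(** On each half line the map v |-> sqrt (h^2 + v^2) misses only ]0, h], where [M] is at most [B].
    The loss is added on the right because both integrals may be infinite here. *)
Lemma le_integral_even_hypot (h B : R) (M : R -> \bar R) : (0 < h)%R ->
  measurable_fun [set: measurableTypeR R] M -> (forall r, 0 <= M r) ->
  (forall r, M r <= B%:E) ->
  \int[mu]_v M `|v|%R <= \int[mu]_v M (Num.sqrt (h ^+ 2 + v ^+ 2)) + (2 * h * B)%:E.
Proof.
move=> h0 mM M0 MB.
have msq : measurable_fun [set: measurableTypeR R] (fun v : measurableTypeR R =>
    M (Num.sqrt (h ^+ 2 + v ^+ 2))).
  apply: (measurableT_comp mM); apply: continuous_measurable_fun => x.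
  apply: (@continuous_comp _ _ _ (fun v : R => h ^+ 2 + v ^+ 2)%R); last exact: sqrt_continuous.
  apply: cvgD; first exact: cvg_cst.
  by apply: cvgM; exact: cvg_id.
have mab : measurable_fun [set: measurableTypeR R] (fun v : measurableTypeR R => M `|v|%R).
  by apply: (measurableT_comp mM); exact: normr_measurable.
rewrite ge0_integral_even//; last by move=> r; rewrite normrN.
rewrite [X in _ <= X + _]ge0_integral_even//; last by move=> r; rewrite sqrrN.
have -> : (2 * h * B)%:E = (h * B)%:E + (h * B)%:E by rewrite -EFinD; congr (_%:E); ring.
rewrite [leRHS]addeACA; suff H : \int[mu]_(v in `]0%R, +oo[) M `|v|%R <=
    \int[mu]_(v in `]0%R, +oo[) M (Num.sqrt (h ^+ 2 + v ^+ 2)) + (h * B)%:E.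
  exact: leeD.
have -> : \int[mu]_(v in `]0%R, +oo[) M `|v|%R = \int[mu]_(v in `]0%R, +oo[) M v.
  by apply: eq_integral => v; rewrite inE/= in_itv/= andbT => v0; rewrite gtr0_norm.
have E : `]0%R, +oo[%classic = `]h, +oo[%classic `|` `]0%R, h]%classic.
  rewrite setUC; apply/seteqP; split => x /=; rewrite !in_itv/= ?andbT.
    by move=> x0; have [xh|xh] := leP x h; [left; rewrite x0|right].
  by case=> [/andP[]//|]; exact: lt_trans.
rewrite [X in integral _ X _ <= _]E ge0_integral_setU//; last 2 first.
- exact: measurable_funTS.
- rewrite disj_set2E; apply/eqP; rewrite -subset0 => x [/=].
  by rewrite !in_itv/= andbT => /lt_le_trans + /andP[_] => /[apply]; rewrite ltxx.
apply: leeD; first exact: le_integral_hypot.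
apply: (@le_trans _ _ (\int[mu]_(v in `]0%R, h]) (cst B%:E) v)).
  by apply: ge0_le_integral => //; exact: measurable_funTS.
rewrite integral_cst//= lebesgue_measure_itv/= lte_fin h0 sube0 -EFinM lee_fin.
by rewrite mulrC.
Qed.

Lemma ge0_integral_translate_itv (a b c : R) (f : R -> \bar R) :
  measurable_fun [set: measurableTypeR R] f -> (forall x, 0 <= f x) ->
  \int[mu]_(x in `[b, c[) f (x + a)%R = \int[mu]_(x in `[(b + a)%R, (c + a)%R[) f x.
Proof.
move=> mf f0; rewrite integral_mkcond [RHS]integral_mkcond.
rewrite -[RHS](ge0_integral_translate a).
- by apply: eq_integral => x _; rewrite /patch !mem_setE !in_itv/= lerD2r ltrD2r.
- by apply/(measurable_restrictT f) => //; exact: measurable_funTS.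
- by move=> x; rewrite /patch; case: ifP.
Qed.

(** For [a] in this range a single piece of the shifted period lies beyond pi; moved back by 2 pi it
    fills exactly the gap left at - pi. *)
Lemma ge0_integral_periodic (a : R) (p : R -> \bar R) :
  measurable_fun [set: measurableTypeR R] p -> (forall x, 0 <= p x) ->
  (forall x, p (x + 2 * pi)%R = p x) -> (0 <= a <= 2 * pi)%R ->
  \int[mu]_(x in `[(- pi)%R, pi[) p (x + a)%R = \int[mu]_(x in `[(- pi)%R, pi[) p x.
Proof.
move=> mp p0 per /andP[a0 a2]; have pi0 := pi_gt0 R.
rewrite ge0_integral_translate_itv//.
have -> : `[(- pi + a)%R, (pi + a)%R[%classic =
    `[(- pi + a)%R, pi[%classic `|` `[(- pi + 2 * pi)%R, (- pi + a + 2 * pi)%R[%classic.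
  apply/seteqP; split => x /=; rewrite !in_itv/=.
    move=> /andP[x1 x2]; have [|] := ltP x pi; [left|right]; first by rewrite x1.
    by apply/andP; split; lra.
  by case=> /andP[? ?]; apply/andP; split; lra.
rewrite ge0_integral_setU//; last 2 first.
- exact: measurable_funTS.
- rewrite disj_set2E; apply/eqP; rewrite -subset0 => x [/=].
  by rewrite !in_itv/= => /andP[? ?] /andP[? ?]; lra.
rewrite -[X in _ + X](ge0_integral_translate_itv (2 * pi))//.
under [X in _ + X]eq_integral do rewrite per.
rewrite addeC -ge0_integral_setU//=.
- congr integral; apply/seteqP; split => x /=; rewrite !in_itv/=.
    by case=> /andP[? ?]; apply/andP; split; lra.
  move=> /andP[x1 x2]; have [|] := ltP x (- pi + a)%R; [left|right]; last by rewrite x2 andbT.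
  by rewrite x1.
- exact: measurable_funTS.
- rewrite disj_set2E; apply/eqP; rewrite -subset0 => x [/=].
  by rewrite !in_itv/= => /andP[? ?] /andP[? ?]; lra.
Qed.

End half_line_integrals.

Section square_of_integral.
Local Open Scope ereal_scope.
Context d (T : measurableType d) (R : realType) (mu : {measure set T -> \bar R}).

(** Cauchy-Schwarz against the constant 1. Integrating 2 c g <= c^2 + g^2 over [A] and choosing c =
    y / l, where y is the integral of g, gives the bound without any integrability assumption. *)
Lemma sqr_integral_le (A : set T) (l : R) (g : T -> \bar R) :
  measurable A -> mu A = l%:E -> (0 < l)%R -> measurable_fun A g -> (forall x, 0 <= g x) ->
  (\int[mu]_(x in A) g x) * (\int[mu]_(x in A) g x) <=
    l%:E * \int[mu]_(x in A) (g x * g x).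
Proof.
move=> mA Al l0 mg g0.
have gg0 x : 0 <= g x * g x by rewrite mule_ge0.
have mgg : measurable_fun A (fun x => g x * g x) by exact: emeasurable_funM.
have key (c : R) : (0 <= c)%R ->
    (2 * c)%:E * \int[mu]_(x in A) g x <= (c ^+ 2 * l)%:E + \int[mu]_(x in A) (g x * g x).
  move=> c0.
  have -> : (c ^+ 2 * l)%:E = \int[mu]_(x in A) (c ^+ 2)%:E.
    by rewrite integral_cst//= Al EFinM.
  rewrite -ge0_integralZl_EFin ?mulr_ge0// -ge0_integralD//; last first.
    by move=> x _; rewrite lee_fin sqr_ge0.
  apply: ge0_le_integral => //.
  - by move=> x _; rewrite mule_ge0// lee_fin mulr_ge0.
  - exact: measurable_funeM.
  - by apply: emeasurable_funD.
  - move=> x _; have := g0 x; case: (g x) => [r|_|//].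
      by rewrite lee_fin -!EFinM -EFinD lee_fin => r0; have := sqr_ge0 (c - r)%R; nra.
    by rewrite mulyy addey// leey.
have B0 : 0 <= \int[mu]_(x in A) (g x * g x) by exact: integral_ge0.
have X0 : 0 <= \int[mu]_(x in A) g x by exact: integral_ge0.
move: B0 X0 key; case: (\int[mu]_(x in A) (g x * g x)) => [b|_|//].
  case: (\int[mu]_(x in A) g x) => [y|_|//].
    rewrite !lee_fin => b0 y0 key.
    have yl0 : (0 <= y / l)%R by rewrite divr_ge0// ltW.
    have := key _ yl0; rewrite -!EFinM -EFinD !lee_fin => H.
    rewrite -(ler_pM2l (_ : 0 < l^-1)%R) ?invr_gt0//.
    rewrite [leRHS]mulrA mulVf ?gt_eqF// mul1r.
    have E : ((y / l) ^+ 2 * l = l^-1 * (y * y))%R by field; rewrite gt_eqF.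
    have E2 : (2 * (y / l) * y = 2 * (l^-1 * (y * y)))%R by field; rewrite gt_eqF.
    by rewrite E E2 in H; lra.
  (* With c = 1, a finite integral of g^2 excludes an infinite integral of g. *)
  move=> _ /(_ 1%R ler01) K; exfalso; move: K.
  by rewrite gt0_muley ?lte_fin ?mulr_gt0// -EFinD leye_eq.
by move=> _ _; rewrite gt0_muley ?lte_fin// leey.
Qed.

End square_of_integral.

(** * Chord integrals and their increments *)

Section tonelli_domains.
Local Open Scope ereal_scope.
Context d1 d2 (T1 : measurableType d1) (T2 : measurableType d2) (R : realType).
Variables (m1 : {sigma_finite_measure set T1 -> \bar R})
          (m2 : {sigma_finite_measure set T2 -> \bar R}).
Variables (f : T1 * T2 -> \bar R) (D1 : set T1) (D2 : set T2).
Hypotheses (mD1 : measurable D1) (mD2 : measurable D2)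
  (mf : measurable_fun setT f) (f0 : forall x, 0 <= f x).

Lemma measurable_integral_snd :
  measurable_fun setT (fun x => \int[m2]_(y in D2) f (x, y)).
Proof.
pose g := f \_ (setT `*` D2).
have mg : measurable_fun setT g.
  apply/(measurable_restrictT f); first exact: measurableX.
  exact: measurable_funTS.
rewrite (_ : (fun _ => _) = fubini_F m2 g).
  by apply: measurable_fun_fubini_tonelli_F => // x; rewrite /g /patch; case: ifP.
apply/funext => x; rewrite integral_mkcond; apply: eq_integral => y _.
by rewrite /g /patch in_setX in_setT.
Qed.

Lemma measurable_integral_fst :
  measurable_fun setT (fun y => \int[m1]_(x in D1) f (x, y)).
Proof.
pose g := f \_ (D1 `*` setT).
have mg : measurable_fun setT g.
  apply/(measurable_restrictT f); first exact: measurableX.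
  exact: measurable_funTS.
rewrite (_ : (fun _ => _) = fubini_G m1 g).
  by apply: measurable_fun_fubini_tonelli_G => // x; rewrite /g /patch; case: ifP.
apply/funext => x; rewrite integral_mkcond; apply: eq_integral => y _.
by rewrite /g /patch in_setX in_setT andbT.
Qed.

Lemma tonelli_domains : \int[m1]_(x in D1) \int[m2]_(y in D2) f (x, y) =
  \int[m2]_(y in D2) \int[m1]_(x in D1) f (x, y).
Proof.
pose g := f \_ (D1 `*` D2).
have mg : measurable_fun setT g.
  apply/(measurable_restrictT f); first exact: measurableX.
  exact: measurable_funTS.
have := fubini_tonelli g mg (m1 := m1) (m2 := m2).
have g0 x : 0 <= g x by rewrite /g /patch; case: ifP.
move=> /(_ g0) E; transitivity (\int[m1]_x \int[m2]_y g (x, y)).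
  rewrite integral_mkcond; apply: eq_integral => x _; rewrite /g /patch.
  case: ifP => xD; last by rewrite integral0_eq// => y _; rewrite in_setX xD.
  rewrite integral_mkcond; apply: eq_integral => y _.
  by rewrite /patch in_setX xD.
rewrite E [RHS]integral_mkcond; apply: eq_integral => y _; rewrite /g /patch.
case: ifP => yD; last by rewrite integral0_eq// => x _; rewrite in_setX yD andbF.
rewrite [RHS]integral_mkcond; apply: eq_integral => x _.
by rewrite /patch in_setX yD andbT.
Qed.

Lemma tonelli_setX : \int[m1 \x m2]_(x in D1 `*` D2) f x =
  \int[m1]_(x in D1) \int[m2]_(y in D2) f (x, y).
Proof.
rewrite integral_mkcond fubini_tonelli1.
- rewrite [RHS]integral_mkcond; apply: eq_integral => x _.
  rewrite /fubini_F /patch; case: ifP => xD.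
    rewrite [RHS]integral_mkcond; apply: eq_integral => y _.
    by rewrite /patch in_setX xD.
  by rewrite integral0_eq// => y _; rewrite in_setX xD.
- apply/(measurable_restrictT f); first exact: measurableX.
  exact: measurable_funTS.
- by move=> x; rewrite /patch; case: ifP.
Qed.

End tonelli_domains.
Arguments measurable_integral_snd {d1 d2 T1 T2 R m2} f {D2}.
Arguments measurable_integral_fst {d1 d2 T1 T2 R m1} f {D1}.
Arguments tonelli_domains {d1 d2 T1 T2 R m1 m2} f {D1 D2}.
Arguments tonelli_setX {d1 d2 T1 T2 R m1 m2} f {D1 D2}.

Definition turn {R : realType} (p : R) (x : plane R) : plane R :=
  (x.1 * cos p - x.2 * sin p, x.1 * sin p + x.2 * cos p).
Arguments turn : simpl never.

Section chords.
Context {R : realType}.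
Local Open Scope ereal_scope.

Lemma measurable_cosR d (T : measurableType d) (f : T -> R) :
  measurable_fun setT f -> measurable_fun setT (fun x => cos (f x)).
Proof.
by apply: measurableT_comp; apply: continuous_measurable_fun; exact: continuous_cos.
Qed.

Lemma measurable_sinR d (T : measurableType d) (f : T -> R) :
  measurable_fun setT f -> measurable_fun setT (fun x => sin (f x)).
Proof.
by apply: measurableT_comp; apply: continuous_measurable_fun; exact: continuous_sin.
Qed.

Lemma measurable_turn d (T : measurableType d) (p : T -> R) (x : T -> plane R) :
  measurable_fun setT p -> measurable_fun setT x ->
  measurable_fun setT (fun t => turn (p t) (x t)).
Proof.
move=> mp mx.
have mc := measurable_cosR mp; have ms := measurable_sinR mp.
have m1 : measurable_fun setT (fun t => (x t).1) by exact: measurableT_comp.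
have m2 : measurable_fun setT (fun t => (x t).2) by exact: measurableT_comp.
apply: measurable_plane_pair.
- by apply: measurable_funB; apply: measurable_funM.
- by apply: measurable_funD; apply: measurable_funM.
Qed.

Lemma ge0_integral_turn (p : R) (f : plane R -> \bar R) :
  measurable_fun setT f -> (forall x, 0 <= f x) ->
  \int[leb2]_x f (turn p x) = \int[leb2]_x f x.
Proof. by move=> mf f0; exact: (ge0_integral_rotation (cos2Dsin2 p)). Qed.

Lemma turn_normsq (p : R) (x : plane R) :
  ((turn p x).1 ^+ 2 + (turn p x).2 ^+ 2 = x.1 ^+ 2 + x.2 ^+ 2)%R.
Proof.
transitivity ((x.1 ^+ 2 + x.2 ^+ 2) * (cos p ^+ 2 + sin p ^+ 2))%R.
  by rewrite /turn/=; ring.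
by rewrite cos2Dsin2 mulr1.
Qed.

Lemma turnD (p : R) (x y : plane R) :
  turn p (x.1 + y.1, x.2 + y.2)%R = ((turn p x).1 + (turn p y).1, (turn p x).2 + (turn p y).2)%R.
Proof. by rewrite /turn/=; congr pair; ring. Qed.

(** The polar angle [a] is the same for all [p], so an integral over a full turn sees only the
    radius. Its range is the one that [ge0_integral_periodic] accepts; for v < 0 the value of acos
    is reflected to 2 pi - acos. *)
Lemma exists_polar (h v : R) : exists2 a, (0 <= a <= 2 * pi)%R &
  forall p, turn p (h, v) = turn (p + a) (Num.sqrt (h ^+ 2 + v ^+ 2), 0%R).
Proof.
have hv0 : (0 <= h ^+ 2 + v ^+ 2)%R by rewrite addr_ge0 ?sqr_ge0.
have := sqr_sqrtr hv0; have := sqrtr_ge0 (h ^+ 2 + v ^+ 2)%R.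
move: (Num.sqrt _) => r r0 r2; have pi0 := pi_gt0 R.
suff [a a2 [ha va]] : exists2 a, (0 <= a <= 2 * pi)%R & h = (r * cos a)%R /\ v = (r * sin a)%R.
  by exists a => // p; rewrite /turn/= ha va cosD sinD; congr pair; ring.
have [r00|rn0] := eqVneq r 0%R.
  exists 0%R; first by rewrite lexx mulr_ge0// ltW.
  by rewrite r00 expr0n/= in r2; rewrite r00 !mul0r; split; nra.
have rp : (0 < r)%R by rewrite lt_neqAle eq_sym rn0.
have hr : (h ^+ 2 <= r ^+ 2)%R by rewrite r2 lerDl sqr_ge0.
have hr1 : (-1 <= h / r <= 1)%R.
  by rewrite ler_pdivlMr// ler_pdivrMr//; apply/andP; split; nra.
have hK : (r * cos (acos (h / r)) = h)%R by rewrite acosK// mulrC divfK.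
have := sin_acos hr1; have q1 : (0 <= 1 - (h / r) ^+ 2)%R by nra.
have := sqr_sqrtr q1; have := sqrtr_ge0 (1 - (h / r) ^+ 2)%R.
move: (Num.sqrt _) => q q0 q2 sq.
have rqv : ((r * q) ^+ 2 = v ^+ 2)%R.
  rewrite exprMn q2 mulrBr mulr1 -exprMn mulrC divfK// r2; ring.
have rq0 : (0 <= r * q)%R by rewrite mulr_ge0// ltW.
have a0 := acos_ge0 hr1; have api := acos_lepi hr1.
have [v0|v0] := leP 0%R v.
  exists (acos (h / r)); first by apply/andP; split; lra.
  by rewrite sq hK; split => //; nra.
exists (2 * pi - acos (h / r))%R; first by apply/andP; split; lra.
have -> : (2 * pi - acos (h / r) = - acos (h / r) + pi *+ 2)%R by rewrite mulr2n; ring.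
by rewrite cosD2pi sinD2pi cosN sinN sq hK; split => //; nra.
Qed.

End chords.

Section chord_integrals.
Context {R : realType}.
Local Notation mu := (@lebesgue_measure R).
Local Open Scope ereal_scope.
Variable F : plane R -> R.
Hypotheses (mF : measurable_fun setT F) (F0 : forall x, (0 <= F x)%R)
  (Fdisk : forall x, ~ disk x -> F x = 0%R).

Definition chord (p s : R) : \bar R := \int[mu]_t (F (turn p (s, t)))%:E.

Definition autocorrelation (z : plane R) : \bar R :=
  \int[leb2]_x (F x * F (x.1 + z.1, x.2 + z.2))%:E.

Definition sqnorm : \bar R := \int[leb2]_x (F x ^+ 2)%:E.

Lemma chord_ge0 p s : 0 <= chord p s.
Proof. by apply: integral_ge0 => t _; rewrite lee_fin. Qed.

Lemma measurable_F_turn d (T : measurableType d) (p s t : T -> R) :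
  measurable_fun setT p -> measurable_fun setT s -> measurable_fun setT t ->
  measurable_fun setT (fun x => F (turn (p x) (s x, t x))).
Proof.
move=> mp ms mt; apply: (measurableT_comp mF).
by apply: measurable_turn => //; exact: measurable_plane_pair.
Qed.

Lemma measurable_chord2 : measurable_fun setT (fun u : plane R => chord u.2 u.1).
Proof.
have m : measurable_fun setT
    (fun x : (plane R * measurableTypeR R)%type => (F (turn x.1.2 (x.1.1, x.2)))%:E).
  apply/measurable_EFinP; apply: measurable_F_turn => //.
  - exact: (measurableT_comp measurable_snd measurable_fst).
  - exact: (measurableT_comp measurable_fst measurable_fst).
apply: (measurable_fun_fubini_tonelli_F (m2 := mu) _ m).
by move=> x; rewrite lee_fin.
Qed.

Lemma measurable_chord d (T : measurableType d) (p s : T -> R) :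
  measurable_fun setT p -> measurable_fun setT s ->
  measurable_fun setT (fun x => chord (p x) (s x)).
Proof.
move=> mp ms.
have m := measurable_plane_pair ms mp.
exact: (measurableT_comp measurable_chord2 m).
Qed.

Lemma turn_disk p s t : ~ (s ^+ 2 + t ^+ 2 < 1)%R -> F (turn p (s, t)) = 0%R.
Proof.
move=> st; apply: Fdisk => H; apply: st; move: H; rewrite /disk/mkset.
by rewrite (turn_normsq p (s, t)). Qed.

(** The line meets the disk only for t in [-1, 1], and Cauchy-Schwarz on this interval contributes
    its length 2. *)
Lemma sqr_chord_le p s :
  chord p s * chord p s <= 2%:E * \int[mu]_t (F (turn p (s, t)) ^+ 2)%:E.
Proof.
have mFr : measurable_fun setT (fun t : measurableTypeR R => F (turn p (s, t))).
  by apply: measurable_F_turn => //; exact: measurable_cst.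
have -> : chord p s = \int[mu]_(t in `[(-1)%R, 1%R]) (F (turn p (s, t)))%:E.
  rewrite /chord [RHS]integral_mkcond; apply: eq_integral => t _.
  rewrite /patch mem_setE in_itv/=; case: ifPn => // nt.
  rewrite turn_disk// => st; move/negP: nt; apply; apply/andP; split; nra.
have -> : \int[mu]_t (F (turn p (s, t)) ^+ 2)%:E =
    \int[mu]_(t in `[(-1)%R, 1%R]) ((F (turn p (s, t)))%:E * (F (turn p (s, t)))%:E).
  rewrite [RHS]integral_mkcond; apply: eq_integral => t _.
  rewrite /patch mem_setE in_itv/= -EFinM -expr2; case: ifPn => // nt.
  rewrite turn_disk ?expr0n// => st; move/negP: nt; apply; apply/andP; split; nra.
apply: sqr_integral_le => //.
- rewrite /= lebesgue_measure_itv/= lte_fin ifT; last by lra.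
  by rewrite -EFinB; congr (_%:E); ring.
- by apply/measurable_EFinP; exact: measurable_funTS.
- by move=> t; rewrite lee_fin.
Qed.

Lemma integral_F_turn p (h : plane R -> \bar R) : measurable_fun setT h ->
  (forall x, 0 <= h x) ->
  \int[mu]_s \int[mu]_t (h (turn p (s, t))) = \int[leb2]_x h x.
Proof.
move=> mh h0; rewrite -(ge0_integral_turn p)// tonelli_leb2//.
by apply: (measurableT_comp mh); apply: measurable_turn => //; exact: measurable_cst.
Qed.

Lemma integral_sqr_chord p : \int[mu]_s (chord p s * chord p s) <= 2%:E * sqnorm.
Proof.
have mF2 : measurable_fun setT (fun x : plane R => (F x ^+ 2)%:E).
  by apply/measurable_EFinP; exact: measurable_funX.
rewrite /sqnorm -(integral_F_turn p)//; last by move=> x; rewrite lee_fin sqr_ge0.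
have mi : measurable_fun [set: measurableTypeR R]
    (fun s : measurableTypeR R => \int[mu]_t (F (turn p (s, t)) ^+ 2)%:E).
  apply: (measurable_fun_fubini_tonelli_F (m2 := mu) (fun x : plane R => (F (turn p x) ^+ 2)%:E)).
    apply: (measurableT_comp mF2); apply: measurable_turn => //; exact: measurable_cst.
  by move=> x; rewrite lee_fin sqr_ge0.
rewrite -ge0_integralZl//; last first.
  by move=> s _; apply: integral_ge0 => t _; rewrite lee_fin sqr_ge0.
have mc : measurable_fun [set: measurableTypeR R] (fun s : measurableTypeR R => chord p s).
  by apply: measurable_chord => //; exact: measurable_cst.
apply: ge0_le_integral => //.
- by move=> s _; rewrite mule_ge0 ?chord_ge0.
- exact: emeasurable_funM.
- exact: measurable_funeM.
- by move=> s _; exact: sqr_chord_le.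
Qed.

(** If the second line is parametrized by t + v, the displacement between the two points is
    [turn p (h, v)], whatever s and t are. Integrating over (s, t) before v thus leaves the
    autocorrelation at this displacement. *)
Lemma integral_chord_shift p h :
  \int[mu]_s (chord p s * chord p (s + h)%R) =
  \int[mu]_v autocorrelation (turn p (h, v)).
Proof.
have mc : measurable_fun [set: measurableTypeR R] (fun s : measurableTypeR R => chord p s).
  by apply: measurable_chord => //; exact: measurable_cst.
have mF1 s : measurable_fun [set: measurableTypeR R]
    (fun t : measurableTypeR R => F (turn p (s, t))).
  by apply: measurable_F_turn => //; exact: measurable_cst.
have mG d (T : measurableType d) (a b c : T -> R) : measurable_fun setT a ->
    measurable_fun setT b -> measurable_fun setT c ->
    measurable_fun setT (fun x => (F (turn p (a x, b x)) * F (turn p (a x + h, b x + c x)))%:E)%R.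
  move=> ma mb mc'; apply/measurable_EFinP; apply: measurable_funM.
    by apply: measurable_F_turn => //; exact: measurable_cst.
  by apply: measurable_F_turn; [exact: measurable_cst|exact: measurable_funD|exact: measurable_funD].
pose K (x : plane R) v := (F (turn p x) * F (turn p (x.1 + h, x.2 + v)))%:E.
have K0 x v : 0 <= K x v by rewrite lee_fin mulr_ge0.
transitivity (\int[mu]_s \int[mu]_t \int[mu]_v K (s, t) v).
  apply: eq_integral => s _.
  rewrite {1}/chord -ge0_integralZr//; last 3 first.
  - exact/measurable_EFinP.
  - by move=> t _; rewrite lee_fin.
  - exact: chord_ge0.
  apply: eq_integral => t _.
  under [RHS]eq_integral do rewrite /K EFinM.
  have mFt : measurable_fun [set: measurableTypeR R] (fun v : measurableTypeR R =>
      (F (turn p (s + h, t + v)))%:E)%R.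
    apply/measurable_EFinP; apply: measurable_F_turn => //; try exact: measurable_cst.
    exact: measurable_funD.
  rewrite ge0_integralZl ?lee_fin//; last by move=> v _; rewrite lee_fin.
  congr (_ * _).
  transitivity (\int[mu]_v (F (turn p ((s + h)%R, (v + t)%R)))%:E); last first.
    by apply: eq_integral => v _; rewrite [(v + t)%R]addrC.
  apply/esym/(ge0_integral_translate t (f := fun v => (F (turn p ((s + h)%R, v)))%:E)).
  - exact/measurable_EFinP.
  - by move=> v; rewrite lee_fin.
transitivity (\int[mu]_v \int[leb2]_x K x v); last first.
  apply: eq_integral => v _; rewrite /autocorrelation -[RHS](ge0_integral_turn p).
  - by apply: eq_integral => x _; rewrite /K -turnD.
  - apply/measurable_EFinP; apply: measurable_funM => //; apply: (measurableT_comp mF).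
    by apply: measurable_plane_pair; apply: measurable_funD.
  - by move=> x; rewrite lee_fin mulr_ge0.
transitivity (\int[mu]_s \int[mu]_v \int[mu]_t K (s, t) v).
  apply: eq_integral => s _.
  apply: (fubini_tonelli (m1 := mu) (m2 := mu) (fun x => K (s, x.1) x.2)) => //.
  by apply: (mG _ (plane R) (cst s) fst snd) => //; exact: measurable_cst.
rewrite (fubini_tonelli (m1 := mu) (m2 := mu) (fun x => \int[mu]_t K (x.1, t) x.2)).
- apply: eq_integral => v _; rewrite tonelli_leb2//.
  by apply: (mG _ (plane R) fst snd (cst v)) => //; exact: measurable_cst.
- apply: (measurable_fun_fubini_tonelli_F (m2 := mu)
    (fun x : (plane R * measurableTypeR R)%type => K (x.1.1, x.2) x.1.2)) => //.
  apply: (mG _ (plane R * measurableTypeR R)%type (fst \o fst) snd (snd \o fst)) => //;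
  exact: measurableT_comp.
- by move=> x; exact: integral_ge0.
Qed.

Lemma measurable_autocorrelation : measurable_fun setT autocorrelation.
Proof.
have mG : measurable_fun setT (fun x : ((plane R * measurableTypeR R) * measurableTypeR R)%type =>
    (F (x.1.2, x.2) * F (x.1.2 + x.1.1.1, x.2 + x.1.1.2))%:E)%R.
  have m12 : measurable_fun setT
      (fun x : ((plane R * measurableTypeR R) * measurableTypeR R)%type => x.1.2).
    exact: (measurableT_comp measurable_snd measurable_fst).
  have m11 : measurable_fun setT
      (fun x : ((plane R * measurableTypeR R) * measurableTypeR R)%type => x.1.1).
    exact: (measurableT_comp measurable_fst measurable_fst).
  apply/measurable_EFinP; apply: measurable_funM.
    by apply: (measurableT_comp mF); exact: measurable_plane_pair.
  apply: (measurableT_comp mF); apply: measurable_plane_pair; apply: measurable_funD => //.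
  - exact: (measurableT_comp measurable_fst m11).
  - exact: (measurableT_comp measurable_snd m11).
have g0 x : 0 <= (F (x.1.2, x.2) * F (x.1.2 + x.1.1.1, x.2 + x.1.1.2)%R)%:E.
  by rewrite lee_fin mulr_ge0.
have := measurable_fun_fubini_tonelli_F (m2 := mu) _ mG g0.
move=> /(measurable_fun_fubini_tonelli_F (m2 := mu)) m.
rewrite (_ : autocorrelation = (fun z => \int[mu]_s \int[mu]_t
    (F (s, t) * F (s + z.1, t + z.2)%R)%:E)).
  by apply: m => x; apply: integral_ge0 => t _; exact: g0.
apply/funext => z; rewrite /autocorrelation tonelli_leb2//.
- apply/measurable_EFinP; apply: measurable_funM => //; apply: (measurableT_comp mF).
  by apply: measurable_plane_pair; apply: measurable_funD.
- by move=> x; rewrite lee_fin mulr_ge0.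
Qed.

Lemma autocorrelation_ge0 z : 0 <= autocorrelation z.
Proof. by apply: integral_ge0 => x _; rewrite lee_fin mulr_ge0. Qed.

(** From a b <= (a^2 + b^2) / 2 and the translation invariance of the plane measure. *)
Lemma autocorrelation_le z : autocorrelation z <= sqnorm.
Proof.
have mF2 : measurable_fun setT (fun x : plane R => (2^-1 * F x ^+ 2)%:E).
  by apply/measurable_EFinP; apply: measurable_funM => //; exact: measurable_funX.
have mt : measurable_fun setT (fun x : plane R => (x.1 + z.1, x.2 + z.2)%R : plane R).
  by apply: measurable_plane_pair; apply: measurable_funD.
have h0 x : 0 <= (2^-1 * F x ^+ 2)%:E by rewrite lee_fin mulr_ge0// sqr_ge0.
have -> : sqnorm = \int[leb2]_x ((2^-1 * F x ^+ 2)%:E +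
    (2^-1 * F (x.1 + z.1, x.2 + z.2)%R ^+ 2)%:E).
  rewrite ge0_integralD//; last exact: (measurableT_comp mF2 mt).
  rewrite (ge0_integral_plane_translate z mF2)// -ge0_integralD//.
  by apply: eq_integral => x _; rewrite -EFinD; congr (_%:E); lra.
apply: ge0_le_integral => //.
- by move=> x _; rewrite lee_fin mulr_ge0.
- apply/measurable_EFinP; apply: measurable_funM => //; exact: (measurableT_comp mF mt).
- by apply: emeasurable_funD => //; exact: (measurableT_comp mF2 mt).
- move=> x _; rewrite -EFinD lee_fin.
  by have := sqr_ge0 (F x - F (x.1 + z.1, x.2 + z.2))%R; lra.
Qed.

End chord_integrals.

Section chord_increments.
Context {R : realType}.
Local Notation mu := (@lebesgue_measure R).
Local Open Scope ereal_scope.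
Variable F : plane R -> R.
Hypotheses (mF : measurable_fun setT F) (F0 : forall x, (0 <= F x)%R)
  (Fdisk : forall x, ~ disk x -> F x = 0%R).
Variable (N : R).
Hypothesis FN : sqnorm F = N%:E.

Let chord0 := chord_ge0 F0.
Let mchord := @measurable_chord R F mF F0.

(** An infinite chord integral becomes 0 here; by [ae_chord_fin] this happens, for every angle, only
    on a null set of offsets. *)
Definition chordr (p s : R) : R := fine (chord F p s).

Lemma measurable_chordr d (T : measurableType d) (p s : T -> R) :
  measurable_fun setT p -> measurable_fun setT s ->
  measurable_fun setT (fun x => chordr (p x) (s x)).
Proof.
by move=> mp ms; apply: (measurableT_comp (fine_measurable measurableT)); exact: mchord.
Qed.

Lemma integral_sqr_chord_shift p h :
  \int[mu]_s (chord F p (s + h)%R * chord F p (s + h)%R) =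
  \int[mu]_s (chord F p s * chord F p s).
Proof.
rewrite (ge0_integral_translate h (f := fun s => chord F p s * chord F p s))//.
- by apply: emeasurable_funM; apply: mchord => //; exact: measurable_cst.
- by move=> s; rewrite mule_ge0.
Qed.

Lemma integral_sqr_chord_fin p : \int[mu]_s (chord F p s * chord F p s) <= (2 * N)%:E.
Proof. by rewrite EFinM -FN; exact: integral_sqr_chord. Qed.

(** A function whose square has a finite integral is finite almost everywhere. The shift is part of
    the statement so that both values of an increment can be replaced at the same s. *)
Lemma ae_chord_fin p h : {ae mu, forall s, chord F p (s + h)%R = (chordr p (s + h))%:E}.
Proof.
have mc : measurable_fun [set: measurableTypeR R]
    (fun s : measurableTypeR R => chord F p (s + h)%R * chord F p (s + h)%R).
  by apply: emeasurable_funM; apply: mchord; [exact: measurable_cst|exact: measurable_funD|exact: measurable_cst|exact: measurable_funD].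
have : mu.-integrable setT (fun s => chord F p (s + h)%R * chord F p (s + h)%R).
  apply/integrableP; split => //.
  under eq_integral do rewrite gee0_abs ?mule_ge0//.
  by rewrite integral_sqr_chord_shift (le_lt_trans (integral_sqr_chord_fin p))// ltry.
move/(integrable_ae measurableT); apply: filterS => s /(_ I) H.
rewrite /chordr fineK//; move: H (chord0 p (s + h)%R).
by case: (chord F p (s + h)%R) => //; rewrite mulyy.
Qed.

(** This integrates (b - a)^2 + 2 a b = a^2 + b^2, valid where both chords are finite. Both squares
    integrate to the correlation at h = 0. The cross term stays on the left since extended reals
    allow no unconditional cancellation. *)
Lemma integral_chord_increment p h :
  \int[mu]_s ((chordr p (s + h) - chordr p s) ^+ 2)%:E +
    2%:E * \int[mu]_v autocorrelation F (turn p (h, v)) =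
  2%:E * \int[mu]_v autocorrelation F (turn p (0, v))%R.
Proof.
have m0 : measurable_fun [set: measurableTypeR R] (fun s : measurableTypeR R => chord F p s).
  by apply: mchord => //; exact: measurable_cst.
have mh : measurable_fun [set: measurableTypeR R]
    (fun s : measurableTypeR R => chord F p (s + h)%R).
  by apply: mchord; [exact: measurable_cst|exact: measurable_funD].
have mr : measurable_fun [set: measurableTypeR R]
    (fun s : measurableTypeR R => ((chordr p (s + h) - chordr p s) ^+ 2)%:E).
  apply/measurable_EFinP/measurable_funX/measurable_funB; apply: measurable_chordr => //;
  first [exact: measurable_cst|exact: measurable_funD].
rewrite -!integral_chord_shift//.
transitivity (\int[mu]_s (((chordr p (s + h) - chordr p s) ^+ 2)%:E +
    2%:E * (chord F p s * chord F p (s + h)%R))).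
  rewrite ge0_integralD//.
  - congr (_ + _); rewrite ge0_integralZl//; first exact: emeasurable_funM.
    by move=> s _; rewrite mule_ge0.
  - by move=> s _; rewrite lee_fin sqr_ge0.
  - by move=> s _; rewrite !mule_ge0.
  - by apply: measurable_funeM; exact: emeasurable_funM.
transitivity (\int[mu]_s (chord F p s * chord F p s + chord F p (s + h)%R * chord F p (s + h)%R)).
  apply: ge0_ae_eq_integral => //.
  - by apply: emeasurable_funD => //; apply: measurable_funeM; exact: emeasurable_funM.
  - by apply: emeasurable_funD; exact: emeasurable_funM.
  - by move=> s _; rewrite adde_ge0 ?lee_fin ?sqr_ge0// !mule_ge0.
  - by move=> s _; rewrite adde_ge0// mule_ge0.
  - apply: (@filterS2 _ _ (ae_filter_ringOfSetsType mu) _ _ _ _ (ae_chord_fin p 0) (ae_chord_fin p h)) => s.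
    rewrite addr0 => -> -> _.
    by rewrite -!EFinM -!EFinD; congr (_%:E); ring.
rewrite ge0_integralD//; last 4 first.
- by move=> s _; rewrite mule_ge0.
- exact: emeasurable_funM.
- by move=> s _; rewrite mule_ge0.
- exact: emeasurable_funM.
rewrite integral_sqr_chord_shift.
under [in RHS]eq_integral do rewrite addr0.
have : 0 <= \int[mu]_s (chord F p s * chord F p s).
  by apply: integral_ge0 => s _; rewrite mule_ge0.
case: (\int[mu]_s (chord F p s * chord F p s)) => // [r|] _.
  by rewrite -EFinD -EFinM; congr (_%:E); ring.
by rewrite gt0_muley.
Qed.

(** Only finiteness is at stake, as the licence to cancel the cross term of
    [integral_chord_increment]; hence the crude a b <= a^2 + b^2. *)
Lemma integral_autocorrelation_turn_fin p h :
  \int[mu]_v autocorrelation F (turn p (h, v)) <= (4 * N)%:E.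
Proof.
have m0 : measurable_fun [set: measurableTypeR R] (fun s : measurableTypeR R => chord F p s).
  by apply: mchord => //; exact: measurable_cst.
have mh : measurable_fun [set: measurableTypeR R]
    (fun s : measurableTypeR R => chord F p (s + h)%R).
  by apply: mchord; [exact: measurable_cst|exact: measurable_funD].
rewrite -integral_chord_shift//.
apply: (@le_trans _ _ (\int[mu]_s (chord F p s * chord F p s + chord F p (s + h)%R * chord F p (s + h)%R))).
  apply: ge0_le_integral => //.
  - by move=> s _; rewrite mule_ge0.
  - exact: emeasurable_funM.
  - by apply: emeasurable_funD; exact: emeasurable_funM.
  - move=> s _; move: (chord0 p s) (chord0 p (s + h)%R).
    case: (chord F p s) => [a| |]//; case: (chord F p (s + h)%R) => [b| |]//.
    + rewrite !lee_fin => a0 b0.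
      by have := sqr_ge0 (a - b)%R; nra.
    + by move=> _ _; rewrite mulyy addey// leey.
    + by move=> _ _; rewrite mulyy addye// leey.
rewrite ge0_integralD//; last 4 first.
- by move=> s _; rewrite mule_ge0.
- exact: emeasurable_funM.
- by move=> s _; rewrite mule_ge0.
- exact: emeasurable_funM.
rewrite integral_sqr_chord_shift.
have -> : (4 * N)%:E = (2 * N)%:E + (2 * N)%:E by rewrite -EFinD; congr (_%:E); ring.
by apply: leeD; exact: integral_sqr_chord_fin.
Qed.

End chord_increments.

(** The finite [a] can be cancelled; the last hypothesis then makes [b] finite as well. *)
Lemma ereal_double_bound (R : realType) (x a b : \bar R) (c : R) :
  (0 <= b)%E -> a \is a fin_num -> (x + 2%:E * a = 2%:E * b)%E ->
  (b <= a + c%:E)%E -> (x <= (2 * c)%:E)%E.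
Proof.
case: a => // a; case: b => // b _ _.
case: x => [x||] //.
by rewrite -!EFinM -!EFinD => -[E]; rewrite !lee_fin; lra.
Qed.

Section chord_regularity.
Context {R : realType}.
Local Notation mu := (@lebesgue_measure R).
Local Open Scope ereal_scope.
Variable F : plane R -> R.
Hypotheses (mF : measurable_fun setT F) (F0 : forall x, (0 <= F x)%R)
  (Fdisk : forall x, ~ disk x -> F x = 0%R).
Variable (N : R).
Hypothesis FN : sqnorm F = N%:E.

Local Notation circle := `[(- pi)%R, (pi : R)[%classic.

Let mAC := measurable_autocorrelation mF F0.
Let AC0 := autocorrelation_ge0 F0.

(** The M(r) of the overview: an integral over all angles, not divided by 2 pi. *)
Definition circular_mean (r : R) : \bar R :=
  \int[mu]_(p in circle) autocorrelation F (turn p (r, 0%R)).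

Let mturn d (T : measurableType d) (p r t : T -> R) :
  measurable_fun setT p -> measurable_fun setT r -> measurable_fun setT t ->
  measurable_fun setT (fun x => autocorrelation F (turn (p x) (r x, t x))).
Proof.
move=> mp mr mt; apply: (measurableT_comp mAC).
by apply: measurable_turn => //; exact: measurable_plane_pair.
Qed.

Lemma lebesgue_measure_circle : mu circle = (2 * pi)%:E.
Proof.
rewrite /= lebesgue_measure_itv/= lte_fin ifT; last by have := pi_gt0 R; lra.
by rewrite -EFinB; congr (_%:E); ring.
Qed.

Lemma circular_mean_ge0 r : 0 <= circular_mean r.
Proof. by apply: integral_ge0 => p _; exact: AC0. Qed.

Lemma measurable_circular_mean : measurable_fun [set: measurableTypeR R] circular_mean.
Proof.
apply: (measurable_integral_snd (m2 := mu)
  (fun x : plane R => autocorrelation F (turn x.2 (x.1, 0%R)))) => //.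
by apply: mturn => //; exact: measurable_cst.
Qed.

Lemma circular_mean_le r : circular_mean r <= (2 * pi * N)%:E.
Proof.
apply: (@le_trans _ _ (\int[mu]_(p in circle) (cst N%:E) p)).
  apply: ge0_le_integral => //.
  - by apply: measurable_funTS; apply: mturn => //; exact: measurable_cst.
  - by move=> p _; rewrite /cst -FN; exact: autocorrelation_le.
by rewrite integral_cst//= lebesgue_measure_circle -EFinM lee_fin mulrC.
Qed.

Lemma circular_mean_turn h v :
  \int[mu]_(p in circle) autocorrelation F (turn p (h, v)) =
  circular_mean (Num.sqrt (h ^+ 2 + v ^+ 2)).
Proof.
have [a a2 E] := exists_polar h v.
under eq_integral do rewrite E.
rewrite /circular_mean; set r := Num.sqrt _.
apply: (ge0_integral_periodic (p := fun p => autocorrelation F (turn p (r, 0%R)))) => //.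
- by apply: mturn => //; exact: measurable_cst.
- move=> p; rewrite /turn/=; have -> : (p + 2 * pi = p + pi *+ 2)%R by rewrite mulr_natl.
  by rewrite cosD2pi sinD2pi.
Qed.

Lemma integral_circular_mean h :
  \int[mu]_(p in circle) \int[mu]_v autocorrelation F (turn p (h, v)) =
  \int[mu]_v circular_mean (Num.sqrt (h ^+ 2 + v ^+ 2)).
Proof.
have m : measurable_fun setT (fun x : plane R => autocorrelation F (turn x.1 (h, x.2))).
  by apply: mturn => //; exact: measurable_cst.
have f0 (x : plane R) : 0 <= autocorrelation F (turn x.1 (h, x.2)) by exact: AC0.
have mc : measurable (circle : set (measurableTypeR R)) by exact: measurable_itv.
have := tonelli_domains (m1 := mu) (m2 := mu) _ mc measurableT m f0.
move=> /= ->.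
by apply: eq_integral => v _; rewrite circular_mean_turn.
Qed.

Let measurable_increment d (T : measurableType d) (p s h : T -> R) :
  measurable_fun setT p -> measurable_fun setT s -> measurable_fun setT h ->
  measurable_fun setT (fun x => ((chordr F (p x) (s x + h x) - chordr F (p x) (s x)) ^+ 2)%:E)%R.
Proof.
move=> mp ms mh; apply/measurable_EFinP/measurable_funX/measurable_funB;
apply: measurable_chordr => //; exact: measurable_funD.
Qed.

(* For [h > 0], polar coordinates turn the double integral into the difference
   of [\int_v circular_mean |v|] and [\int_v circular_mean (sqrt (h^2 + v^2))]. *)
Lemma chord_increment_le_pos h : (0 < h)%R ->
  \int[mu]_(p in circle) \int[mu]_s ((chordr F p (s + h) - chordr F p s) ^+ 2)%:E <=
  (8 * pi * h * N)%:E.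
Proof.
move=> h0.
have mi : measurable_fun [set: measurableTypeR R] (fun p : measurableTypeR R =>
    \int[mu]_s ((chordr F p (s + h) - chordr F p s) ^+ 2)%:E).
  apply: (measurable_fun_fubini_tonelli_F (m2 := mu)
    (fun x : plane R => ((chordr F x.1 (x.2 + h) - chordr F x.1 x.2) ^+ 2)%:E)%R).
    by apply: measurable_increment => //; exact: measurable_cst.
  by move=> x; rewrite lee_fin sqr_ge0.
have ma k : measurable_fun [set: measurableTypeR R] (fun p : measurableTypeR R =>
    \int[mu]_v autocorrelation F (turn p (k, v))).
  apply: (measurable_fun_fubini_tonelli_F (m2 := mu)
    (fun x : plane R => autocorrelation F (turn x.1 (k, x.2)))) => //.
  by apply: mturn => //; exact: measurable_cst.
have a0 k p : 0 <= \int[mu]_v autocorrelation F (turn p (k, v)).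
  by apply: integral_ge0 => v _; exact: AC0.
have i0 p : 0 <= \int[mu]_s ((chordr F p (s + h) - chordr F p s) ^+ 2)%:E.
  by apply: integral_ge0 => v _; rewrite lee_fin sqr_ge0.
have E : \int[mu]_(p in circle) \int[mu]_s ((chordr F p (s + h) - chordr F p s) ^+ 2)%:E
    + 2%:E * \int[mu]_(p in circle) \int[mu]_v autocorrelation F (turn p (h, v)) =
    2%:E * \int[mu]_(p in circle) \int[mu]_v autocorrelation F (turn p (0%R, v)).
  have EZ k : 2%:E * \int[mu]_(p in circle) \int[mu]_v autocorrelation F (turn p (k, v)) =
      \int[mu]_(p in circle) (2%:E * \int[mu]_v autocorrelation F (turn p (k, v))).
    rewrite ge0_integralZl//; exact: measurable_funS (ma k).
  rewrite [X in _ + X = _](EZ h) [RHS](EZ 0%R); transitivity (\int[mu]_(p in circle)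
      (\int[mu]_s ((chordr F p (s + h) - chordr F p s) ^+ 2)%:E +
       2%:E * \int[mu]_v autocorrelation F (turn p (h, v)))).
    apply/esym; apply: ge0_integralD => //.
    - exact: measurable_funS mi.
    - by move=> p _; rewrite mule_ge0.
    - by apply: measurable_funeM; exact: measurable_funS (ma h).
  by apply: eq_integral => p _; rewrite (integral_chord_increment mF F0 Fdisk FN).
move: E; rewrite [X in _ + _ * X = _](integral_circular_mean h) [X in _ = _ * X](integral_circular_mean 0%R).
have E0 : \int[mu]_v circular_mean (Num.sqrt (0 ^+ 2 + v ^+ 2)) = \int[mu]_v circular_mean `|v|%R.
  by apply: eq_integral => v _; rewrite expr0n/= add0r sqrtr_sqr.
rewrite [X in _ = _ * X]E0 => {E0} E.
(* The bound 2 pi N of [circular_mean] costs 2 h (2 pi N) in [le_integral_even_hypot], and the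
   factor 2 of the cross term doubles it. *)
have -> : (8 * pi * h * N)%:E = (2 * (2 * h * (2 * pi * N)))%:E by congr (_%:E); ring.
apply: (ereal_double_bound _ _ E).
- by apply: integral_ge0 => v _; exact: circular_mean_ge0.
- rewrite -(integral_circular_mean h) ge0_fin_numE; last by apply: integral_ge0 => p _.
  apply: (@le_lt_trans _ _ (\int[mu]_(p in circle) (cst (4 * N)%:E) p)).
    apply: ge0_le_integral => //; first exact: measurable_funS (ma h).
    by move=> p _; exact: (integral_autocorrelation_turn_fin mF F0 Fdisk FN).
  by rewrite integral_cst//= lebesgue_measure_circle -EFinM ltry.
- exact: (le_integral_even_hypot h0 measurable_circular_mean circular_mean_ge0 circular_mean_le).
Qed.

Lemma chord_increment_le h :
  \int[mu]_(p in circle) \int[mu]_s ((chordr F p (s + h) - chordr F p s) ^+ 2)%:E <=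
  (8 * pi * `|h| * N)%:E.
Proof.
have [h0|h0|->] := ltgtP h 0%R.
- rewrite (_ : integral _ _ _ = \int[mu]_(p in circle) \int[mu]_s
      ((chordr F p (s + - h) - chordr F p s) ^+ 2)%:E).
    by rewrite ltr0_norm//; apply: chord_increment_le_pos; rewrite oppr_gt0.
  apply: eq_integral => p _.
  rewrite -[RHS](ge0_integral_translate h).
  - by apply: eq_integral => s _; rewrite addrK -sqrrN opprB.
  - by apply: measurable_increment => //; exact: measurable_cst.
  - by move=> s; rewrite lee_fin sqr_ge0.
- by rewrite gtr0_norm//; exact: chord_increment_le_pos.
- rewrite normr0 mulr0 mul0r integral0_eq// => p _; rewrite integral0_eq// => s _.
  by rewrite addr0 subrr expr0n.
Qed.

End chord_regularity.

(** * The discrete Radon transform of a nonnegative function *)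

Section trig.
Context {R : realType}.
Lemma lipschitz_of_deriv (f df : R -> R) : (forall x : R, is_derive x 1 f (df x)) ->
  (forall x, `|df x| <= 1) -> forall x y : R, `|f x - f y| <= `|x - y|.
Proof.
move=> fd df1.
suff H x y : x <= y -> `|f y - f x| <= `|y - x|.
  move=> x y; have [xy|yx] := leP x y; last exact/H/ltW.
  by rewrite distrC (distrC x); exact: H.
rewrite le_eqVlt => /predU1P[->|xy]; first by rewrite !subrr !normr0.
have [|z _ ->] := @MVT R f df x y xy (fun z _ => fd z).
  apply: continuous_subspaceT => z; apply: differentiable_continuous.
  by apply/derivable1_diffP; have := fd z; case.
by rewrite normrM ler_piMl.
Qed.

Lemma cos_lipschitz (x y : R) : `|cos x - cos y| <= `|x - y|.
Proof.
apply: (@lipschitz_of_deriv _ (fun x => - sin x)) => z.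
by rewrite normrN ler_norml sin_geN1 sin_le1.
Qed.

Lemma sin_lipschitz (x y : R) : `|sin x - sin y| <= `|x - y|.
Proof.
apply: (@lipschitz_of_deriv _ cos) => z.
by rewrite ler_norml cos_geN1 cos_le1.
Qed.

Lemma cos_sin_periodz (x : R) (k : int) :
  cos (x + k%:~R * (2 * pi)) = cos x /\ sin (x + k%:~R * (2 * pi)) = sin x.
Proof.
have E (n : nat) (z : R) : z + n%:R * (2 * pi) = z + (pi *+ 2) *+ n.
  by rewrite !mulr_natl.
have C (n : nat) (z : R) : cos (z + n%:R * (2 * pi)) = cos z.
  by rewrite E (periodicn (@cosD2pi R)).
have S (n : nat) (z : R) : sin (z + n%:R * (2 * pi)) = sin z.
  by rewrite E (periodicn (@sinD2pi R)).
case: k => n; first by rewrite -pmulrn C S.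
rewrite NegzE mulrNz -pmulrn mulNr.
have := C n.+1 (x - n.+1%:R * (2 * pi)); rewrite subrK => ->.
by have := S n.+1 (x - n.+1%:R * (2 * pi)); rewrite subrK => ->.
Qed.
End trig.

(** * Geometry of the offset, pixel and angle cells *)

Section cells.
Context {R : realType}.

Lemma cell_inj (h : R) (n i j : nat) (x : R) : 0 < h ->
  cell h (grid_node h n i) x -> cell h (grid_node h n j) x -> i = j.
Proof.
rewrite /cell /grid_node /= !in_itv/= => h0 /andP[i1 i2] /andP[j1 j2].
have H1 : (i%:R < j.+1%:R :> R) by rewrite -natr1 -(ltr_pM2l h0); lra.
have H2 : (j%:R < i.+1%:R :> R) by rewrite -natr1 -(ltr_pM2l h0); lra.
by apply/eqP; rewrite eqn_leq -ltnS -(ltr_nat R) H1 -ltnS -(ltr_nat R) H2.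
Qed.

Lemma cell_dist (h c x : R) : cell h c x -> `|c - x| <= h / 2.
Proof.
by rewrite /cell/= in_itv/= => /andP[? ?]; rewrite ler_norml; apply/andP; split; lra.
Qed.

Variable D : discretization R.
Local Notation Q := (nangle D).
Local Notation w := (wrap_angles Q (angle D)).

Lemma nangle_gt0 : (0 < Q)%N.
Proof.
have : cylinder ((0, 0) : plane R).
  rewrite /cylinder/=; split => /=; rewrite in_itv/=; have := pi_gt0 R => ?.
    by apply/andP; split; lra.
  by apply/andP; split; lra.
by move=> /(@cylinder_covered _ D)[[p q] /= [_ /andP[q0 qQ]] _]; exact: leq_trans qQ.
Qed.

Lemma wrap_angles0 : w 0 = angle D Q - 2 * pi.
Proof. by []. Qed.

Lemma wrap_anglesS : w Q.+1 = angle D 1 + 2 * pi.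
Proof. by rewrite /wrap_angles/= eqxx. Qed.

Lemma wrap_angles_mid q : (1 <= q <= Q)%N -> w q = angle D q.
Proof.
move=> /andP[q0 qQ]; rewrite /wrap_angles gtn_eqF// ltn_eqF//.
Qed.

Lemma wrap_angles_incr q : (q <= Q)%N -> w q <= w q.+1.
Proof.
move=> qQ; have Q0 := nangle_gt0.
have pi0 := pi_gt0 R.
have /andP[aQ1 aQ2] : - pi <= angle D Q < pi by apply: angle_range; rewrite Q0 leqnn.
have /andP[a11 a12] : - pi <= angle D 1 < pi by apply: angle_range; rewrite Q0.
have [q0|q0] := posnP q.
  by rewrite q0 wrap_angles0 wrap_angles_mid ?Q0//; lra.
rewrite wrap_angles_mid ?q0//; have [qeq|qlt] := eqVneq q Q.
  by rewrite qeq wrap_anglesS; lra.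
have qQ' : (q.+1 <= Q)%N by rewrite ltn_neqAle qlt.
by rewrite wrap_angles_mid//; apply/ltW/angle_incr.
Qed.

Lemma wrap_angles_le q r : (q <= r)%N -> (r <= Q.+1)%N -> w q <= w r.
Proof.
move=> + rQ; elim: r rQ => [_|r IH rQ]; first by rewrite leqn0 => /eqP ->.
rewrite leq_eqVlt => /predU1P[->//|]; rewrite ltnS => qr.
exact: (le_trans (IH (ltnW rQ) qr) (wrap_angles_incr rQ)).
Qed.

Lemma wrap_gap_le q : (1 <= q <= Q)%N -> w q.+1 - w q <= dphi D.
Proof.
move=> qQ; rewrite /dphi /angle_width; apply: (le_bigmax_seq _ _ xpredT (fun q => w q.+1 - w q)) => //.
by rewrite mem_index_iota ltnS.
Qed.

Lemma dphi_ge0 : 0 <= dphi D.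
Proof.
have Q0 := nangle_gt0.
apply: (le_trans _ (@wrap_gap_le 1 _)); last by rewrite Q0.
by rewrite subr_ge0 wrap_angles_incr.
Qed.

Lemma angle_cell_dist q a : (1 <= q <= Q)%N -> angle_cell Q (angle D) q a ->
  exists k : int, `|a + k%:~R * (2 * pi) - angle D q| <= dphi D / 2.
Proof.
move=> /andP[q0 qQ] [k]; rewrite in_itv/= => /andP[k1 k2]; exists k.
move: k1 k2; rewrite (@wrap_angles_mid q) ?q0// => k1 k2.
have := @wrap_gap_le q; rewrite q0 qQ => /(_ isT); rewrite (@wrap_angles_mid q) ?q0// => g1.
(* The gap before the first angle does not occur in [angle_width], but shifted by a full turn it is
   the gap after the last one. *)
have g2 : angle D q - w q.-1 <= dphi D.
  case: q q0 qQ {k1 k2 g1} => // -[_ _|q _ qQ].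
    have := @wrap_gap_le Q; rewrite nangle_gt0 leqnn => /(_ isT).
    rewrite wrap_anglesS wrap_angles_mid ?nangle_gt0 ?leqnn// wrap_angles0/=; lra.
  have := @wrap_gap_le q.+1; rewrite /= => /(_ (ltnW qQ)).
  by rewrite (@wrap_angles_mid q.+2).
by rewrite ler_norml; apply/andP; split; lra.
Qed.

Lemma angle_cell_trig q a : (1 <= q <= Q)%N -> angle_cell Q (angle D) q a ->
  `|cos (angle D q) - cos a| <= dphi D / 2 /\ `|sin (angle D q) - sin a| <= dphi D / 2.
Proof.
move=> qQ /(angle_cell_dist qQ)[k ak]; rewrite distrC in ak.
have [<- <-] := cos_sin_periodz a k.
by split; apply: le_trans ak; [exact: cos_lipschitz|exact: sin_lipschitz].
Qed.

(** With b n the left end of the n-th cell, the cells occupy consecutive intervals of the single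
    period [b 1, b 1 + 2 pi[. Two translates of [a] in one period coincide, so k = l, and
    consecutive half-open intervals are disjoint. *)
Lemma angle_cell_inj q r a : (1 <= q <= Q)%N -> (1 <= r <= Q)%N ->
  angle_cell Q (angle D) q a -> angle_cell Q (angle D) r a -> q = r.
Proof.
pose b n := (w n.-1 + w n) / 2.
have ble n m : (n <= m)%N -> (m <= Q.+1)%N -> b n <= b m.
  move=> nm mQ; have H1 := wrap_angles_le nm mQ.
  have H2 : w n.-1 <= w m.-1.
    apply: wrap_angles_le; last exact: leq_trans (leq_pred m) mQ.
    by rewrite -!subn1 leq_sub2r.
  by rewrite /b; lra.
have bQ : b Q.+1 = b 1%N + 2 * pi.
  rewrite /b wrap_anglesS/= wrap_angles0 !wrap_angles_mid ?nangle_gt0 ?leqnn//; lra.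
move=> /andP[q0 qQ] /andP[r0 rQ] [k]; rewrite in_itv/= => /andP[k1 k2] [l].
rewrite in_itv/= => /andP[l1 l2].
have pi0 := pi_gt0 R.
have kb1 : b 1%N <= a + k%:~R * (2 * pi) by apply: (le_trans _ k1); exact: (ble 1%N q q0 (leqW qQ)).
have lb1 : b 1%N <= a + l%:~R * (2 * pi) by apply: (le_trans _ l1); exact: (ble 1%N r r0 (leqW rQ)).
have kb2 : a + k%:~R * (2 * pi) < b 1%N + 2 * pi.
  by rewrite -bQ; apply: (lt_le_trans k2); exact: (ble q.+1 Q.+1 qQ (leqnn _)).
have lb2 : a + l%:~R * (2 * pi) < b 1%N + 2 * pi.
  by rewrite -bQ; apply: (lt_le_trans l2); exact: (ble r.+1 Q.+1 rQ (leqnn _)).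
have kl : k = l.
  have pi2 : (0 < 2 * pi :> R) by lra.
  have H1 : (k%:~R < (l + 1)%:~R :> R) by rewrite intrD -(ltr_pM2r pi2); lra.
  have H2 : (l%:~R < (k + 1)%:~R :> R) by rewrite intrD -(ltr_pM2r pi2); lra.
  by rewrite !ltr_int !ltzD1 in H1 H2; apply/eqP; rewrite eq_le H1 H2.
rewrite {}kl in k1 k2 kb1 kb2 *.
have [qr|rq|//] := ltngtP q r.
- have H : b q.+1 <= b r := ble _ _ qr (leqW rQ).
  by exfalso; move: H k2 l1; rewrite /b/=; lra.
- have H : b r.+1 <= b q := ble _ _ rq (leqW qQ).
  by exfalso; move: H l2 k1; rewrite /b/=; lra.
Qed.

End cells.

Section hat_function.
Context {R : realType}.
Local Notation mu := (@lebesgue_measure R).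
Variable D : discretization R.

Lemma hat_ge0 t : 0 <= hat D t.
Proof. by rewrite /hat le_max lexx. Qed.

Lemma hat_le t : hat D t <= ds D.
Proof. by rewrite /hat ge_max (ltW (ds_gt0 D))/= lerBlDr lerDl. Qed.

Lemma hat_eq0 t : ds D <= `|t| -> hat D t = 0.
Proof. by move=> dt; rewrite /hat; apply/max_idPl; rewrite subr_le0. Qed.

Lemma hat_lipschitz a b : `|hat D a - hat D b| <= `|a - b|.
Proof.
have := ler_dist_dist a b; rewrite /hat ler_norml => /andP[h1 h2].
by rewrite ler_norml; apply/andP; split;
  case: (leP 0 (ds D - `|a|)) => ?; case: (leP 0 (ds D - `|b|)) => ?; lra.
Qed.

Lemma measurable_hat d (T : measurableType d) (f : T -> R) :
  measurable_fun setT f -> measurable_fun setT (fun x => hat D (f x)).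
Proof.
move=> mf; apply: measurable_maxr => //; apply: measurable_funB => //.
exact: measurableT_comp.
Qed.

Local Open Scope ereal_scope.

(* Reflecting [0, delta] at its midpoint shows that the two halves of the
   triangle fill a rectangle. *)
Lemma integral_hat (c : R) : \int[mu]_t (hat D (t - c))%:E = (ds D ^+ 2)%:E.
Proof.
have d0 := ds_gt0 D.
have mh : measurable_fun [set: measurableTypeR R] (fun t : measurableTypeR R => (hat D t)%:E).
  by apply/measurable_EFinP; exact: measurable_hat.
have h0 t : 0 <= (hat D t)%:E by rewrite lee_fin hat_ge0.
rewrite (ge0_integral_translate (- c) (f := fun t => (hat D t)%:E))//.
rewrite ge0_integral_even//; last by move=> r; rewrite /hat normrN.
pose f (t : R) : \bar R := (t * \1_(`]0%R, (ds D)[%classic) t)%:E.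
have mf : measurable_fun [set: measurableTypeR R] f.
  by apply/measurable_EFinP/measurable_funM.
have f0 t : 0 <= f t.
  rewrite lee_fin indicE mem_setE in_itv/=.
  by case: ltP => //= t0; [rewrite mulr_ge0// ltW|rewrite mulr0].
have half : \int[mu]_(x in `]0%R, +oo[) (hat D x)%:E = \int[mu]_x f (- x + ds D)%R.
  rewrite integral_mkcond; apply: eq_integral => x _.
  rewrite /patch /f indicE !mem_setE !in_itv/= andbT /hat.
  have [x0|x0] := ltP 0%R x; last first.
    by rewrite (_ : (_ < _)%R && _ = false) ?mulr0//; apply/negbTE/negP => /andP[? ?]; lra.
  rewrite gtr0_norm//; have [xd|xd] := ltP x (ds D).
    rewrite max_r ?subr_ge0 1?ltW// (_ : _ && _ = true) ?mulr1 1?addrC//.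
    by apply/andP; split; lra.
  rewrite max_l ?subr_le0// (_ : (_ < _)%R && _ = false) ?mulr0//.
  by apply/negbTE/negP => /andP[? ?]; lra.
have E1 : \int[mu]_x f (- x + ds D)%R = \int[mu]_x f x.
  rewrite (ge0_integral_opp (f := fun x => f (x + ds D)%R))//.
  - exact: ge0_integral_translate.
  - by apply: (measurableT_comp mf); exact: measurable_funD.
have E2 := etrans half E1.
rewrite [X in X + _]E2 [X in _ + X]integral_mkcond -ge0_integralD//; last 2 first.
- by move=> x _; rewrite /patch; case: ifP.
- by apply/(measurable_restrictT (fun x => (hat D x)%:E)) => //; exact: measurable_funS mh.
transitivity (\int[mu]_(x in `]0%R, (ds D)[) (cst (ds D)%:E x)).
  rewrite [RHS]integral_mkcond; apply: eq_integral => x _.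
  rewrite /patch /f indicE !mem_setE !in_itv/= andbT /hat.
  have [x0|x0] := ltP 0%R x; last by rewrite mulr0 adde0.
  rewrite gtr0_norm// -EFinD; have [xd|xd] := ltP x (ds D).
    rewrite mulr1 /= max_r; last by rewrite subr_ge0 ltW.
    by congr (_%:E); ring.
  by rewrite mulr0 max_l ?addr0// subr_le0.
by rewrite integral_cst//= lebesgue_measure_itv/= lte_fin d0 sube0 -EFinM expr2.
Qed.
End hat_function.

Section pixel_weights.
Context {R : realType}.
Variable D : discretization R.

Definition center_offset (i j p q : nat) : R :=
  (pixel_center D i j).1 * cos (angle D q) + (pixel_center D i j).2 * sin (angle D q)
  - offset D p.

(** The piecewise constant kernel whose integral against the function is the discrete coefficient.
    It has to be compared with the hat function at the exact offset of x. *)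
Definition pixel_weight (p q : nat) (x : plane R) : R :=
  \sum_(1 <= i < (nrow D).+1) \sum_(1 <= j < (ncol D).+1)
    hat D (center_offset i j p q) * \1_(pixel D i j) x.

Lemma measurable_pixel i j : measurable (pixel D i j).
Proof. by apply: measurableX; exact: measurable_itv. Qed.

Lemma pixel_weight_ge0 p q x : 0 <= pixel_weight p q x.
Proof.
by apply: sumr_ge0 => i _; apply: sumr_ge0 => j _; rewrite mulr_ge0 ?hat_ge0.
Qed.

Lemma measurable_pixel_weight p q : measurable_fun setT (pixel_weight p q).
Proof.
apply: measurable_sum => i; apply: measurable_sum => j.
by apply: measurable_funM => //; apply: measurable_indic; exact: measurable_pixel.
Qed.

Lemma pixel_weightE p q x i j : (1 <= i <= nrow D)%N -> (1 <= j <= ncol D)%N ->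
  pixel D i j x -> pixel_weight p q x = hat D (center_offset i j p q).
Proof.
move=> iN jM xij; rewrite /pixel_weight.
rewrite (bigD1_seq i) ?mem_index_iota ?iota_uniq//= (bigD1_seq j) ?mem_index_iota ?iota_uniq//=.
rewrite big1 => [|k kj].
  rewrite big1 => [|k ki].
    by rewrite indicE mem_set// mulr1 !addr0.
  rewrite big1// => l _; rewrite indicE memNset ?mulr0// => -[xk _].
  by move/eqP: ki; apply; exact: (cell_inj (dx_gt0 D) xk xij.1).
rewrite indicE memNset ?mulr0// => -[_ xk].
by move/eqP: kj; apply; exact: (cell_inj (dx_gt0 D) xk xij.2).
Qed.

Lemma pixel_weight_dist p q a s t : (1 <= q <= nangle D)%N ->
  angle_cell (nangle D) (angle D) q a -> disk (turn a (s, t)) ->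
  exists2 c, pixel_weight p q (turn a (s, t)) = hat D (c - offset D p) &
    `|c - s| <= dx D + dphi D.
Proof.
move=> qQ aq xd; have := disk_covered D xd => -[[i j] /= [iN jM] xij].
have [Hc Hs] := angle_cell_trig qQ aq.
set x := turn a (s, t) in xd xij *.
exists ((pixel_center D i j).1 * cos (angle D q) + (pixel_center D i j).2 * sin (angle D q)).
  by rewrite (pixel_weightE _ _ iN jM xij).
have sE : s = x.1 * cos a + x.2 * sin a.
  rewrite /x /turn/=; transitivity (s * (cos a ^+ 2 + sin a ^+ 2)); last by ring.
  by rewrite cos2Dsin2 mulr1.
have c1 := cell_dist xij.1; have c2 := cell_dist xij.2.
have {xd} xd : x.1 ^+ 2 + x.2 ^+ 2 < 1 by exact: xd.
have sqr_lt1 (y z : R) : y ^+ 2 + z ^+ 2 < 1 -> `|y| <= 1.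
  move=> yz; rewrite -(@ler_pXn2r _ 2) ?nnegrE// expr1n real_normK ?num_real//.
  by have := sqr_ge0 z; lra.
have x1 : `|x.1| <= 1 := sqr_lt1 _ _ xd.
have x2 : `|x.2| <= 1 by apply: (sqr_lt1 _ x.1); rewrite addrC.
move: c1 c2; rewrite /= -/(pixel_center D i j); set c := pixel_center D i j => c1 c2.
(* Each coordinate moves by at most dx / 2, and cosine and sine by at most dphi / 2 each. All four
   cofactors are at most 1 in absolute value, those of the angle part because x lies in the disk;
   the sum is dx + dphi. *)
have -> : c.1 * cos (angle D q) + c.2 * sin (angle D q) - s =
   (c.1 - x.1) * cos (angle D q) + (c.2 - x.2) * sin (angle D q) +
   (x.1 * (cos (angle D q) - cos a) + x.2 * (sin (angle D q) - sin a)).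
  by rewrite sE; ring.
have bound (y z A B : R) : `|y| <= A -> `|z| <= B -> `|y * z| <= A * B.
  by move=> yA zB; rewrite normrM ler_pM.
have cos1 : `|cos (angle D q)| <= 1 by rewrite ler_norml cos_geN1 cos_le1.
have sin1 : `|sin (angle D q)| <= 1 by rewrite ler_norml sin_geN1 sin_le1.
have e1 := bound _ _ _ _ c1 cos1; have e2 := bound _ _ _ _ c2 sin1.
have e3 := bound _ _ _ _ x1 Hc; have e4 := bound _ _ _ _ x2 Hs.
apply: (le_trans (ler_normD _ _)).
have := ler_normD ((c.1 - x.1) * cos (angle D q)) ((c.2 - x.2) * sin (angle D q)).
have := ler_normD (x.1 * (cos (angle D q) - cos a)) (x.2 * (sin (angle D q) - sin a)).
by move: e1 e2 e3 e4; rewrite !mulr1 !mul1r; lra.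
Qed.

(** A contribution from s' needs |s' - s| <= ds / 2 + ds + eta, that is half an offset cell, the
    support of the hat and the perturbation of its argument. With eta <= ds this is at most 5/2 ds,
    and 4 ds leaves room. *)
Definition window (s : R) : set R := `[s - 4 * ds D, s + 4 * ds D].

Lemma hat_near p s s' : offset_cell D p s -> hat D (s' - offset D p) <= ds D * \1_(window s) s'.
Proof.
move=> /cell_dist; rewrite indicE /window mem_setE in_itv/= => ps; have d0 := ds_gt0 D.
have [_|w] := boolP (_ <= _ <= _); first by rewrite mulr1 hat_le.
rewrite mulr0 hat_eq0//; move: ps; rewrite ler_norml => /andP[p1 p2].
rewrite ler_normr; apply/orP; move: w; rewrite negb_and -!ltNge => /orP[?|?].
  by right; lra.
by left; lra.
Qed.

Lemma hat_dist p s s' c eta : eta <= ds D -> offset_cell D p s -> `|c - s'| <= eta ->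
  `|hat D (c - offset D p) - hat D (s' - offset D p)| <= eta * \1_(window s) s'.
Proof.
move=> etad /cell_dist + cs; rewrite indicE /window mem_setE in_itv/= => ps.
have d0 := ds_gt0 D.
have [_|w] := boolP (_ <= _ <= _).
  rewrite mulr1; apply: le_trans cs; apply: (le_trans (hat_lipschitz _ _ _)).
  by rewrite opprB addrA subrK.
rewrite mulr0; move: ps cs; rewrite !ler_norml => /andP[p1 p2] /andP[c1 c2].
suff [-> ->] : hat D (c - offset D p) = 0 /\ hat D (s' - offset D p) = 0 by rewrite subrr oppr0 lexx.
split; apply: hat_eq0; rewrite ler_normr; apply/orP; move: w;
  rewrite negb_and -!ltNge => /orP[?|?]; by [right; lra|left; lra].
Qed.

End pixel_weights.

Section discrete_coefficient.
Context {R : realType}.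
Local Notation mu := (@lebesgue_measure R).
Local Open Scope ereal_scope.
Variable D : discretization R.
Variable F : plane R -> R.
Hypotheses (mF : measurable_fun setT F) (F0 : forall x, (0 <= F x)%R)
  (Fdisk : forall x, ~ disk x -> F x = 0%R).
Variable (N : R).
Hypothesis FN : sqnorm F = N%:E.

Let F0' x : 0 <= (F x)%:E.
Proof. by rewrite lee_fin. Qed.

Let mFE : measurable_fun setT (fun x => (F x)%:E).
Proof. exact/measurable_EFinP. Qed.

Lemma patch_disk : F \_ disk = F.
Proof.
apply/funext => x; rewrite /patch; case: ifPn => // /negP xd.
by rewrite Fdisk// => H; apply: xd; rewrite inE.
Qed.

(** From F <= 1 + F^2 on a square of area 4 around the disk. The pixel integrals of
    [discrete_radon_coef] are real numbers obtained by [fine], and only finiteness lets them be read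
    as extended integrals. *)
Lemma integral_lty : \int[leb2]_x (F x)%:E < +oo.
Proof.
pose S : set (plane R) := `[(-1)%R, 1%R] `*` `[(-1)%R, 1%R].
have mS : measurable S by apply: measurableX; exact: measurable_itv.
have mF2 : measurable_fun setT (fun x : plane R => (F x ^+ 2)%:E).
  by apply/measurable_EFinP; exact: measurable_funX.
have m1S : measurable_fun setT (fun x : plane R => (\1_S x : R)%:E).
  by apply/measurable_EFinP; exact: measurable_indic.
have mu1 : mu `[(-1)%R, 1%R]%classic = 2%:E.
  rewrite /= lebesgue_measure_itv/= lte_fin ifT; last by lra.
  by rewrite -EFinB; congr (_%:E); ring.
have muS : leb2 S = 2%:E * 2%:E.
  by rewrite -mu1; apply: product_measure1E; exact: measurable_itv.
apply: (@le_lt_trans _ _ (\int[leb2]_x ((\1_S x)%:E + (F x ^+ 2)%:E))).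
  apply: ge0_le_integral => //.
    exact: emeasurable_funD.
  move=> x _; rewrite -EFinD lee_fin indicE.
  have [xS|xS] := boolP (x \in S); first by have := F0 x; rewrite /=; nra.
  rewrite Fdisk ?expr0n ?addr0// /disk/= => xd.
  move/negP: xS; apply; rewrite inE /S/=; split => /=; rewrite in_itv/=; apply/andP; split; nra.
rewrite ge0_integralD//; last by move=> x _; rewrite lee_fin sqr_ge0.
by rewrite integral_indic// setIT muS -/(sqnorm F) FN -EFinM -EFinD ltry.
Qed.

Lemma discrete_radon_coefE p q :
  (discrete_radon_coef D F p q)%:E = \int[leb2]_x (pixel_weight D p q x * F x)%:E.
Proof.
have mpF i j : measurable_fun setT
    (fun x : plane R => (hat D (center_offset D i j p q) * \1_(pixel D i j) x * F x)%:E).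
  apply/measurable_EFinP/measurable_funM => //; apply: measurable_funM => //.
  by apply: measurable_indic; exact: measurable_pixel.
have p0 i j x : 0 <= (hat D (center_offset D i j p q) * \1_(pixel D i j) x * F x)%:E.
  by rewrite lee_fin !mulr_ge0// hat_ge0.
rewrite /discrete_radon_coef patch_disk -sumEFin.
transitivity (\sum_(1 <= i < (nrow D).+1) \sum_(1 <= j < (ncol D).+1)
    \int[leb2]_x (hat D (center_offset D i j p q) * \1_(pixel D i j) x * F x)%:E).
  apply: eq_bigr => i _; rewrite -sumEFin; apply: eq_bigr => j _.
  rewrite EFinM /Rintegral fineK; last first.
    rewrite ge0_fin_numE; last by apply: integral_ge0 => x _.
    apply: le_lt_trans integral_lty.
    by apply: ge0_subset_integral => //; exact: measurable_pixel.
  rewrite integral_mkcond -ge0_integralZl ?lee_fin ?hat_ge0//.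
  - apply: eq_integral => x _; rewrite /patch indicE; case: ifPn => _.
      by rewrite mulr1 EFinM.
    by rewrite mulr0 mul0r mule0.
  - apply/(measurable_restrictT (fun x => (F x)%:E)); first exact: measurable_pixel.
    exact: measurable_funS mFE.
  - by move=> x _; rewrite /patch; case: ifP.
transitivity (\sum_(1 <= i < (nrow D).+1) \int[leb2]_x \sum_(1 <= j < (ncol D).+1)
    (hat D (center_offset D i j p q) * \1_(pixel D i j) x * F x)%:E).
  by apply: eq_bigr => i _; rewrite ge0_integral_sum.
rewrite -ge0_integral_sum//.
- apply: eq_integral => x _; rewrite /pixel_weight mulr_suml -sumEFin.
  by apply: eq_bigr => i _; rewrite mulr_suml -sumEFin.
- by move=> i; exact: emeasurable_sum.
- by move=> i x _; exact: sume_ge0.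
Qed.

End discrete_coefficient.

(** * The error at one point of the cylinder *)

Section pointwise_error.
Context {R : realType}.
Local Notation mu := (@lebesgue_measure R).
Local Open Scope ereal_scope.
Variable D : discretization R.
Variable F : plane R -> R.
Hypotheses (mF : measurable_fun setT F) (F0 : forall x, (0 <= F x)%R)
  (Fdisk : forall x, ~ disk x -> F x = 0%R).
Variable (N : R).
Hypothesis FN : sqnorm F = N%:E.
Hypothesis etad : (dx D + dphi D <= ds D)%R.
Local Notation eta := (dx D + dphi D)%R.

Lemma chordr_ge0 a s : (0 <= chordr F a s)%R.
Proof. by rewrite fine_ge0// chord_ge0. Qed.

(** The first term pays for replacing the pixel weights by the hat function, the second for
    replacing g(s') by g(s) under the hat. *)
Definition error_density (a s s' : R) : R :=
  (eta * chordr F a s' + ds D * `|chordr F a s' - chordr F a s|)%R.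

Lemma error_density_ge0 a s s' : (0 <= error_density a s s')%R.
Proof.
have := dphi_ge0 D; have := dx_gt0 D; have := ds_gt0 D => d0 x0 p0.
by rewrite /error_density addr_ge0// mulr_ge0 ?chordr_ge0// ?normr_ge0; lra.
Qed.

Lemma measurable_error_density d (T : measurableType d) (a s s' : T -> R) :
  measurable_fun setT a -> measurable_fun setT s -> measurable_fun setT s' ->
  measurable_fun setT (fun x => error_density (a x) (s x) (s' x)).
Proof.
move=> ma ms ms'; apply: measurable_funD.
  by apply: measurable_funM => //; exact: measurable_chordr.
apply: measurable_funM => //; apply: measurableT_comp => //.
by apply: measurable_funB; exact: measurable_chordr.
Qed.

Variables (p q : nat) (a s : R).
Hypotheses (qQ : (1 <= q <= nangle D)%N) (sp : offset_cell D p s)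
  (aq : angle_cell (nangle D) (angle D) q a).
Local Notation g := (chordr F a).
Local Notation W := (pixel_weight D p q).
Local Notation w s' := (\1_(window D s) s' : R).
Local Notation hatp s' := (hat D (s' - offset D p)).

Let slice (s' : R) : \bar R := \int[mu]_t (W (turn a (s', t)) * F (turn a (s', t)))%:E.

Let w0 s' : (0 <= w s')%R.
Proof. by []. Qed.

Let eta0 : (0 <= eta)%R.
Proof. by have := dphi_ge0 D; have := dx_gt0 D; lra. Qed.

Let mslice (s' : R) : measurable_fun [set: measurableTypeR R]
  (fun t : measurableTypeR R => F (turn a (s', t))).
Proof. by apply: measurable_F_turn => //; exact: measurable_cst. Qed.

Let mWslice (s' : R) : measurable_fun [set: measurableTypeR R]
  (fun t : measurableTypeR R => W (turn a (s', t)) * F (turn a (s', t)))%R.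
Proof.
apply: measurable_funM => //; apply: (measurableT_comp (measurable_pixel_weight D p q)).
by apply: measurable_turn; [exact: measurable_cst|apply: measurable_plane_pair => //; exact: measurable_cst].
Qed.

Let pixel_weight_near (s' t : R) :
  (`|W (turn a (s', t)) * F (turn a (s', t)) - hatp s' * F (turn a (s', t))| <=
   eta * w s' * F (turn a (s', t)))%R.
Proof.
have [xd|/negP xd] := boolP (turn a (s', t) \in disk).
  rewrite inE in xd; have [c -> cs] := pixel_weight_dist p qQ aq xd.
  rewrite -mulrBl normrM (ger0_norm (F0 _)) ler_wpM2r//.
  exact: hat_dist.
by rewrite Fdisk ?mulr0 ?subrr ?normr0// => H; apply: xd; rewrite inE.
Qed.

(** This and [slice_ge] are one-sided estimates, since a difference of the two line integrals is
    meaningless for those s' where they are infinite. *)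
Let slice_le s' : slice s' <= ((hatp s' + eta * w s')%:E * chord F a s').
Proof.
have c0 : (0 <= hatp s' + eta * w s')%R by rewrite addr_ge0 ?hat_ge0 ?mulr_ge0.
rewrite /chord -ge0_integralZl//; last 2 first.
- exact/measurable_EFinP.
- by move=> t _; rewrite lee_fin.
apply: ge0_le_integral => //.
- by move=> t _; rewrite lee_fin mulr_ge0 ?pixel_weight_ge0.
- exact/measurable_EFinP.
- by apply: measurable_funeM; exact/measurable_EFinP.
- move=> t _; rewrite -EFinM lee_fin.
  by have := pixel_weight_near s' t; rewrite ler_norml => /andP[_]; lra.
Qed.

Let slice_ge s' : (hatp s')%:E * chord F a s' <= slice s' + (eta * w s')%:E * chord F a s'.
Proof.
have Fs0 t : 0 <= (F (turn a (s', t)))%:E by rewrite lee_fin.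
have mFs : measurable_fun [set: measurableTypeR R]
  (fun t : measurableTypeR R => (F (turn a (s', t)))%:E) by exact/measurable_EFinP.
have ZE c : (0 <= c)%R -> c%:E * chord F a s' = \int[mu]_t (c%:E * (F (turn a (s', t)))%:E).
  by move=> c0; rewrite ge0_integralZl.
rewrite (ZE _ (hat_ge0 _ _)) (ZE _ (mulr_ge0 eta0 (w0 s'))) /slice -ge0_integralD//; last 4 first.
- by move=> t _; rewrite lee_fin mulr_ge0 ?pixel_weight_ge0.
- exact/measurable_EFinP.
- by move=> t _; rewrite mule_ge0// lee_fin mulr_ge0.
- exact: measurable_funeM.
apply: ge0_le_integral => //.
- by move=> t _; rewrite mule_ge0// lee_fin hat_ge0.
- exact: measurable_funeM.
- by apply: emeasurable_funD; [exact/measurable_EFinP|exact: measurable_funeM].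
- move=> t _; rewrite -!EFinM -EFinD lee_fin.
  by have := pixel_weight_near s' t; rewrite ler_norml => /andP[+ _]; lra.
Qed.

Let hat_diff s' : (`|hatp s' * g s' - hatp s' * g s| <= ds D * w s' * `|g s' - g s|)%R.
Proof.
by rewrite -mulrBr normrM (ger0_norm (hat_ge0 _ _)) ler_wpM2r// hat_near.
Qed.

Let slice_ge0 s' : 0 <= slice s'.
Proof. by apply: integral_ge0 => t _; rewrite lee_fin mulr_ge0 ?pixel_weight_ge0. Qed.

Let ae_slice : {ae mu, forall s', [set: measurableTypeR R] s' ->
  slice s' <= (hatp s' * g s)%:E + (w s' * error_density a s s')%:E /\
  (hatp s' * g s)%:E <= slice s' + (w s' * error_density a s s')%:E}.
Proof.
apply: (@filterS _ _ (ae_filter_ringOfSetsType mu) _ _ _ (ae_chord_fin mF F0 Fdisk FN a 0)) => s'.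
rewrite addr0 => cE _; have := slice_le s'; have := slice_ge s'; rewrite {}cE -!EFinM.
have := hat_diff s'; rewrite ler_norml => /andP[h1 h2].
move: (slice_ge0 s'); case: (slice s') => // r.
rewrite -!EFinD !lee_fin /error_density => r0 h3 h4; split; lra.
Qed.

Let slice_integral : \int[mu]_s' slice s' = (discrete_radon_coef D F p q)%:E.
Proof.
rewrite (discrete_radon_coefE D mF F0 Fdisk FN).
rewrite -(integral_F_turn a (h := fun x => (W x * F x)%:E))//.
- by apply/measurable_EFinP/measurable_funM => //; exact: measurable_pixel_weight.
- by move=> x; rewrite lee_fin mulr_ge0 ?pixel_weight_ge0.
Qed.

Let measurable_slice : measurable_fun [set: measurableTypeR R] slice.
Proof.
apply: (measurable_fun_fubini_tonelli_F (m2 := mu)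
  (fun x : plane R => (W (turn a x) * F (turn a x))%:E)).
  have mt : measurable_fun setT (fun x : plane R => turn a x).
    by apply: measurable_turn => //; exact: measurable_cst.
  apply/measurable_EFinP/measurable_funM; last exact: measurableT_comp.
  exact: (measurableT_comp (measurable_pixel_weight D p q) mt).
by move=> x; rewrite lee_fin mulr_ge0 ?pixel_weight_ge0.
Qed.

Let measurable_window_error : measurable_fun [set: measurableTypeR R]
  (fun s' : measurableTypeR R => (w s' * error_density a s s')%:E).
Proof.
apply/measurable_EFinP/measurable_funM; first by apply: measurable_indic; exact: measurable_itv.
by apply: measurable_error_density => //; exact: measurable_cst.
Qed.

Let window_error_ge0 s' : 0 <= (w s' * error_density a s s')%:E.
Proof. by rewrite lee_fin mulr_ge0// error_density_ge0. Qed.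

Let integral_hatp : \int[mu]_s' (hatp s' * g s)%:E = (ds D ^+ 2 * g s)%:E.
Proof.
under eq_integral do rewrite EFinM.
rewrite ge0_integralZr ?lee_fin ?chordr_ge0//.
- by rewrite integral_hat EFinM.
- by apply/measurable_EFinP/measurable_hat; exact: measurable_funB.
- by move=> s' _; rewrite lee_fin hat_ge0.
Qed.

Let mhatp : measurable_fun [set: measurableTypeR R]
  (fun s' : measurableTypeR R => (hatp s' * g s)%:E).
Proof.
by apply/measurable_EFinP/measurable_funM => //; apply: measurable_hat; exact: measurable_funB.
Qed.

Let hatp0 s' : 0 <= (hatp s' * g s)%:E.
Proof. by rewrite lee_fin mulr_ge0 ?hat_ge0 ?chordr_ge0. Qed.

Let eqe_le (x y : \bar R) : x = y -> x <= y.
Proof. by move=> ->. Qed.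

Lemma coef_error :
  (`|discrete_radon_coef D F p q - ds D ^+ 2 * g s|)%:E <=
  \int[mu]_(s' in window D s) (error_density a s s')%:E.
Proof.
have -> : \int[mu]_(s' in window D s) (error_density a s s')%:E =
    \int[mu]_s' (w s' * error_density a s s')%:E.
  rewrite integral_mkcond; apply: eq_integral => s' _.
  by rewrite /patch indicE; case: ifP; rewrite ?mul1r ?mul0r.
have H1 : \int[mu]_s' slice s' <=
    \int[mu]_s' ((hatp s' * g s)%:E + (w s' * error_density a s s')%:E).
  apply: ae_ge0_le_integral => //.
  - by move=> s' _; rewrite adde_ge0.
  - exact: emeasurable_funD.
  - apply: (@filterS _ _ (ae_filter_ringOfSetsType mu) _ _ _ ae_slice) => s' H _.
    by have [] := H I.
have H2 : \int[mu]_s' (hatp s' * g s)%:E <=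
    \int[mu]_s' (slice s' + (w s' * error_density a s s')%:E).
  apply: ae_ge0_le_integral => //.
  - by move=> s' _; rewrite adde_ge0.
  - exact: emeasurable_funD.
  - apply: (@filterS _ _ (ae_filter_ringOfSetsType mu) _ _ _ ae_slice) => s' H _.
    by have [] := H I.
have E1 : \int[mu]_s' ((hatp s' * g s)%:E + (w s' * error_density a s s')%:E) =
    (ds D ^+ 2 * g s)%:E + \int[mu]_s' (w s' * error_density a s s')%:E.
  by rewrite -integral_hatp; apply: ge0_integralD.
have E2 : \int[mu]_s' (slice s' + (w s' * error_density a s s')%:E) =
    (discrete_radon_coef D F p q)%:E + \int[mu]_s' (w s' * error_density a s s')%:E.
  by rewrite -slice_integral; apply: ge0_integralD.
have {H1} H1 := le_trans (eqe_le (esym slice_integral)) (le_trans H1 (eqe_le E1)).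
have {H2} H2 := le_trans (eqe_le (esym integral_hatp)) (le_trans H2 (eqe_le E2)).
move: H1 H2.
move: (\int[mu]_s' (w s' * error_density a s s')%:E) => [r| |].
- rewrite -!EFinD !lee_fin => H1 H2; rewrite ler_norml; apply/andP; split; lra.
- by move=> _ _; rewrite leey.
- by move=> + _; rewrite addeNy leeNy_eq.
Qed.

Lemma lebesgue_measure_window : mu (window D s) = (8 * ds D)%:E.
Proof.
have d0 := ds_gt0 D.
rewrite /= lebesgue_measure_itv/= lte_fin ifT; last by lra.
by rewrite -EFinB; congr (_%:E); ring.
Qed.

(** Cauchy-Schwarz over the window contributes its length 8 ds. The substitution s' = s + h then
    makes the domain of integration independent of s, so that the integrals over s and h can later
    be exchanged. *)
Lemma coef_error_sqr :
  ((discrete_radon_coef D F p q - ds D ^+ 2 * g s) ^+ 2)%:E <=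
  (8 * ds D)%:E * \int[mu]_(h in `[(- (4 * ds D))%R, (4 * ds D)%R])
    (error_density a s (s + h) ^+ 2)%:E.
Proof.
have me : measurable_fun [set: measurableTypeR R]
    (fun s' : measurableTypeR R => (error_density a s s')%:E).
  by apply/measurable_EFinP; apply: measurable_error_density => //; exact: measurable_cst.
have e0 s' : 0 <= (error_density a s s')%:E by rewrite lee_fin error_density_ge0.
have mw : measurable (window D s : set (measurableTypeR R)) by exact: measurable_itv.
apply: (@le_trans _ _ ((\int[mu]_(s' in window D s) (error_density a s s')%:E) *
    \int[mu]_(s' in window D s) (error_density a s s')%:E)).
  rewrite -real_normK ?num_real// expr2 EFinM.
  by apply: lee_pmul; rewrite ?lee_fin// ?coef_error.
have d8 : (0 < 8 * ds D)%R by have := ds_gt0 D; lra.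
apply: (le_trans (sqr_integral_le mw lebesgue_measure_window d8 (measurable_funS measurableT (@subsetT _ _) me) e0)).
rewrite le_eqVlt; apply/orP; left; apply/eqP; congr (_ * _).
rewrite integral_mkcond [RHS]integral_mkcond.
rewrite -[LHS](ge0_integral_translate s).
- apply: eq_integral => h _; rewrite /patch /window !mem_setE !in_itv/=.
  rewrite [(h + s)%R]addrC -EFinM -expr2.
  by rewrite !lerD2l.
- apply/(measurable_restrictT (fun s' => (error_density a s s')%:E * (error_density a s s')%:E)) => //.
  by apply: measurable_funS (emeasurable_funM me me).
- by move=> h; rewrite /patch; case: ifP => // _; rewrite mule_ge0.
Qed.

End pointwise_error.

(** * The error integrated over the cylinder *)

Section integrated_error.
Context {R : realType}.
Local Notation mu := (@lebesgue_measure R).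
Variable D : discretization R.
Local Notation eta := (dx D + dphi D)%R.
Local Notation circle := `[(- pi)%R, (pi : R)[%classic.
Local Notation H := `[(- (4 * ds D))%R, (4 * ds D)%R]%classic.

Lemma discrete_radon_funE (F : plane R -> R) (u : plane R) (p q : nat) :
  (1 <= p <= noffset D)%N -> (1 <= q <= nangle D)%N ->
  offset_cell D p u.1 -> angle_cell (nangle D) (angle D) q u.2 ->
  discrete_radon_fun D F u = (ds D ^+ 2)^-1 * discrete_radon_coef D F p q.
Proof.
move=> pP qQ up uq; rewrite /discrete_radon_fun; congr (_ * _).
rewrite (bigD1_seq q) ?mem_index_iota ?iota_uniq//= (bigD1_seq p) ?mem_index_iota ?iota_uniq//=.
rewrite big1_seq => [|k]; last first.
  move=> /andP[kp _]; rewrite indicE memNset ?mul0r// => uk.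
  by move/eqP: kp; apply; exact: (cell_inj (ds_gt0 D) uk up).
rewrite big1_seq ?addr0 => [|k].
  by rewrite !indicE !mem_set// !mul1r.
move=> /andP[kq]; rewrite mem_index_iota ltnS => kQ; rewrite big1// => l _.
rewrite [X in _ * X * _]indicE memNset ?mulr0 ?mul0r// => uk.
by move/eqP: kq; apply; exact: (angle_cell_inj kQ qQ uk uq).
Qed.

Local Open Scope ereal_scope.
Variable F : plane R -> R.
Hypotheses (mF : measurable_fun setT F) (F0 : forall x, (0 <= F x)%R)
  (Fdisk : forall x, ~ disk x -> F x = 0%R).
Variable (N : R).
Hypothesis FN : sqnorm F = N%:E.
Hypothesis etad : (eta <= ds D)%R.

Let N0 : (0 <= N)%R.
Proof.
by rewrite -lee_fin -FN; apply: integral_ge0 => x _; rewrite lee_fin sqr_ge0.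
Qed.

Let e (a s h : R) : \bar R := (error_density D F a s (s + h) ^+ 2)%:E.

Let e0 a s h : 0 <= e a s h.
Proof. by rewrite lee_fin sqr_ge0. Qed.

Let measurable_e d (T : measurableType d) (a s h : T -> R) :
  measurable_fun setT a -> measurable_fun setT s -> measurable_fun setT h ->
  measurable_fun setT (fun x => e (a x) (s x) (h x)).
Proof.
move=> ma ms mh; apply/measurable_EFinP/measurable_funX.
by apply: measurable_error_density => //; exact: measurable_funD.
Qed.

Lemma discrete_radon_fun_error (u : plane R) : cylinder u ->
  ((discrete_radon_fun D F u - chordr F u.2 u.1) ^+ 2)%:E <=
  (8 * ds D ^- 3)%:E * \int[mu]_(h in H) e u.2 u.1 h.
Proof.
move=> /(@cylinder_covered _ D)[[p q] /= [pP qQ] [up uq]].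
have d0 := ds_gt0 D; have dn0 : ds D != 0%R by rewrite gt_eqF.
rewrite (discrete_radon_funE _ pP qQ up uq).
have -> : ((ds D ^+ 2)^-1 * discrete_radon_coef D F p q - chordr F u.2 u.1 =
    (ds D ^+ 2)^-1 * (discrete_radon_coef D F p q - ds D ^+ 2 * chordr F u.2 u.1))%R.
  by field.
rewrite exprMn EFinM.
(* The squared normalization contributes ds^-4 and [coef_error_sqr] the factor 8 ds. *)
have -> : (8 * ds D ^- 3)%:E = (((ds D ^+ 2)^-1) ^+ 2)%:E * (8 * ds D)%:E.
  by rewrite -EFinM; congr (_%:E); field.
rewrite -muleA; apply: lee_wpmul2l; first by rewrite lee_fin sqr_ge0.
exact: (coef_error_sqr mF F0 Fdisk FN etad qQ up uq).
Qed.

Let mH : measurable (H : set (measurableTypeR R)).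
Proof. exact: measurable_itv. Qed.

Let mcircle : measurable (circle : set (measurableTypeR R)).
Proof. exact: measurable_itv. Qed.

Let measurable_sqr_chordr (a h : R) : measurable_fun [set: measurableTypeR R]
  (fun s : measurableTypeR R => (chordr F a (s + h) ^+ 2)%:E).
Proof.
apply/measurable_EFinP/measurable_funX/measurable_chordr => //.
exact: measurable_funD.
Qed.

Let measurable_increment d (T : measurableType d) (a s h : T -> R) :
  measurable_fun setT a -> measurable_fun setT s -> measurable_fun setT h ->
  measurable_fun setT (fun x => ((chordr F (a x) (s x + h x) - chordr F (a x) (s x)) ^+ 2)%:E).
Proof.
move=> ma ms mh; apply/measurable_EFinP/measurable_funX/measurable_funB;
by apply: measurable_chordr => //; exact: measurable_funD.
Qed.

Lemma integral_sqr_chordr a h : \int[mu]_s (chordr F a (s + h) ^+ 2)%:E <= (2 * N)%:E.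
Proof.
have mc : measurable_fun [set: measurableTypeR R]
    (fun s : measurableTypeR R => chord F a (s + h)%R).
  by apply: measurable_chord => //; first [exact: measurable_cst|exact: measurable_funD].
apply: le_trans (integral_sqr_chord_fin mF F0 Fdisk FN a).
rewrite -(integral_sqr_chord_shift mF F0 a h).
apply: ge0_le_integral => //.
- by move=> s _; rewrite lee_fin sqr_ge0.
- exact: emeasurable_funM.
- move=> s _; rewrite /chordr; have := chord_ge0 F0 a (s + h)%R.
  by case: (chord F a (s + h)%R) => [r| |]//= _; rewrite ?mulyy ?leey// -EFinM lee_fin expr2.
Qed.

(** From (x + y)^2 <= 2 x^2 + 2 y^2. The first term is bounded for each angle by the squared norm 2
    N of the chord integrals; the increment has to wait for the integration over angles. *)
Let integral_e a h : \int[mu]_s e a s h <=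
  (4 * eta ^+ 2 * N)%:E + (2 * ds D ^+ 2)%:E *
    \int[mu]_s ((chordr F a (s + h) - chordr F a s) ^+ 2)%:E.
Proof.
have mi : measurable_fun [set: measurableTypeR R]
    (fun s : measurableTypeR R => ((chordr F a (s + h) - chordr F a s) ^+ 2)%:E).
  by apply: measurable_increment => //; exact: measurable_cst.
have i0 s : 0 <= ((chordr F a (s + h) - chordr F a s) ^+ 2)%:E by rewrite lee_fin sqr_ge0.
have c0 s : 0 <= (chordr F a (s + h) ^+ 2)%:E by rewrite lee_fin sqr_ge0.
have k1 : (0 <= 2 * eta ^+ 2)%R by rewrite mulr_ge0// sqr_ge0.
have k2 : (0 <= 2 * ds D ^+ 2)%R by rewrite mulr_ge0// sqr_ge0.
apply: (@le_trans _ _ (\int[mu]_s ((2 * eta ^+ 2)%:E * (chordr F a (s + h) ^+ 2)%:E +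
    (2 * ds D ^+ 2)%:E * ((chordr F a (s + h) - chordr F a s) ^+ 2)%:E))).
  apply: ge0_le_integral => //.
  - by apply: measurable_e => //; exact: measurable_cst.
  - by apply: emeasurable_funD; exact: measurable_funeM.
  - move=> s _; rewrite /e -!EFinM -EFinD lee_fin /error_density.
    set x := (eta * _)%R; set y := (`|_|)%R.
    have -> : (2 * eta ^+ 2 * chordr F a (s + h) ^+ 2 = 2 * x ^+ 2)%R by rewrite /x; ring.
    rewrite -[X in (_ <= _ + _ * X)%R]real_normK ?num_real// -/y.
    by have := sqr_ge0 (x - ds D * y)%R; nra.
have -> : \int[mu]_s ((2 * eta ^+ 2)%:E * (chordr F a (s + h) ^+ 2)%:E +
    (2 * ds D ^+ 2)%:E * ((chordr F a (s + h) - chordr F a s) ^+ 2)%:E) =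
    (2 * eta ^+ 2)%:E * \int[mu]_s (chordr F a (s + h) ^+ 2)%:E + (2 * ds D ^+ 2)%:E *
    \int[mu]_s ((chordr F a (s + h) - chordr F a s) ^+ 2)%:E.
  rewrite ge0_integralD//.
  - by congr (_ + _); apply: ge0_integralZl.
  - by move=> s _; rewrite mule_ge0.
  - exact: measurable_funeM.
  - by move=> s _; rewrite mule_ge0.
  - exact: measurable_funeM.
apply: leeD => //.
have -> : (4 * eta ^+ 2 * N)%:E = (2 * eta ^+ 2)%:E * (2 * N)%:E.
  by rewrite -EFinM; congr (_%:E); ring.
by apply: lee_wpmul2l; [rewrite lee_fin|exact: integral_sqr_chordr].
Qed.

Let integral_e_circle h : H h ->
  \int[mu]_(a in circle) \int[mu]_s e a s h <=
  (8 * pi * N * (eta ^+ 2 + 8 * ds D ^+ 3))%:E.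
Proof.
rewrite /= in_itv/= => /andP[h1 h2]; have d0 := ds_gt0 D; have pi0 := pi_gt0 R.
have mi : measurable_fun [set: measurableTypeR R] (fun a : measurableTypeR R =>
    \int[mu]_s ((chordr F a (s + h) - chordr F a s) ^+ 2)%:E).
  apply: (measurable_fun_fubini_tonelli_F (m2 := mu)
    (fun x : plane R => ((chordr F x.1 (x.2 + h) - chordr F x.1 x.2) ^+ 2)%:E)).
    by apply: measurable_increment => //; exact: measurable_cst.
  by move=> x; rewrite lee_fin sqr_ge0.
have i0 a : 0 <= \int[mu]_s ((chordr F a (s + h) - chordr F a s) ^+ 2)%:E.
  by apply: integral_ge0 => s _; rewrite lee_fin sqr_ge0.
have k1 : (0 <= 4 * eta ^+ 2 * N)%R by rewrite mulr_ge0// mulr_ge0// sqr_ge0.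
have k2 : (0 <= 2 * ds D ^+ 2)%R by rewrite mulr_ge0// sqr_ge0.
apply: (@le_trans _ _ (\int[mu]_(a in circle) ((4 * eta ^+ 2 * N)%:E + (2 * ds D ^+ 2)%:E *
    \int[mu]_s ((chordr F a (s + h) - chordr F a s) ^+ 2)%:E))).
  apply: ge0_le_integral => //.
  - by move=> a _; apply: integral_ge0 => s _; exact: e0.
  - apply: measurable_funS measurableT (@subsetT _ _) _.
    apply: (measurable_fun_fubini_tonelli_F (m2 := mu) (fun x : plane R => e x.1 x.2 h)) => //.
    by apply: measurable_e => //; exact: measurable_cst.
  - apply: emeasurable_funD => //; apply: measurable_funeM.
    exact: measurable_funS measurableT (@subsetT _ _) mi.
have -> : \int[mu]_(a in circle) ((4 * eta ^+ 2 * N)%:E + (2 * ds D ^+ 2)%:E *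
    \int[mu]_s ((chordr F a (s + h) - chordr F a s) ^+ 2)%:E) =
    \int[mu]_(a in circle) (cst (4 * eta ^+ 2 * N)%:E) a + (2 * ds D ^+ 2)%:E *
    \int[mu]_(a in circle) \int[mu]_s ((chordr F a (s + h) - chordr F a s) ^+ 2)%:E.
  have mi' := measurable_funS measurableT (@subsetT _ circle) mi.
  rewrite ge0_integralD//.
  - by congr (_ + _); apply: ge0_integralZl.
  - by move=> a _; rewrite mule_ge0.
  - exact: measurable_funeM.
rewrite integral_cst//= lebesgue_measure_circle -EFinM.
apply: (@le_trans _ _ ((4 * eta ^+ 2 * N * (2 * pi))%:E + (2 * ds D ^+ 2)%:E * (8 * pi * `|h| * N)%:E)).
  by apply: leeD => //; apply: lee_wpmul2l; [rewrite lee_fin|exact: (chord_increment_le mF F0 Fdisk FN)].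
rewrite -EFinM -EFinD lee_fin.
have hd : (`|h| <= 4 * ds D)%R by rewrite ler_norml h1.
have -> : (8 * pi * N * (eta ^+ 2 + 8 * ds D ^+ 3) = 4 * eta ^+ 2 * N * (2 * pi) +
  2 * ds D ^+ 2 * (8 * pi * (4 * ds D) * N))%R by ring.
by rewrite lerD2l; apply: ler_wpM2l => //; rewrite ler_wpM2r// ler_wpM2l// mulr_ge0// ltW.
Qed.

Let measurable_integral_e :
  measurable_fun setT (fun x : plane R => \int[mu]_s e x.1 s x.2).
Proof.
have m : measurable_fun setT
    (fun x : (plane R * measurableTypeR R)%type => e x.1.1 x.2 x.1.2).
  apply: measurable_e.
  - exact: (measurableT_comp measurable_fst measurable_fst).
  - exact: measurable_snd.
  - exact: (measurableT_comp measurable_snd measurable_fst).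
exact: (measurable_integral_snd (m2 := mu) _ measurableT m (fun=> e0 _ _ _)).
Qed.

Let measurable_integral_e_sym :
  measurable_fun setT (fun x : plane R => \int[mu]_s e x.2 s x.1).
Proof.
have m : measurable_fun setT
    (fun x : (plane R * measurableTypeR R)%type => e x.1.2 x.2 x.1.1).
  apply: measurable_e.
  - exact: (measurableT_comp measurable_snd measurable_fst).
  - exact: measurable_snd.
  - exact: (measurableT_comp measurable_fst measurable_fst).
exact: (measurable_integral_snd (m2 := mu) _ measurableT m (fun=> e0 _ _ _)).
Qed.

Let integral_cst_window (c : R) : \int[mu]_(h in H) (cst c%:E) h = (c * (8 * ds D))%:E.
Proof.
have d0 := ds_gt0 D; rewrite integral_cst//= lebesgue_measure_itv/= lte_fin ifT; last by lra.
by rewrite -EFinB -EFinM; congr (_%:E); ring.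
Qed.

Let integral_e_window : \int[mu]_(h in H) \int[mu]_(a in circle) \int[mu]_s e a s h <=
    \int[mu]_(h in H) (cst (8 * pi * N * (eta ^+ 2 + 8 * ds D ^+ 3))%:E) h.
Proof.
have se0 (x : plane R) : 0 <= \int[mu]_s e x.2 s x.1.
  by apply: integral_ge0 => s _; exact: e0.
apply: ge0_le_integral.
- exact: mH.
- by move=> h _; apply: integral_ge0 => a _; apply: integral_ge0 => s _; exact: e0.
- apply: measurable_funS measurableT (@subsetT _ _) _.
  exact: (measurable_integral_snd (m2 := mu) _ mcircle measurable_integral_e_sym se0).
- exact: measurable_cst.
- exact: integral_e_circle.
Qed.

Lemma integral_discrete_radon_error :
  \int[leb2]_(u in cylinder) ((discrete_radon_fun D F u - chordr F u.2 u.1) ^+ 2)%:E <=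
  (512 * pi * N * ((eta / ds D) ^+ 2 + 8 * ds D))%:E.
Proof.
have d0 := ds_gt0 D; have dn0 : ds D != 0%R by rewrite gt_eqF.
have k0 : (0 <= 8 * ds D ^- 3)%R by rewrite mulr_ge0// invr_ge0 exprn_ge0// ltW.
have mI : measurable_fun setT (fun u : plane R => \int[mu]_(h in H) e u.2 u.1 h).
  apply: (measurable_integral_snd (m2 := mu)
    (fun x : (plane R * measurableTypeR R)%type => e x.1.2 x.1.1 x.2)) => //.
  apply: measurable_e => //.
  - exact: (measurableT_comp measurable_snd measurable_fst).
  - exact: (measurableT_comp measurable_fst measurable_fst).
have I0 (u : plane R) : 0 <= \int[mu]_(h in H) e u.2 u.1 h.
  by apply: integral_ge0 => h _; exact: e0.
have mK : measurable_fun setT (fun u : plane R =>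
    (8 * ds D ^- 3)%:E * \int[mu]_(h in H) e u.2 u.1 h) by exact: measurable_funeM.
have mE : measurable_fun setT (fun u : plane R =>
    ((discrete_radon_fun D F u - chordr F u.2 u.1) ^+ 2)%:E).
  apply/measurable_EFinP/measurable_funX/measurable_funB.
    by have := discrete_radon_L2cyl D F; rewrite inE => /andP[]; rewrite inE.
  exact: measurable_chordr.
have mcyl : measurable (setT `*` circle : set (plane R)) by exact: measurableX.
(* The offsets are enlarged from ]-1, 1[ to the whole line, where translation in s is measure
   preserving. *)
apply: (@le_trans _ _ (\int[leb2]_(u in setT `*` circle)
    ((8 * ds D ^- 3)%:E * \int[mu]_(h in H) e u.2 u.1 h))).
  apply: (@le_trans _ _ (\int[leb2]_(u in cylinder)
    ((8 * ds D ^- 3)%:E * \int[mu]_(h in H) e u.2 u.1 h))).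
    apply: ge0_le_integral.
    - exact: measurable_cylinder.
    - by move=> u _; rewrite lee_fin sqr_ge0.
    - exact: measurable_funS measurableT (@subsetT _ _) mE.
    - exact: measurable_funS measurableT (@subsetT _ _) mK.
    - exact: discrete_radon_fun_error.
  apply: ge0_subset_integral => //.
  - exact: measurable_cylinder.
  - exact: measurable_funS measurableT (@subsetT _ _) mK.
  - by move=> u _; rewrite mule_ge0.
  - by move=> u [].
have -> : \int[leb2]_(u in setT `*` circle)
    ((8 * ds D ^- 3)%:E * \int[mu]_(h in H) e u.2 u.1 h) =
    (8 * ds D ^- 3)%:E * \int[leb2]_(u in setT `*` circle) \int[mu]_(h in H) e u.2 u.1 h.
  apply: ge0_integralZl.
  - exact: mcyl.
  - exact: measurable_funS measurableT (@subsetT _ _) mI.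
  - by move=> u _; exact: I0.
  - by rewrite lee_fin.
(* The integral over h moves outermost, because the increments are controlled for a fixed h after
   integration over s and the angle. *)
have E1 : \int[leb2]_(u in setT `*` circle) \int[mu]_(h in H) e u.2 u.1 h =
    \int[mu]_(a in circle) \int[mu]_s \int[mu]_(h in H) e a s h.
  transitivity (\int[mu]_s \int[mu]_(a in circle) \int[mu]_(h in H) e a s h).
    exact: (tonelli_setX (m1 := mu) (m2 := mu) _ measurableT mcircle mI I0).
  exact: (tonelli_domains (m1 := mu) (m2 := mu) _ measurableT mcircle mI I0).
have E2 : \int[mu]_(a in circle) \int[mu]_s \int[mu]_(h in H) e a s h =
    \int[mu]_(a in circle) \int[mu]_(h in H) \int[mu]_s e a s h.
  apply: eq_integral => a _.
  have m : measurable_fun setT (fun x : plane R => e a x.1 x.2).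
    by apply: measurable_e => //; exact: measurable_cst.
  exact: (tonelli_domains (m1 := mu) (m2 := mu) _ measurableT mH m).
have E3 : \int[mu]_(a in circle) \int[mu]_(h in H) \int[mu]_s e a s h =
    \int[mu]_(h in H) \int[mu]_(a in circle) \int[mu]_s e a s h.
  have m : measurable_fun setT (fun x : plane R => \int[mu]_s e x.1 s x.2).
    exact: measurable_integral_e.
  apply: (tonelli_domains (m1 := mu) (m2 := mu) _ mcircle mH m) => x.
  by apply: integral_ge0 => s _; exact: e0.
(* The constant 512 is 8 * 8 * 8: the factor 8 ds^-3, the bound of [integral_e_circle] and the
   window length 8 ds. *)
apply: (@le_trans _ _ ((8 * ds D ^- 3)%:E *
    (8 * pi * N * (eta ^+ 2 + 8 * ds D ^+ 3) * (8 * ds D))%:E)).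
  apply: lee_wpmul2l; first by rewrite lee_fin.
  by rewrite -integral_cst_window [X in X <= _]E1 [X in X <= _]E2 [X in X <= _]E3; exact: integral_e_window.
by rewrite -EFinM lee_fin le_eqVlt; apply/orP; left; apply/eqP; field.
Qed.

End integrated_error.

(** * The Radon transform of square-integrable functions *)

Section restricted_measure.
Local Open Scope ereal_scope.
Context d (T : measurableType d) (R : realType).
Variables (mu : {measure set T -> \bar R}) (D : set T) (mD : measurable D).

(** On subsets of [D] the measure is the sum of its restrictions to [D] and to the complement; each
    restriction vanishes on the other set. *)
Lemma ge0_integral_mrestr (f : T -> \bar R) : measurable_fun setT f ->
  (forall x, 0 <= f x) -> \int[mrestr mu mD]_x f x = \int[mu]_(x in D) f x.
Proof.
move=> mf f0.
have mDC : measurable (~` D) by exact: measurableC.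
have mfD : measurable_fun D f by exact: measurable_funS mf.
have mfDC : measurable_fun (~` D) f by exact: measurable_funS mf.
pose m1 : {measure set T -> \bar R} := mrestr mu mD.
pose m2 : {measure set T -> \bar R} := mrestr mu mDC.
have -> : \int[mu]_(x in D) f x = \int[measure_add m1 m2]_(x in D) f x.
  apply: eq_measure_integral => A mA _.
  rewrite [RHS]measure_addE /= /mrestr -measureU; last 3 first.
  - exact: measurableI.
  - exact: measurableI.
  - by rewrite setICA -setIA setICr !setI0.
  - by rewrite -setIUr setUCr setIT.
rewrite ge0_integral_measure_add//.
have -> : \int[m2]_(x in D) f x = 0.
  apply: null_set_integral => //.
  by rewrite /m2/= /mrestr setICr measure0.
rewrite adde0.
have -> : \int[mrestr mu mD]_x f x = \int[m1]_(x in D `|` ~` D) f x.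
  by rewrite setUCr.
rewrite ge0_integral_setU//.
- have -> : \int[m1]_(x in ~` D) f x = 0; last by rewrite adde0.
  apply: null_set_integral => //.
  by rewrite /m1/= /mrestr setICl measure0.
- by rewrite setUCr.
- by rewrite disj_set2E setICr.
Qed.

End restricted_measure.

Section norm2.
Local Open Scope ereal_scope.
Context d (T : measurableType d) (R : realType) (mu : {measure set T -> \bar R}).

Lemma Lnorm2_leP (f : T -> R) (c : R) : (0 <= c)%R ->
  ('N[mu]_2%:E[EFin \o f] <= c%:E) = (\int[mu]_x (f x ^+ 2)%:E <= (c ^+ 2)%:E).
Proof.
move=> c0.
have E : 'N[mu]_2%:E[EFin \o f] `^ 2 = \int[mu]_x (f x ^+ 2)%:E.
  rewrite poweR_Lnorm//; apply: eq_integral => x _ /=.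
  by rewrite powR_mulrn// real_normK ?num_real.
rewrite -E; have := Lnorm_ge0 mu 2%:E (EFin \o f).
case: ('N[mu]_2%:E[EFin \o f]) => [r| |]//=.
  rewrite lee_fin => r0; rewrite !lee_fin powR_mulrn//.
  by rewrite ler_pXn2r// nnegrE.
by move=> _; rewrite leye_eq; case: eqP => [/eqP|_]; rewrite ?pnatr_eq0 ?leye_eq.
Qed.

Lemma Lnorm2_lty (f : T -> R) :
  ('N[mu]_2%:E[EFin \o f] < +oo) = (\int[mu]_x (f x ^+ 2)%:E < +oo).
Proof.
have E : 'N[mu]_2%:E[EFin \o f] `^ 2 = \int[mu]_x (f x ^+ 2)%:E.
  rewrite poweR_Lnorm//; apply: eq_integral => x _ /=.
  by rewrite powR_mulrn// real_normK ?num_real.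
rewrite -E; have := Lnorm_ge0 mu 2%:E (EFin \o f).
case: ('N[mu]_2%:E[EFin \o f]) => [r| |]//= _; first by rewrite !ltry.
by case: eqP => [/eqP|_] //; rewrite pnatr_eq0.
Qed.

Lemma Lfun2P (f : T -> R) : measurable_fun setT f ->
  \int[mu]_x (f x ^+ 2)%:E < +oo -> f \in Lfun mu 2%:E.
Proof.
move=> mf f2; rewrite inE; apply/andP; split; rewrite inE//=.
by rewrite /finite_norm Lnorm2_lty.
Qed.

End norm2.

Section cylinder_bound.
Context {R : realType}.
Local Notation mu := (@lebesgue_measure R).
Local Notation circle := `[(- pi)%R, (pi : R)[%classic.
Local Open Scope ereal_scope.
Variable F : plane R -> R.
Hypotheses (mF : measurable_fun setT F) (F0 : forall x, (0 <= F x)%R)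
  (Fdisk : forall x, ~ disk x -> F x = 0%R).
Variable (N : R).
Hypothesis FN : sqnorm F = N%:E.

Lemma integral_cylinder_sqr_chord :
  \int[leb2]_(u in cylinder) (chord F u.2 u.1 * chord F u.2 u.1) <= (4 * pi * N)%:E.
Proof.
have mcircle : measurable (circle : set (measurableTypeR R)) by exact: measurable_itv.
have mc := measurable_chord2 mF F0.
have mcc : measurable_fun setT (fun u : plane R => chord F u.2 u.1 * chord F u.2 u.1).
  exact: emeasurable_funM.
have cc0 (u : plane R) : 0 <= chord F u.2 u.1 * chord F u.2 u.1.
  by rewrite mule_ge0// chord_ge0.
have mcyl : measurable (setT `*` circle : set (plane R)) by exact: measurableX.
apply: (@le_trans _ _ (\int[leb2]_(u in setT `*` circle) (chord F u.2 u.1 * chord F u.2 u.1))).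
  apply: ge0_subset_integral.
  - exact: measurable_cylinder.
  - exact: mcyl.
  - exact: measurable_funS measurableT (@subsetT _ _) mcc.
  - by move=> u _; exact: cc0.
  - by move=> u [].
have -> : \int[leb2]_(u in setT `*` circle) (chord F u.2 u.1 * chord F u.2 u.1) =
    \int[mu]_(a in circle) \int[mu]_s (chord F a s * chord F a s).
  transitivity (\int[mu]_s \int[mu]_(a in circle) (chord F a s * chord F a s)).
    exact: (tonelli_setX (m1 := mu) (m2 := mu) _ measurableT mcircle mcc cc0).
  exact: (tonelli_domains (m1 := mu) (m2 := mu) _ measurableT mcircle mcc cc0).
apply: (@le_trans _ _ (\int[mu]_(a in circle) (cst (2 * N)%:E) a)).
  apply: ge0_le_integral.
  - exact: mcircle.
  - by move=> a _; apply: integral_ge0 => s _; exact: (cc0 (s, a)).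
  - apply: measurable_funS measurableT (@subsetT _ _) _.
    exact: (measurable_integral_fst (m1 := mu) _ measurableT mcc cc0).
  - exact: measurable_cst.
  - by move=> a _; exact: (integral_sqr_chord_fin mF F0 Fdisk FN).
by rewrite integral_cst//= lebesgue_measure_circle -EFinM lee_fin; nra.
Qed.

End cylinder_bound.

Section signed.
Context {R : realType}.
Local Notation mu := (@lebesgue_measure R).
Local Open Scope ereal_scope.
Variable F : plane R -> R.
Hypotheses (mF : measurable_fun setT F) (Fdisk : forall x, ~ disk x -> F x = 0%R).

Local Notation absF := (fun x => `|F x|%R).

Lemma measurable_normF : measurable_fun setT absF.
Proof. exact: measurableT_comp. Qed.

Lemma normF_disk x : ~ disk x -> absF x = 0%R.
Proof. by move=> /Fdisk ->; rewrite normr0. Qed.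

Lemma funrpos_disk x : ~ disk x -> (F^\+ x = 0)%R.
Proof. by move=> /Fdisk Fx; rewrite /funrpos Fx maxxx. Qed.

Lemma funrneg_disk x : ~ disk x -> (F^\- x = 0)%R.
Proof. by move=> /Fdisk Fx; rewrite /funrneg Fx oppr0 maxxx. Qed.

Lemma sqnorm_norm : sqnorm absF = sqnorm F.
Proof. by apply: eq_integral => x _; rewrite real_normK ?num_real. Qed.

Lemma sqnorm_pos_neg : sqnorm (F^\+)%R + sqnorm (F^\-)%R = sqnorm F.
Proof.
rewrite /sqnorm -ge0_integralD//.
- apply: eq_integral => x _; rewrite -EFinD /funrpos /funrneg; congr (_%:E).
  have [x0|x0] := leP 0%R (F x).
    by rewrite max_r ?oppr_le0// expr0n/= addr0.
  by rewrite expr0n/= add0r max_l ?sqrrN// oppr_ge0 ltW.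
- by move=> x _; rewrite lee_fin sqr_ge0.
- by apply/measurable_EFinP/measurable_funX/measurable_funrpos.
- by move=> x _; rewrite lee_fin sqr_ge0.
- by apply/measurable_EFinP/measurable_funX/measurable_funrneg.
Qed.

Lemma radon_integralE (u : plane R) :
  radon_integral F u = fine (chord (F^\+)%R u.2 u.1 - chord (F^\-)%R u.2 u.1).
Proof.
rewrite /radon_integral /Rintegral integralE; congr (fine (_ - _));
  apply: eq_integral => t _.
- by rewrite funeposE /funrpos EFin_max.
- by rewrite funenegE /funrneg EFin_max.
Qed.

Lemma measurable_radon_integral : measurable_fun setT (radon_integral F : plane R -> R).
Proof.
rewrite (_ : radon_integral F = (fun u => fine (chord (F^\+)%R u.2 u.1 - chord (F^\-)%R u.2 u.1))).
  apply: (measurableT_comp (fine_measurable measurableT)).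
  apply: emeasurable_funB; apply: measurable_chord2.
  - exact: measurable_funrpos.
  - by move=> x; exact: funrpos_ge0.
  - exact: measurable_funrneg.
  - by move=> x; exact: funrneg_ge0.
by apply/funext => u; exact: radon_integralE.
Qed.

Lemma measurable_line (u : plane R) : measurable_fun [set: measurableTypeR R]
  (fun t : measurableTypeR R => F (turn u.2 (u.1, t))).
Proof. by apply: measurable_F_turn => //; exact: measurable_cst. Qed.

(** This holds for divergent line integrals too: the left side is then the default value 0 of
    [fine]. *)
Lemma normr_radon_integral_le (u : plane R) :
  (`|radon_integral F u|)%:E <= chord absF u.2 u.1.
Proof.
have H : `|\int[mu]_t (F (turn u.2 (u.1, t)))%:E| <= chord absF u.2 u.1.
  apply: (le_trans (le_abse_integral _ _ _)) => //.
  by apply/measurable_EFinP; exact: measurable_line.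
apply: le_trans H; rewrite /radon_integral /Rintegral.
by case: (\int[mu]_t _) => [r| |] /=; rewrite ?normr0 ?lee_fin ?leey.
Qed.

Lemma integrable_line (u : plane R) : chord absF u.2 u.1 < +oo ->
  mu.-integrable setT (fun t => (F (turn u.2 (u.1, t)))%:E).
Proof.
move=> H; apply/integrableP; split => //.
by apply/measurable_EFinP; exact: measurable_line.
Qed.

Variable N : R.
Hypothesis FN : sqnorm F = N%:E.

Lemma integral_cylinder_sqr_radon_integral :
  \int[leb2]_(u in cylinder) (radon_integral F u ^+ 2)%:E <= (4 * pi * N)%:E.
Proof.
have FN' : sqnorm absF = N%:E by rewrite sqnorm_norm.
apply: le_trans (integral_cylinder_sqr_chord measurable_normF (fun=> normr_ge0 _) normF_disk FN').
apply: ge0_le_integral.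
- exact: measurable_cylinder.
- by move=> u _; rewrite lee_fin sqr_ge0.
- apply: measurable_funS measurableT (@subsetT _ _) _.
  by apply/measurable_EFinP/measurable_funX; exact: measurable_radon_integral.
- apply: measurable_funS measurableT (@subsetT _ _) _.
  by apply: emeasurable_funM; exact: (measurable_chord2 measurable_normF (fun=> normr_ge0 _)).
- move=> u _; rewrite -real_normK ?num_real// expr2 EFinM.
  by apply: lee_pmul; rewrite ?lee_fin ?normr_radon_integral_le.
Qed.

(** Where this holds the line integral converges absolutely, hence is additive in the function and
    splits into its positive and negative parts. Elsewhere [radon_integral] may be a default value,
    and linearity can fail. *)
Lemma ae_chord_norm_lty : {ae cylinder_measure, forall u : plane R, chord absF u.2 u.1 < +oo}.
Proof.
have FN' : sqnorm absF = N%:E by rewrite sqnorm_norm.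
have mc := measurable_chord2 measurable_normF (fun=> normr_ge0 _).
have c0 (u : plane R) : 0 <= chord absF u.2 u.1 by apply: chord_ge0.
have : cylinder_measure.-integrable setT
    (fun u : plane R => chord absF u.2 u.1 * chord absF u.2 u.1).
  apply/integrableP; split; first exact: emeasurable_funM.
  apply: (@le_lt_trans _ _ (4 * pi * N)%:E); last exact: ltry.
  under eq_integral do rewrite gee0_abs ?mule_ge0//.
  rewrite ge0_integral_mrestr.
  - exact: (integral_cylinder_sqr_chord measurable_normF (fun=> normr_ge0 _) normF_disk FN').
  - exact: emeasurable_funM.
  - by move=> u; rewrite mule_ge0.
move/(integrable_ae measurableT); apply: filterS => u /(_ I).
by move: (c0 u); case: (chord absF u.2 u.1) => [r| |]//=; rewrite ?ltry ?mulyy.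
Qed.

End signed.

Section signed_error.
Context {R : realType}.
Local Open Scope ereal_scope.
Variable D : discretization R.
Local Notation eta := (dx D + dphi D)%R.
Variable F : plane R -> R.
Hypotheses (mF : measurable_fun setT F) (Fdisk : forall x, ~ disk x -> F x = 0%R).
Variable N : R.
Hypothesis FN : sqnorm F = N%:E.
Local Notation Fp := (F^\+)%R.
Local Notation Fm := (F^\-)%R.

Let mFp : measurable_fun setT Fp.
Proof. exact: measurable_funrpos. Qed.

Let mFm : measurable_fun setT Fm.
Proof. exact: measurable_funrneg. Qed.

Lemma sqnorm_pos_neg_fin : exists Np Nm : R,
  [/\ sqnorm Fp = Np%:E, sqnorm Fm = Nm%:E & (Np + Nm = N)%R].
Proof.
have := sqnorm_pos_neg mF; rewrite FN.
have p0 : 0 <= sqnorm Fp by apply: integral_ge0 => x _; rewrite lee_fin sqr_ge0.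
have m0 : 0 <= sqnorm Fm by apply: integral_ge0 => x _; rewrite lee_fin sqr_ge0.
case: (sqnorm Fp) p0 => [a| |]// _; case: (sqnorm Fm) m0 => [b| |]// _.
by rewrite -EFinD => -[ab]; exists a, b.
Qed.

Lemma discrete_radon_coef_pos_neg p q : discrete_radon_coef D F p q =
  (discrete_radon_coef D Fp p q - discrete_radon_coef D Fm p q)%R.
Proof.
have [Np [Nm [Ep Em _]]] := sqnorm_pos_neg_fin.
rewrite /discrete_radon_coef !patch_disk//; last 2 first.
- exact: funrneg_disk.
- exact: funrpos_disk.
rewrite -sumrB; apply: eq_bigr => i _; rewrite -sumrB; apply: eq_bigr => j _.
rewrite -mulrBr; congr (_ * _)%R; rewrite /Rintegral integralE.
have E1 : \int[leb2]_(x in pixel D i j) (fun x => (F x)%:E)^\+ x =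
    \int[leb2]_(x in pixel D i j) (Fp x)%:E.
  by apply: eq_integral => x _; rewrite funeposE /funrpos EFin_max.
have E2 : \int[leb2]_(x in pixel D i j) (fun x => (F x)%:E)^\- x =
    \int[leb2]_(x in pixel D i j) (Fm x)%:E.
  by apply: eq_integral => x _; rewrite funenegE /funrneg EFin_max.
rewrite [X in fine (X - _)]E1 [X in fine (_ - X)]E2 fineB//.
- rewrite ge0_fin_numE; last by apply: integral_ge0 => x _; rewrite lee_fin funrpos_ge0.
  apply: le_lt_trans (integral_lty mFp (@funrpos_ge0 _ _ F) (funrpos_disk Fdisk) Ep).
  apply: ge0_subset_integral => //; first exact: measurable_pixel.
    exact/measurable_EFinP.
  by move=> x _; rewrite lee_fin funrpos_ge0.
- rewrite ge0_fin_numE; last by apply: integral_ge0 => x _; rewrite lee_fin funrneg_ge0.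
  apply: le_lt_trans (integral_lty mFm (@funrneg_ge0 _ _ F) (funrneg_disk Fdisk) Em).
  apply: ge0_subset_integral => //; first exact: measurable_pixel.
    exact/measurable_EFinP.
  by move=> x _; rewrite lee_fin funrneg_ge0.
Qed.

Lemma discrete_radon_fun_pos_neg u : discrete_radon_fun D F u =
  (discrete_radon_fun D Fp u - discrete_radon_fun D Fm u)%R.
Proof.
rewrite /discrete_radon_fun -mulrBr; congr (_ * _)%R.
rewrite -sumrB; apply: eq_bigr => q _; rewrite -sumrB; apply: eq_bigr => p _.
by rewrite -mulrBr discrete_radon_coef_pos_neg.
Qed.

Lemma radon_integral_pos_neg (u : plane R) : chord (fun x => `|F x|)%R u.2 u.1 < +oo ->
  radon_integral F u = (chordr Fp u.2 u.1 - chordr Fm u.2 u.1)%R.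
Proof.
move=> uF; rewrite radon_integralE fineB//.
- rewrite ge0_fin_numE; last by apply: chord_ge0 => x; exact: funrpos_ge0.
  apply: le_lt_trans uF; apply: ge0_le_integral => //.
  - by move=> t _; rewrite lee_fin funrpos_ge0.
  - by apply/measurable_EFinP; exact: measurable_line.
  - by apply/measurable_EFinP/measurableT_comp => //; exact: measurable_line.
  - by move=> t _; rewrite lee_fin /funrpos ge_max normr_ge0 ler_norm.
- rewrite ge0_fin_numE; last by apply: chord_ge0 => x; exact: funrneg_ge0.
  apply: le_lt_trans uF; apply: ge0_le_integral => //.
  - by move=> t _; rewrite lee_fin funrneg_ge0.
  - by apply/measurable_EFinP; exact: measurable_line.
  - by apply/measurable_EFinP/measurableT_comp => //; exact: measurable_line.
  - by move=> t _; rewrite lee_fin /funrneg ge_max normr_ge0 -normrN ler_norm.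
Qed.

Lemma measurable_discrete_radon_fun (G : plane R -> R) :
  measurable_fun setT (discrete_radon_fun D G).
Proof. by have := discrete_radon_L2cyl D G; rewrite inE => /andP[]; rewrite inE. Qed.

Hypothesis etad : (eta <= ds D)%R.

Let err (G : plane R -> R) (u : plane R) : \bar R :=
  ((discrete_radon_fun D G u - chordr G u.2 u.1) ^+ 2)%:E.

Let measurable_err (G : plane R -> R) : measurable_fun setT G -> (forall x, (0 <= G x)%R) ->
  measurable_fun setT (err G).
Proof.
move=> mG G0; apply/measurable_EFinP/measurable_funX/measurable_funB.
  exact: measurable_discrete_radon_fun.
exact: measurable_chordr.
Qed.

Let err0 G u : 0 <= err G u.
Proof. by rewrite lee_fin sqr_ge0. Qed.

Lemma integral_signed_error :
  \int[cylinder_measure]_u ((discrete_radon_fun D F u - radon_integral F u) ^+ 2)%:E <=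
  (1024 * pi * N * ((eta / ds D) ^+ 2 + 8 * ds D))%:E.
Proof.
have [Np [Nm [Ep Em ENN]]] := sqnorm_pos_neg_fin.
have mp := measurable_err mFp (@funrpos_ge0 _ _ F).
have mm := measurable_err mFm (@funrneg_ge0 _ _ F).
have m2p : measurable_fun setT (fun u => 2%:E * err Fp u) by exact: measurable_funeM.
have m2m : measurable_fun setT (fun u => 2%:E * err Fm u) by exact: measurable_funeM.
have m2 : measurable_fun setT (fun u => 2%:E * err Fp u + 2%:E * err Fm u).
  exact: emeasurable_funD.
have s0 (G : plane R -> R) u : 0 <= 2%:E * err G u by rewrite mule_ge0.
apply: (@le_trans _ _ (\int[cylinder_measure]_u (2%:E * err Fp u + 2%:E * err Fm u))).
  apply: ae_ge0_le_integral.
  - exact: measurableT.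
  - by move=> u _; rewrite lee_fin sqr_ge0.
  - apply/measurable_EFinP/measurable_funX/measurable_funB.
      exact: measurable_discrete_radon_fun.
    exact: measurable_radon_integral.
  - by move=> u _; rewrite adde_ge0.
  - exact: m2.
  - apply: (@filterS _ _ (ae_filter_ringOfSetsType _) _ _ _ (ae_chord_norm_lty mF Fdisk FN)) => u uF _.
    rewrite discrete_radon_fun_pos_neg (radon_integral_pos_neg uF) /err.
    rewrite -!EFinM -EFinD lee_fin.
    move: (discrete_radon_fun D Fp u) (discrete_radon_fun D Fm u) => a b.
    move: (chordr Fp u.2 u.1) (chordr Fm u.2 u.1) => c d.
    by have := sqr_ge0 ((a - c) + (b - d))%R; nra.
have -> : \int[cylinder_measure]_u (2%:E * err Fp u + 2%:E * err Fm u) =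
    2%:E * \int[cylinder_measure]_u err Fp u + 2%:E * \int[cylinder_measure]_u err Fm u.
  transitivity (\int[cylinder_measure]_u (2%:E * err Fp u) +
      \int[cylinder_measure]_u (2%:E * err Fm u)).
    by apply: ge0_integralD => // u _; exact: s0.
  by congr (_ + _); apply: ge0_integralZl => // u _; exact: err0.
have Hp : \int[cylinder_measure]_u err Fp u <=
    (512 * pi * Np * ((eta / ds D) ^+ 2 + 8 * ds D))%:E.
  rewrite [X in X <= _](ge0_integral_mrestr leb2 measurable_cylinder mp (err0 Fp)).
  exact: (integral_discrete_radon_error mFp (@funrpos_ge0 _ _ F) (funrpos_disk Fdisk) Ep etad).
have Hm : \int[cylinder_measure]_u err Fm u <=
    (512 * pi * Nm * ((eta / ds D) ^+ 2 + 8 * ds D))%:E.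
  rewrite [X in X <= _](ge0_integral_mrestr leb2 measurable_cylinder mm (err0 Fm)).
  exact: (integral_discrete_radon_error mFm (@funrneg_ge0 _ _ F) (funrneg_disk Fdisk) Em etad).
have -> : (1024 * pi * N * ((eta / ds D) ^+ 2 + 8 * ds D))%:E =
    2%:E * (512 * pi * Np * ((eta / ds D) ^+ 2 + 8 * ds D))%:E +
    2%:E * (512 * pi * Nm * ((eta / ds D) ^+ 2 + 8 * ds D))%:E.
  by rewrite -ENN -!EFinM -EFinD; congr (_%:E); ring.
by apply: leeD; apply: lee_wpmul2l.
Qed.

End signed_error.

Section explicit_operator.
Context {R : realType}.
Local Open Scope ereal_scope.

Implicit Type f g : L2disk R.

Local Notation ext f := ((f : plane R -> R) \_ disk).

Lemma measurable_ext f : measurable_fun setT (ext f).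
Proof.
by apply/(measurable_restrictT f); [exact: measurable_disk|exact: measurable_funTS].
Qed.

Lemma ext_disk f x : ~ disk x -> ext f x = 0%R.
Proof. by move=> xd; rewrite /patch memNset. Qed.

Lemma measurable_sqr f : measurable_fun setT (fun x => (f x ^+ 2)%:E).
Proof. by apply/measurable_EFinP; exact: measurable_funX. Qed.

Lemma sqnorm_ext f : sqnorm (ext f) = \int[disk_measure]_x (f x ^+ 2)%:E.
Proof.
have f0 x : 0 <= (f x ^+ 2)%:E by rewrite lee_fin sqr_ge0.
rewrite [RHS](ge0_integral_mrestr leb2 measurable_disk (measurable_sqr f) f0).
rewrite [RHS]integral_mkcond; apply: eq_integral => x _.
by rewrite /patch; case: ifP => // _; rewrite expr0n.
Qed.

Lemma norm_disk_leP f (c : R) : (0 <= c)%R ->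
  (norm_disk f <= c%:E) = (sqnorm (ext f) <= (c ^+ 2)%:E).
Proof. by move=> c0; rewrite sqnorm_ext /norm_disk Lnorm2_leP. Qed.

Lemma sqnorm_ext_fin f : exists2 N : R, (0 <= N)%R & sqnorm (ext f) = N%:E.
Proof.
have : norm_disk f < +oo by exact: Lfunction_finite.
rewrite /norm_disk Lnorm2_lty -sqnorm_ext.
have : 0 <= sqnorm (ext f) by apply: integral_ge0 => x _; rewrite lee_fin sqr_ge0.
by case: (sqnorm (ext f)) => // N N0 _; exists N.
Qed.

Lemma radon_integral_L2cyl f : (radon_integral (ext f) : plane R -> R) \in
  Lfun (@cylinder_measure R) 2%:E.
Proof.
have [N N0 FN] := sqnorm_ext_fin f.
have m := measurable_radon_integral (measurable_ext f).
apply: Lfun2P => //.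
have m2 : measurable_fun setT (fun u : plane R => (radon_integral (ext f) u ^+ 2)%:E).
  by apply/measurable_EFinP; exact: measurable_funX.
have s0 (u : plane R) : 0 <= (radon_integral (ext f) u ^+ 2)%:E by rewrite lee_fin sqr_ge0.
rewrite [ltLHS](ge0_integral_mrestr leb2 measurable_cylinder m2 s0).
apply: (@le_lt_trans _ _ (4 * pi * N)%:E); last exact: ltry.
exact: (integral_cylinder_sqr_radon_integral (measurable_ext f) (@ext_disk f) FN).
Qed.

(** The function is cut off outside the disk, where the values of an element of [L2disk] are
    arbitrary and must not influence the line integrals. *)
Definition radon_operator f : L2cyl R := Lfun_Sub one_le_two (radon_integral_L2cyl f).

Lemma norm_cyl_leP (g : L2cyl R) (c : R) : (0 <= c)%R ->
  (norm_cyl g <= c%:E) = (\int[cylinder_measure]_u (g u ^+ 2)%:E <= (c ^+ 2)%:E).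
Proof. by move=> c0; rewrite /norm_cyl Lnorm2_leP. Qed.

Lemma norm_cyl_ae (g h : L2cyl R) : g = h %[ae cylinder_measure] -> norm_cyl g = norm_cyl h.
Proof.
move=> gh; rewrite /norm_cyl unlock; congr (_ `^ _).
have m (k : L2cyl R) : measurable_fun setT (fun u => `|(EFin \o k) u| `^ 2).
  apply: (measurableT_comp (measurable_poweR _)).
  apply: measurableT_comp => //; exact/measurable_EFinP.
apply: ae_eq_integral => //.
apply: (@filterS _ _ (ae_filter_ringOfSetsType _) _ _ _ gh) => u /= H _.
by rewrite H.
Qed.

Lemma radon_operator_bound f (c : R) : (0 <= c)%R -> norm_disk f <= c%:E ->
  norm_cyl (radon_operator f) <= (4 * c)%:E.
Proof.
move=> c0; rewrite norm_disk_leP// norm_cyl_leP ?mulr_ge0//.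
have [N N0 FN] := sqnorm_ext_fin f; rewrite FN lee_fin => Nc.
have m2 : measurable_fun setT (fun u : plane R => (radon_integral (ext f) u ^+ 2)%:E).
  by apply/measurable_EFinP/measurable_funX; exact: (measurable_radon_integral (measurable_ext f)).
have s0 (u : plane R) : 0 <= (radon_integral (ext f) u ^+ 2)%:E by rewrite lee_fin sqr_ge0.
rewrite [leLHS](ge0_integral_mrestr leb2 measurable_cylinder m2 s0).
apply: le_trans (integral_cylinder_sqr_radon_integral (measurable_ext f) (@ext_disk f) FN) _.
rewrite lee_fin; have := pihalf_lt2 R; have := pi_gt0 R => p0 p4.
(* The squared norm is at most 4 pi N, and pi < 4 turns this into the integer bound 4 for the
   operator. *)
rewrite exprMn; apply: (@le_trans _ _ (4 * 4 * N)%R); first by rewrite ler_wpM2r//; lra.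
by rewrite -expr2 ler_wpM2l// sqr_ge0.
Qed.

Lemma radon_operator_linear : linear_operator radon_operator.
Proof.
move=> a f g.
have [N _ fN] := sqnorm_ext_fin f; have [M _ gM] := sqnorm_ext_fin g.
apply: (@filterS2 _ _ (ae_filter_ringOfSetsType _) _ _ _ _
  (ae_chord_norm_lty (measurable_ext f) (@ext_disk f) fN)
  (ae_chord_norm_lty (measurable_ext g) (@ext_disk g) gM)) => u fu gu _.
have If := integrable_line (measurable_ext f) fu.
have Ig := integrable_line (measurable_ext g) gu.
transitivity (a * radon_integral (ext f) u + radon_integral (ext g) u)%R; last by [].
rewrite /radon_operator/= /radon_integral -RintegralZl//.
rewrite -RintegralD//; last first.
  by have := integrableZl measurableT a If.
apply: eq_Rintegral => t _.
by rewrite /patch; case: ifP => //; rewrite mulr0 addr0.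
Qed.

End explicit_operator.

(** * Uniqueness of the continuous extension *)

Section operators_facts.
Context {R : realType}.
Local Open Scope ereal_scope.
Implicit Type f g : L2disk R.

Lemma linear_operatorB (T : L2disk R -> L2cyl R) f g : linear_operator T ->
  (T (g - f)%R : plane R -> R) = (T g - T f)%R %[ae cylinder_measure].
Proof.
move=> lT; have -> : (g - f)%R = (-1 *: f + g)%R by rewrite scaleN1r addrC.
apply: (@filterS _ _ (ae_filter_ringOfSetsType _) _ _ _ (lT (-1)%R f g)) => u H /H ->.
transitivity (-1 * T f u + T g u)%R; first by [].
by rewrite mulN1r addrC.
Qed.

Lemma norm_cyl_triangle (g h : L2cyl R) : norm_cyl (g - h)%R <= norm_cyl g + norm_cyl h.
Proof.
rewrite /norm_cyl.
have E : 'N[cylinder_measure]_2%:E[EFin \o h] =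
    'N[cylinder_measure]_2%:E[EFin \o (- (h : plane R -> R))%R].
  by rewrite -[LHS]oppe_Lnorm; apply: eq_Lnorm => x.
rewrite E; apply: eminkowski; [exact: measurable_funP | |exact: one_le_two].
by apply: measurableT_comp => //; exact: measurable_funP.
Qed.

Lemma radon_operator_continuous : continuous_operator (@radon_operator R).
Proof.
(* The operator is bounded by 4, and another factor 2 makes the inequality strict. *)
move=> f e e0; exists (e / 8)%R; first by rewrite divr_gt0.
move=> g gf; have e8 : (0 <= e / 8)%R by rewrite divr_ge0// ltW.
rewrite -(norm_cyl_ae (linear_operatorB f g (@radon_operator_linear R))).
apply: le_lt_trans (radon_operator_bound e8 (ltW gf)) _.
by rewrite lte_fin; lra.
Qed.

(** This is the existence that keeps [radon] from being the default zero operator. *)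
Lemma radon_operator_extension : radon_extension (@radon_operator R).
Proof.
split; [exact: radon_operator_linear|exact: radon_operator_continuous|].
move=> f [_ [K [_ Kd f0]]]; apply/nearW => u _; congr (radon_integral _ u).
apply/funext => x; rewrite /patch; case: ifPn => // /negP xd.
by rewrite f0// => /Kd xK; apply: xd; rewrite inE.
Qed.

End operators_facts.

Section agreement.
Context {R : realType}.
Local Open Scope ereal_scope.
Implicit Type f g : L2disk R.
Variable T : L2disk R -> L2cyl R.
Hypothesis radonT : radon_extension T.

Definition agree f : Prop :=
  (T f : plane R -> R) = radon_operator f %[ae cylinder_measure].

Let linT : linear_operator T. Proof. by case: radonT. Qed.
Let contT : continuous_operator T. Proof. by case: radonT. Qed.

Lemma agree_linear (a : R) f g : agree f -> agree g -> agree (a *: f + g)%R.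
Proof.
move=> af ag.
have H := @filterI _ _ (ae_filter_ringOfSetsType _) _ _ (linT a f g) (radon_operator_linear a f g).
have H' := @filterI _ _ (ae_filter_ringOfSetsType _) _ _ af ag.
apply: (@filterS2 _ _ (ae_filter_ringOfSetsType _) _ _ _ _ H H') => u [h1 h2] [h3 h4] _.
rewrite (h1 I) (h2 I).
transitivity (a * T f u + T g u)%R; first by [].
by rewrite (h3 I) (h4 I).
Qed.

Lemma agree_cc f : continuous_compactly_supported f -> agree f.
Proof.
move=> cf; have [_ _ ccT] := radonT; have [_ _ cc0] := @radon_operator_extension R.
apply: (@filterS2 _ _ (ae_filter_ringOfSetsType _) _ _ _ _ (ccT f cf) (cc0 f cf)) => u h1 h2 _.
by rewrite (h1 I) (h2 I).
Qed.

Lemma agree_closed f : (forall e : R, (0 < e)%R ->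
  exists2 g, agree g & norm_disk (g - f)%R < e%:E) -> agree f.
Proof.
move=> approx; suff H : norm_cyl (T f - radon_operator f)%R = 0.
  have := @Lnorm_eq0_eq0 _ _ _ cylinder_measure _ 2%:E _ _ H.
  have m : measurable_fun setT (EFin \o (T f - radon_operator f)%R) by exact/measurable_EFinP.
  move=> /(_ m); rewrite lte_fin ltr0n => /(_ isT).
  apply: (@filterS _ _ (ae_filter_ringOfSetsType _)) => u /(_ I)/= [] /eqP.
  by rewrite subr_eq0 => /eqP.
apply/eqP; rewrite eq_le Lnorm_ge0 andbT; apply/lee_addgt0Pr => e e0.
rewrite add0e.
have e2 : (0 < e / 2)%R by rewrite divr_gt0.
have [h1 h10 H1] := contT f e2; have [h2 h20 H2] := radon_operator_continuous f e2.
have h0 : (0 < Num.min h1 h2)%R by rewrite lt_min h10.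
have [g ag gf] := approx _ h0.
have g1 : norm_disk (g - f)%R < h1%:E by apply: (lt_le_trans gf); rewrite lee_fin ge_min lexx.
have g2 : norm_disk (g - f)%R < h2%:E.
  by apply: (lt_le_trans gf); rewrite lee_fin ge_min lexx orbT.
(* As both operators agree at g, their difference at f is a difference of two increments from f to
   g, each of which continuity makes smaller than e / 2. *)
have -> : norm_cyl (T f - radon_operator f)%R =
    norm_cyl ((radon_operator g - radon_operator f) - (T g - T f))%R.
  apply: norm_cyl_ae; apply: (@filterS _ _ (ae_filter_ringOfSetsType _) _ _ _ ag) => u /(_ I) E _.
  transitivity (T f u - radon_operator f u)%R; first by [].
  transitivity (radon_operator g u - radon_operator f u - (T g u - T f u))%R; last by [].
  by rewrite E; ring.
apply: (le_trans (norm_cyl_triangle _ _)).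
have -> : e%:E = (e / 2)%:E + (e / 2)%:E by rewrite -EFinD -splitr.
by apply: leeD; apply: ltW; [exact: H2|exact: H1].
Qed.

(** Dominated convergence upgrades pointwise limits on the disk to limits in L^2: since |fn - f| <=
    2 k, the squared differences have the integrable majorant 4 k^2. *)
Lemma agree_dominated (fn : nat -> L2disk R) f (k : L2disk R) :
  (forall n, agree (fn n)) ->
  (forall x, disk x -> fn n x @[n --> \oo] --> f x) ->
  (forall n x, disk x -> (`|fn n x| <= k x)%R) -> agree f.
Proof.
move=> afn fnf fnk; apply: agree_closed => e e0.
have fk x : disk x -> (`|f x| <= k x)%R.
  move=> xd; have c : `|fn n x|%R @[n --> \oo] --> `|f x|%R by apply: cvg_norm; exact: fnf.
  by apply: (cvgr_to_le c); apply: nearW => n; exact: fnk.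
have msq n : measurable_fun disk (fun x => ((fn n x - f x) ^+ 2)%:E).
  by apply: measurable_funTS; apply/measurable_EFinP/measurable_funX/measurable_funB.
have ik : leb2.-integrable disk (fun x => (4 * k x ^+ 2)%:E).
  have mk : measurable_fun setT (fun x => (4 * k x ^+ 2)%:E).
    by apply/measurable_EFinP/measurable_funM => //; exact: measurable_funX.
  apply/integrableP; split; first exact: measurable_funTS.
  have -> : \int[leb2]_(x in disk) `|(4 * k x ^+ 2)%:E| =
      \int[leb2]_(x in disk) (4%:E * (k x ^+ 2)%:E).
    apply: eq_integral => x _; rewrite gee0_abs ?EFinM// lee_fin.
    by rewrite mulr_ge0// sqr_ge0.
  rewrite [ltLHS]ge0_integralZl//; last 3 first.
  - exact: measurable_disk.
  - by apply: measurable_funTS; exact: measurable_sqr.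
  - by move=> x _; rewrite lee_fin sqr_ge0.
  have [N N0 kN] := sqnorm_ext_fin k.
  have s0 x : 0 <= (k x ^+ 2)%:E by rewrite lee_fin sqr_ge0.
  move: kN; rewrite sqnorm_ext.
  rewrite [X in X = _ -> _](ge0_integral_mrestr leb2 measurable_disk (measurable_sqr k) s0).
  by move=> ->; rewrite -EFinM ltry.
have [|||_ _] := @dominated_convergence _ _ R leb2 disk measurable_disk
  (fun n x => ((fn n x - f x) ^+ 2)%:E) (cst 0) (fun x => (4 * k x ^+ 2)%:E) msq _ _ ik.
- exact: measurable_cst.
- apply/nearW => x xd; apply: cvg_EFin; first exact: nearW.
  rewrite /comp/= (_ : 0%R = (f x - f x) * (f x - f x))%R; last by rewrite subrr mulr0.
  by under eq_fun do rewrite expr2; apply: cvgM; apply: cvgB; (exact: fnf || exact: cvg_cst).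
- apply/nearW => x n xd; rewrite gee0_abs ?lee_fin ?sqr_ge0//.
  have := fnk n x xd; have := fk x xd; rewrite !ler_norml => /andP[a1 a2] /andP[b1 b2].
  by move: (fn n x) (f x) (k x) a1 a2 b1 b2 => a b c *; nra.
rewrite integral0 => /fine_cvgP[fin c0].
have e2 : (0 < (e / 2) ^+ 2)%R by rewrite exprn_gt0// divr_gt0.
have [n _ /(_ n (leqnn n)) [h1 h2]] : \forall n \near \oo, \int[leb2]_(x in disk) ((fn n x - f x) ^+ 2)%:E
   \is a fin_num /\
   (fine (\int[leb2]_(x in disk) ((fn n x - f x) ^+ 2)%:E) < (e / 2) ^+ 2)%R.
  by apply: filterI; [exact: fin|exact: cvgr_lt c0 _ e2].
exists (fn n); first exact: afn.
apply: (@le_lt_trans _ _ (e / 2)%:E); last by rewrite lte_fin; lra.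
have e20 : (0 <= e / 2)%R by rewrite divr_ge0// ltW.
rewrite norm_disk_leP// sqnorm_ext.
have s0 x : 0 <= ((fn n - f)%R x ^+ 2)%:E by rewrite lee_fin sqr_ge0.
rewrite [X in X <= _](ge0_integral_mrestr leb2 measurable_disk (measurable_sqr (fn n - f)%R) s0).
apply: (@le_trans _ _ (fine (\int[leb2]_(x in disk) ((fn n x - f x) ^+ 2)%:E))%:E).
  by rewrite fineK.
by rewrite lee_fin ltW.
Qed.

End agreement.

(** * Density of continuous functions with compact support in the disk *)

Section clamp.
Context {R : realType}.

Definition clamp (t : R) : R := Num.max 0 (Num.min 1 t).

Lemma clamp_ge0 t : 0 <= clamp t.
Proof. by rewrite /clamp le_max lexx. Qed.

Lemma clamp_le1 t : clamp t <= 1.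
Proof. by rewrite /clamp ge_max ler01 ge_min lexx. Qed.

Lemma clamp_eq0 t : t <= 0 -> clamp t = 0.
Proof. by move=> t0; apply/max_idPl; rewrite ge_min t0 orbT. Qed.

Lemma clamp_eq1 t : 1 <= t -> clamp t = 1.
Proof. by move=> t1; rewrite /clamp (min_idPl t1); apply/max_idPr; exact: ler01. Qed.

Lemma continuous_clamp : continuous clamp.
Proof.
move=> t; apply: (@continuous_max _ R^o (cst 0) (fun t => Num.min 1 t)) => //.
  exact: cvg_cst.
by apply: (@continuous_min _ R^o (cst 1) id); [exact: cvg_cst|exact: cvg_id].
Qed.

Lemma near_natr_mul_ge (a c : R) : 0 < a -> \forall n \near \oo, c <= n%:R * a.
Proof.
move=> a0; exists (Num.truncn `|c / a|).+1 => // n /= cn.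
rewrite -ler_pdivrMr//; apply: (le_trans (ler_norm _)).
by apply: le_trans (ltW (Num.Theory.truncnS_gt _)) _; rewrite ler_nat.
Qed.

(** For large n a continuous trapezoid: 0 up to a, 1 from a + 1/n to b, 0 again from b + 1/n on.
    Both slopes lie to the right of their endpoints, so the limit is the indicator of ]a, b], the
    shape of interval that generates the Borel sets. *)
Definition cutoff (a b : R) (n : nat) (x : R) : R :=
  clamp (n%:R * (x - a)) * clamp (1 - n%:R * (x - b)).

Lemma cutoff_ge0 a b n x : 0 <= cutoff a b n x.
Proof. by rewrite mulr_ge0// clamp_ge0. Qed.

Lemma cutoff_le1 a b n x : cutoff a b n x <= 1.
Proof. by rewrite mulr_ile1// ?clamp_ge0 ?clamp_le1. Qed.

Lemma continuous_cutoff a b n : continuous (cutoff a b n).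
Proof.
move=> x; apply: cvgM.
  apply: (@continuous_comp _ _ _ (fun x => n%:R * (x - a)) clamp); last exact: continuous_clamp.
  by apply: cvgM; [exact: cvg_cst|apply: cvgB; [exact: cvg_id|exact: cvg_cst]].
apply: (@continuous_comp _ _ _ (fun x => 1 - n%:R * (x - b)) clamp); last exact: continuous_clamp.
apply: cvgB; first exact: cvg_cst.
by apply: cvgM; [exact: cvg_cst|apply: cvgB; [exact: cvg_id|exact: cvg_cst]].
Qed.

Lemma near_cutoff a b x : \forall n \near \oo, cutoff a b n x = \1_`]a, b] x.
Proof.
rewrite indicE; have [xa|ax] := leP x a.
  apply: nearW => n; rewrite memNset/=; last by rewrite in_itv/= ltNge xa.
  by rewrite /cutoff clamp_eq0 ?mul0r// mulr_ge0_le0// subr_le0.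
have n1 := @near_natr_mul_ge (x - a) 1.
have [xb|bx] := leP x b.
  near=> n; rewrite mem_set/=; last by rewrite in_itv/= ax.
  rewrite /cutoff !clamp_eq1 ?mulr1//.
    by rewrite lerBrDl addrC -lerBrDl subrr mulr_ge0_le0// subr_le0.
  by near: n; apply: n1; rewrite subr_gt0.
near=> n; rewrite memNset/=; last by rewrite in_itv/= ax leNgt bx.
rewrite /cutoff [X in _ * X]clamp_eq0 ?mulr0// subr_le0.
by near: n; apply: near_natr_mul_ge; rewrite subr_gt0.
Unshelve. all: by end_near. Qed.

End clamp.

Section membership.
Context {R : realType}.
Local Notation mu := (@lebesgue_measure R).
Local Open Scope ereal_scope.

Lemma L2disk_dominated (h k : plane R -> R) : measurable_fun setT h ->
  k \in Lfun (@disk_measure R) 2%:E ->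
  (forall x, disk x -> (`|h x| <= `|k x|)%R) -> h \in Lfun (@disk_measure R) 2%:E.
Proof.
move=> mh; rewrite inE => /andP[]; rewrite !inE/= => mk; rewrite /finite_norm Lnorm2_lty => k2 hk.
apply: Lfun2P => //.
have mh2 : measurable_fun setT (fun x => (h x ^+ 2)%:E).
  by apply/measurable_EFinP; exact: measurable_funX.
have mk2 : measurable_fun setT (fun x => (k x ^+ 2)%:E).
  by apply/measurable_EFinP; exact: measurable_funX.
have h0 x : 0 <= (h x ^+ 2)%:E by rewrite lee_fin sqr_ge0.
have k0 x : 0 <= (k x ^+ 2)%:E by rewrite lee_fin sqr_ge0.
move: k2; rewrite [X in X < _ -> _](ge0_integral_mrestr leb2 measurable_disk mk2 k0) => k2.
rewrite [X in X < _](ge0_integral_mrestr leb2 measurable_disk mh2 h0).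
apply: (le_lt_trans _ k2); apply: ge0_le_integral.
- exact: measurable_disk.
- by move=> x _; exact: h0.
- exact: measurable_funTS.
- exact: measurable_funTS.
- move=> x /hk; rewrite lee_fin -(real_normK (num_real (h x))) => hx.
  by rewrite -(real_normK (num_real (k x))) ler_sqr ?nnegrE.
Qed.

Lemma cst1_L2disk : (cst 1%R : plane R -> R) \in Lfun (@disk_measure R) 2%:E.
Proof.
apply: Lfun2P; first exact: measurable_cst.
have -> : \int[disk_measure]_x ((cst 1 x : R) ^+ 2)%:E = \int[disk_measure]_(x in [set: plane R]) (cst 1 x).
  by apply: eq_integral => x _; rewrite /= expr1n.
rewrite integral_cst//= mul1e /mrestr setTI.
pose S : set (plane R) := `[(-1)%R, 1%R] `*` `[(-1)%R, 1%R].
have mS : measurable S by apply: measurableX; exact: measurable_itv.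
apply: (@le_lt_trans _ _ (leb2 S)).
  apply: le_measure; rewrite ?inE//; first exact: measurable_disk.
  by move=> x; rewrite /disk/= => xd; split => /=; rewrite in_itv/=; apply/andP; split; nra.
have -> : leb2 S = mu `[(-1)%R, 1%R]%classic * mu `[(-1)%R, 1%R]%classic.
  by apply: product_measure1E; exact: measurable_itv.
rewrite /= lebesgue_measure_itv/= lte_fin ifT; last by lra.
by rewrite -!EFinB -EFinM ltry.
Qed.

End membership.

Section density.
Context {R : realType}.
Variable T : L2disk R -> L2cyl R.
Hypothesis radonT : radon_extension T.

(** Agreement for a bare function, with membership in L^2 hidden in the witness; this lets
    indicators and sums be handled pointwise. *)
Definition agree_at (h : plane R -> R) : Prop :=
  exists2 f : L2disk R, (f : plane R -> R) = h & agree T f.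

Lemma agree_at_linear (a : R) (h k : plane R -> R) : agree_at h -> agree_at k ->
  agree_at (fun x => a * h x + k x).
Proof.
move=> [f fh af] [g gk ag]; exists (a *: f + g); last exact: agree_linear.
by rewrite -fh -gk.
Qed.

Lemma agree_at_dominated (hn : nat -> plane R -> R) (h : plane R -> R) (k : L2disk R) :
  (forall n, agree_at (hn n)) -> measurable_fun setT h ->
  (forall x, disk x -> hn n x @[n --> \oo] --> h x) ->
  (forall n x, disk x -> `|hn n x| <= k x) -> agree_at h.
Proof.
move=> ahn mh hnh hnk.
have hk x : disk x -> `|h x| <= k x.
  move=> xd; have c : `|hn n x| @[n --> \oo] --> `|h x| by apply: cvg_norm; exact: hnh.
  by apply: (cvgr_to_le c); apply: nearW => n; exact: hnk.
have kL : (k : plane R -> R) \in Lfun (@disk_measure R) 2%:E by exact: LfunP.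
have hL : h \in Lfun (@disk_measure R) 2%:E
  by apply: (L2disk_dominated mh kL) => x /hk hx; apply: le_trans hx (ler_norm _).
have [fn fnE] : {fn : nat -> L2disk R & forall n, (fn n : plane R -> R) = hn n /\ agree T (fn n)}.
  apply: (@choice _ _ (fun n (f : L2disk R) => (f : plane R -> R) = hn n /\ agree T f)) => n.
  by have [f] := ahn n; exists f.
exists (Lfun_Sub one_le_two hL) => //.
apply: (@agree_dominated _ _ radonT fn _ k).
- by move=> n; have [] := fnE n.
- move=> x xd; rewrite (_ : (fun n => fn n x) = (fun n => hn n x)); first exact: hnh.
  by apply/funext => n; have [-> _] := fnE n.
- by move=> n x xd; have [-> _] := fnE n; exact: hnk.
Qed.

Definition agree_set (A : set (plane R)) : Prop := measurable A /\ agree_at (\1_A).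

Let indic_le1 (A : set (plane R)) x : `|\1_A x : R| <= 1.
Proof. by rewrite indicE; case: (x \in A); rewrite ?normr1 ?normr0. Qed.

(** A constant sequence converges to the indicator of [B] at all points of the disk, the only ones
    that [agree_at_dominated] examines. *)
Lemma agree_set_eq_disk A B : agree_set A -> measurable B ->
  (forall x, disk x -> A x <-> B x) -> agree_set B.
Proof.
move=> [mA aA] mB AB; split => //.
apply: (@agree_at_dominated (fun=> \1_A) _ (Lfun_Sub one_le_two (@cst1_L2disk R))) => //.
move=> x /AB h; have -> : \1_B x = \1_A x :> R; last exact: cvg_cst.
by rewrite !indicE; congr ((nat_of_bool _)%:R); apply/idP/idP; rewrite !inE => /h.
Qed.

Lemma agree_setD A B : B `<=` A -> agree_set A -> agree_set B -> agree_set (A `\` B).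
Proof.
move=> BA [mA aA] [mB aB]; split; first exact: measurableD.
have -> : \1_(A `\` B) = (fun x => -1 * \1_B x + \1_A x) :> (plane R -> R).
  apply/funext => x; rewrite !indicE in_setD.
  have [xB|xB] := boolP (x \in B); last by rewrite andbT mulr0 add0r.
  by rewrite (mem_set (BA x (set_mem xB))) mulr1 addNr.
exact: agree_at_linear.
Qed.

Lemma agree_set_bigcup (A : nat -> set (plane R)) :
  {homo A : n m / (n <= m)%N >-> n `<=` m} -> (forall n, agree_set (A n)) ->
  agree_set (\bigcup_n A n).
Proof.
move=> ndA aA; have mA n : measurable (A n) by have [] := aA n.
have mU : measurable (\bigcup_n A n) by exact: bigcupT_measurable.
split => //.
apply: (@agree_at_dominated (fun n => \1_(A n)) _ (Lfun_Sub one_le_two (@cst1_L2disk R))) => //.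
- by move=> n; have [] := aA n.
- move=> x _; have [[m _ Amx]|nA] := pselect ((\bigcup_n A n) x).
    apply: cvg_near_cst.
    exists m => // n /= mn; rewrite !indicE !mem_set//; first by exists m.
    exact: ndA Amx.
  apply: cvg_near_cst; apply: nearW => n; rewrite !indicE !memNset// => Anx.
  by apply: nA; exists n.
Qed.

(** Dynkin's lambda-system argument relative to [E], for sets pulled back along [p]. With [p] a
    coordinate it replaces one side of a rectangle of intervals by a Borel set; with [p] the
    identity it passes from rectangles to the product sigma-algebra. *)
Lemma agree_set_generated (U : Type) (p : plane R -> U) (E : set (plane R)) (G : set (set U)) :
  agree_set E -> setI_closed G -> (forall A, G A -> agree_set (E `&` p @^-1` A)) ->
  forall A, <<s G >> A -> agree_set (E `&` p @^-1` A).
Proof.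
move=> aE GI GA A sA.
apply: (@lambda_system_subset _ G GI setT [set A | agree_set (E `&` p @^-1` A)] _ GA) => //.
split => //=.
- by rewrite preimage_setT setIT.
- move=> B C CB aB aC.
  have E1 : E `&` p @^-1` (B `\` C) = (E `&` p @^-1` B) `\` (E `&` p @^-1` C).
    apply/seteqP; split => x /=; first by move=> [Ex [Bx nCx]]; split => // -[].
    by move=> [[Ex Bx] h]; split => //; split => // Cx; exact: h.
  have CB' : E `&` p @^-1` C `<=` E `&` p @^-1` B by move=> x [? ?]; split => //; exact: CB.
  by have := agree_setD CB' aB aC; rewrite -E1.
- move=> B ndB aB.
  have E1 : E `&` p @^-1` (\bigcup_n B n) = \bigcup_n (E `&` p @^-1` B n).
    by rewrite preimage_bigcup setI_bigcupr.
  have ndB' : {homo (fun n => E `&` p @^-1` B n) : n m / (n <= m)%N >-> n `<=` m}.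
    move=> n m nm x [Ex Bx]; split => //.
    by have := ndB _ _ nm; rewrite subsetEset; apply.
  by have := agree_set_bigcup ndB' aB; rewrite -E1.
Qed.

(** Subtracting 1 keeps the support away from the unit circle: the value is 0 as long as n (1 -
    |x|^2) <= 1, and it is 1 once this product reaches 2. *)
Definition disk_cutoff (n : nat) (x : R * R) : R :=
  clamp (n%:R * (1 - (x.1 ^+ 2 + x.2 ^+ 2)) - 1).

Definition rectangle_cutoff (a b c d : R) (n : nat) (x : R * R) : R :=
  cutoff a b n x.1 * cutoff c d n x.2 * disk_cutoff n x.

Lemma continuous_normsq : continuous (fun x : R * R => x.1 ^+ 2 + x.2 ^+ 2).
Proof.
move=> x; under eq_fun do rewrite !expr2.
by apply: cvgD; apply: cvgM; (exact: cvg_fst || exact: cvg_snd).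
Qed.

Let margin (n : nat) (x : R * R) : R := n%:R * (1 - (x.1 ^+ 2 + x.2 ^+ 2)) - 1.

Let continuous_margin n : continuous (margin n).
Proof.
move=> x; apply: cvgB; last exact: cvg_cst.
apply: cvgM; first exact: cvg_cst.
by apply: cvgB; [exact: cvg_cst|exact: continuous_normsq].
Qed.

Lemma continuous_disk_cutoff n : continuous (disk_cutoff n).
Proof.
move=> x; apply: (@continuous_comp _ _ _ (margin n) clamp); first exact: continuous_margin.
exact: continuous_clamp.
Qed.

Lemma continuous_rectangle_cutoff a b c d n : continuous (rectangle_cutoff a b c d n).
Proof.
move=> x; apply: cvgM; last exact: continuous_disk_cutoff.
apply: cvgM.
  by apply: (@continuous_comp _ _ _ fst (cutoff a b n)); [exact: cvg_fst|exact: continuous_cutoff].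
by apply: (@continuous_comp _ _ _ snd (cutoff c d n)); [exact: cvg_snd|exact: continuous_cutoff].
Qed.

Lemma compact_disk_cutoff n : exists K : set (R * R),
  [/\ compact K, K `<=` disk & forall x, ~ K x -> disk_cutoff n x = 0].
Proof.
pose K := margin n @^-1` [set t | 0 <= t].
have Kd : K `<=` disk.
  move=> x; rewrite /K /disk/= subr_ge0 => n1.
  rewrite ltNge; apply/negP => x1.
  by have : n%:R * (1 - (x.1 ^+ 2 + x.2 ^+ 2)) <= 0 :> R;
    [rewrite mulr_ge0_le0// subr_le0|lra].
exists K; split => //; last first.
  by move=> x /negP; rewrite -ltNge => /ltW; exact: clamp_eq0.
have cS : compact (`[-1, 1]%classic `*` `[-1, 1]%classic : set (R * R)).
  by apply: compact_setX; exact: segment_compact.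
apply: (subclosed_compact _ cS).
- by apply: preimage_closed; [move=> x _; exact: continuous_margin|exact: closed_ge].
- by move=> x /Kd; rewrite /disk/= => xd; split => /=; rewrite in_itv/=; apply/andP; split; nra.
Qed.

Lemma measurable_rectangle_cutoff a b c d n :
  measurable_fun [set: plane R] (rectangle_cutoff a b c d n).
Proof.
have mc : measurable_fun [set: measurableTypeR R] (clamp : R -> R).
  by apply: continuous_measurable_fun; exact: continuous_clamp.
have mcut p q : measurable_fun [set: measurableTypeR R] (cutoff p q n : R -> R).
  by apply: continuous_measurable_fun; exact: continuous_cutoff.
apply: measurable_funM; first apply: measurable_funM.
- exact: (measurableT_comp (mcut _ _) measurable_fst).
- exact: (measurableT_comp (mcut _ _) measurable_snd).
apply: (measurableT_comp mc).
apply: measurable_funB => //; apply: measurable_funM => //; apply: measurable_funB => //.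
by apply: measurable_funD; apply: measurable_funX.
Qed.

Lemma agree_set_itv a b c d : agree_set (`]a, b] `*` `]c, d]).
Proof.
split; first by apply: measurableX; exact: measurable_itv.
have b1 n x : `|rectangle_cutoff a b c d n x| <= 1.
  rewrite ger0_norm ?mulr_ge0 ?cutoff_ge0 ?clamp_ge0//.
  by rewrite !mulr_ile1 ?mulr_ge0 ?cutoff_ge0 ?clamp_ge0 ?cutoff_le1 ?clamp_le1.
apply: (@agree_at_dominated (rectangle_cutoff a b c d) _ (Lfun_Sub one_le_two (@cst1_L2disk R))).
- move=> n; have hL : (rectangle_cutoff a b c d n : plane R -> R) \in Lfun (@disk_measure R) 2%:E.
    apply: (@L2disk_dominated _ _ (cst 1)) => //.
      exact: measurable_rectangle_cutoff.
      exact: cst1_L2disk.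
    by move=> x _; rewrite normr1; exact: b1.
  exists (Lfun_Sub one_le_two hL) => //; apply: agree_cc => //; split.
    exact: continuous_rectangle_cutoff.
  have [K [cK Kd K0]] := compact_disk_cutoff n; exists K; split => // x Kx.
  by rewrite /= /rectangle_cutoff K0 ?mulr0.
- by apply: measurable_indic; apply: measurableX; exact: measurable_itv.
- move=> x xd; apply: cvg_near_cst.
  have := near_cutoff c d x.2; have := near_cutoff a b x.1.
  have x0 : 0 < 1 - (x.1 ^+ 2 + x.2 ^+ 2) by rewrite subr_gt0.
  have := near_natr_mul_ge 2 x0.
  apply: filterS3 => n h1 h2 h3; rewrite /rectangle_cutoff h2 h3 /disk_cutoff clamp_eq1; last by lra.
  by rewrite mulr1 !indicE in_setX -natrM mulnb.
- by move=> n x _; exact: b1.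
Qed.

Let disk_itv (x : plane R) : disk x -> `]-1, 1]%classic x.1 /\ `]-1, 1]%classic x.2.
Proof. by rewrite /disk/= => xd; split; rewrite in_itv/=; apply/andP; split; nra. Qed.

Lemma agree_setT : agree_set setT.
Proof.
apply: (agree_set_eq_disk (agree_set_itv (-1) 1 (-1) 1)) => // x xd.
by split => // _; have [] := disk_itv xd.
Qed.

Let ocitv_generated (P : set (measurableTypeR R) -> Prop) :
  (forall A, <<s @ocitv R >> A -> P A) -> forall A, measurable A -> P A.
Proof. by move=> H A mA; apply: H. Qed.

Let agree_strip_snd (c d : R) : agree_set (setT `*` `]c, d]).
Proof.
apply: (agree_set_eq_disk (agree_set_itv (-1) 1 c d)).
  by apply: measurableX => //; exact: measurable_itv.
by move=> x /disk_itv[? ?]; split => -[].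
Qed.

Let agree_setX_itv (A : set (measurableTypeR R)) (c d : R) : measurable A -> agree_set (A `*` `]c, d]).
Proof.
move=> mA; rewrite (_ : A `*` _ = (setT `*` `]c, d]) `&` fst @^-1` A); last first.
  by apply/seteqP; split => x /=; [move=> []|move=> [[]]].
move: A mA; apply: ocitv_generated; apply: agree_set_generated (agree_strip_snd c d) (@ocitvI R) _.
move=> A [[a b] _ <-]; rewrite (_ : _ `&` _ = `]a, b] `*` `]c, d]); first exact: agree_set_itv.
by apply/seteqP; split => x /=; [move=> [[]]|move=> []].
Qed.

Let agree_setX (A B : set (measurableTypeR R)) : measurable A -> measurable B -> agree_set (A `*` B).
Proof.
move=> mA mB; rewrite (_ : A `*` _ = (A `*` setT) `&` snd @^-1` B); last first.
  by apply/seteqP; split => x /=; [move=> []|move=> [[]]].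
have AT : agree_set (A `*` setT).
  apply: (agree_set_eq_disk (agree_setX_itv (-1) 1 mA)); first exact: measurableX.
  by move=> x /disk_itv[? ?]; split => -[].
move: B mB; apply: ocitv_generated; apply: agree_set_generated AT (@ocitvI R) _.
move=> B [[a b] _ <-]; rewrite (_ : _ `&` _ = A `*` `]a, b]); first exact: agree_setX_itv.
by apply/seteqP; split => x /=; [move=> [[]]|move=> []].
Qed.

Lemma agree_set_measurable (A : set (plane R)) : measurable A -> agree_set A.
Proof.
rewrite measurable_prod_measurableType => sA.
rewrite -[A]setTI; move: A sA; apply: (agree_set_generated (p := id) agree_setT).
  move=> X Y [X1 mX1 [X2 mX2 <-{X}]] [Y1 mY1 [Y2 mY2 <-{Y}]].
  exists (X1 `&` Y1); first exact: measurableI.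
  by exists (X2 `&` Y2); [exact: measurableI|rewrite setXI].
by move=> _ [A mA [B mB <-]]; rewrite setTI; exact: agree_setX.
Qed.

Let agree_at_sum n (c : nat -> R) (A : nat -> set (plane R)) : (forall i, measurable (A i)) ->
  agree_at (fun x => \sum_(i < n) c i * \1_(A i) x).
Proof.
move=> mA; elim: n => [|n IH].
  have -> : (fun x => \sum_(i < 0) c i * \1_(A i) x) = \1_set0 :> (plane R -> R).
    by apply/funext => x; rewrite big_ord0 indic0.
  by have [] := agree_set_measurable measurable0.
have -> : (fun x => \sum_(i < n.+1) c i * \1_(A i) x) =
    (fun x => c n * \1_(A n) x + \sum_(i < n) c i * \1_(A i) x) :> (plane R -> R).
  by apply/funext => x; rewrite big_ord_recr addrC.
by apply: agree_at_linear => //; have [] := agree_set_measurable (mA n).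
Qed.

Import HBNNSimple.

Lemma agree_at_simple (g : {nnsfun plane R >-> R}) : agree_at g.
Proof.
pose s : seq R := finmap.enum_fset (fset_set (range g)).
rewrite (_ : (g : plane R -> R) = (fun x => \sum_(i < size s) s`_i * \1_(g @^-1` [set s`_i]) x)); last first.
  by apply/funext => x; exact: fimfunEord.
apply: (@agree_at_sum _ (fun i => s`_i) (fun i => g @^-1` [set s`_i])) => i.
rewrite -[X in measurable X]setTI.
exact: (measurable_funP g measurableT _ (measurable_set1 _)).
Qed.

Lemma agree_at_nonneg (h : plane R -> R) (k : L2disk R) : measurable_fun setT h ->
  (forall x, 0 <= h x) -> (forall x, h x <= k x) -> agree_at h.
Proof.
move=> mh h0 hk.
have mE : measurable_fun setT (EFin \o h) by exact/measurable_EFinP.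
have E0 x : [set: plane R] x -> (0 <= (EFin \o h) x)%E by rewrite lee_fin.
pose g n := nnsfun_approx measurableT mE n.
have gh x : g n x @[n --> \oo] --> h x.
  by have := cvg_nnsfun_approx measurableT mE E0 (x := x) I => /fine_cvgP[].
apply: (@agree_at_dominated (fun n => g n) _ k) => //.
- by move=> n; exact: agree_at_simple.
- move=> n x _; rewrite ger0_norm; last exact: fun_ge0.
  apply: le_trans (hk x); have c := gh x.
  apply: (cvgr_to_ge c); exists n => // m /= nm.
  by have /lefP := nd_nnsfun_approx measurableT mE nm; exact.
Qed.

Lemma agree_everywhere (f : L2disk R) : agree T f.
Proof.
have mf : measurable_fun setT f by exact: measurable_funP.
have nL : (fun x => `|f x|) \in Lfun (@disk_measure R) 2%:E.
  apply: (@L2disk_dominated _ _ f); [exact: measurableT_comp|exact: LfunP|].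
  by move=> x _; rewrite normr_id.
have ap : agree_at (f^\+)%R.
  apply: (@agree_at_nonneg _ (Lfun_Sub one_le_two nL)).
  - exact: measurable_funrpos.
  - exact: funrpos_ge0.
  - by move=> x; rewrite /funrpos ge_max normr_ge0 ler_norm.
have am : agree_at (f^\-)%R.
  apply: (@agree_at_nonneg _ (Lfun_Sub one_le_two nL)).
  - exact: measurable_funrneg.
  - exact: funrneg_ge0.
  - by move=> x; rewrite /= /funrneg ge_max normr_ge0 andbT -normrN ler_norm.
have [g gf ag] := agree_at_linear (-1) am ap.
rewrite (_ : f = g)//; apply/val_inj; rewrite /= gf; apply/funext => x.
by rewrite mulN1r addrC -[in LHS](funrposBneg f).
Qed.

End density.

Section radon_is_explicit.
Context {R : realType}.

Lemma radonP : radon_extension (@radon R).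
Proof.
apply: (@xgetPex _ _ [set T | radon_extension T]).
by exists (@radon_operator R); exact: radon_operator_extension.
Qed.

Lemma radonE (f : L2disk R) : (radon f : R * R -> R) = radon_operator f %[ae cylinder_measure].
Proof. exact: agree_everywhere radonP f. Qed.

End radon_is_explicit.

(** * Convergence in operator norm *)

Section operator_error.
Context {R : realType}.
Variable D : discretization R.
Local Notation eta := (dx D + dphi D).

Lemma discrete_radon_fun_patch (f : plane R -> R) :
  discrete_radon_fun D (f \_ disk) = discrete_radon_fun D f.
Proof.
rewrite /discrete_radon_fun /discrete_radon_coef patch_disk// => x xd.
by rewrite /patch memNset.
Qed.

Lemma norm_discrete_radon_error (f : L2disk R) : eta <= ds D -> (norm_disk f <= 1)%E ->
  (norm_cyl (discrete_radon D f - radon f)%R <= (64 * (eta / ds D + 3 * Num.sqrt (ds D)))%:E)%E.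
Proof.
move=> etad f1.
have -> : norm_cyl (discrete_radon D f - radon f)%R =
    norm_cyl (discrete_radon D f - radon_operator f)%R.
  apply: norm_cyl_ae; apply: (@filterS _ _ (ae_filter_ringOfSetsType _) _ _ _ (radonE f)) => u /(_ I) E _.
  transitivity (discrete_radon D f u - radon f u); first by [].
  by rewrite E.
have eta0 : 0 <= eta / ds D.
  by rewrite divr_ge0 ?addr_ge0// ?(ltW (dx_gt0 _)) ?(ltW (ds_gt0 _)) ?dphi_ge0.
have s0 : 0 <= Num.sqrt (ds D) by exact: sqrtr_ge0.
have ss : Num.sqrt (ds D) ^+ 2 = ds D by rewrite sqr_sqrtr// ltW// ds_gt0.
rewrite norm_cyl_leP; last by rewrite mulr_ge0// addr_ge0// mulr_ge0.
have [N N0 fN] := sqnorm_ext_fin f.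
have N1 : N <= 1.
  have := f1; rewrite norm_disk_leP// fN lee_fin => N1.
  by rewrite expr1n in N1.
have -> : (\int[cylinder_measure]_u ((discrete_radon D f - radon_operator f)%R u ^+ 2)%:E =
    \int[cylinder_measure]_u ((discrete_radon_fun D (f \_ disk) u - radon_integral (f \_ disk) u) ^+ 2)%:E)%E.
  by apply: eq_integral => u _; rewrite discrete_radon_fun_patch.
apply: (le_trans (integral_signed_error (measurable_ext f) (@ext_disk _ f) fN etad)).
rewrite lee_fin -{2}ss.
have := pihalf_lt2 R; have := pi_gt0 R => p0 p4.
move: (eta / ds D) (Num.sqrt (ds D)) eta0 s0 => a b a0 b0.
have q0 : 0 <= a ^+ 2 + 8 * b ^+ 2 by rewrite addr_ge0 ?mulr_ge0 ?sqr_ge0.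
have ab0 : 0 <= 6 * (a * b) + b ^+ 2 by rewrite addr_ge0 ?sqr_ge0// mulr_ge0// mulr_ge0.
(* The constants 64 and 3 come from 1024 pi <= 64^2, as pi < 4, and from 8 <= 3^2; what remains of
   the square is nonnegative. *)
have -> : (64 * (a + 3 * b)) ^+ 2 =
    64 * 64 * (a ^+ 2 + 8 * b ^+ 2) + 64 * 64 * (6 * (a * b) + b ^+ 2) by ring.
move: q0 ab0; move: (a ^+ 2 + 8 * b ^+ 2) (6 * (a * b) + b ^+ 2) => q r q0 r0.
have c0 : 0 <= 64 * 64 :> R by rewrite mulr_ge0.
apply: (@le_trans _ _ (64 * 64 * q)); last by rewrite lerDl mulr_ge0.
by rewrite ler_wpM2r//; nra.
Qed.

Lemma operator_norm_ge0 (T : L2disk R -> L2cyl R) : (0 <= operator_norm T)%E.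
Proof.
apply: (@le_trans _ _ (norm_cyl (T 0))); first exact: Lnorm_ge0.
apply: ereal_sup_ubound; exists 0 => //=.
rewrite /norm_disk (_ : EFin \o _ = cst 0%E) ?Lnorm0//.
Qed.

Lemma operator_norm_error : eta <= ds D ->
  (operator_norm (fun f => discrete_radon D f - radon f)%R <=
   (64 * (eta / ds D + 3 * Num.sqrt (ds D)))%:E)%E.
Proof.
move=> etad; apply: ge_ereal_sup => _ [f f1 <-].
exact: norm_discrete_radon_error.
Qed.

End operator_error.

Theorem theorem2p9 (R : realType) (I : Type) (F : filter_on I)
    (D : I -> discretization R) :
  ds (D i) @[i --> F] --> (0 : R) ->
  dphi (D i) / ds (D i) @[i --> F] --> (0 : R) ->
  dx (D i) / ds (D i) @[i --> F] --> (0 : R) ->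
  operator_norm (fun f => discrete_radon (D i) f - radon f) @[i --> F]
    --> (0 : \bar R)%E
  /\
  forall eps : R, 0 < eps <= 1 / 2 ->
    (fun i => dphi (D i)) =O_F (fun i => ds (D i) `^ (1 + eps)) ->
    (fun i => dx (D i)) =O_F (fun i => ds (D i) `^ (1 + eps)) ->
    (fun i => fine (operator_norm (fun f => discrete_radon (D i) f - radon f)))
      =O_F (fun i => ds (D i) `^ eps).
Proof.
move=> ds0 dphi0 dx0.
pose err i := (dx (D i) + dphi (D i)) / ds (D i).
have err0 : err i @[i --> F] --> (0 : R).
  rewrite -(addr0 0); under eq_fun do rewrite /err mulrDl.
  exact: cvgD.
(* The error bound is available only for dx + dphi <= ds, which holds eventually because the
   quotient tends to 0. *)
have small : \forall i \near F, dx (D i) + dphi (D i) <= ds (D i).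
  have lt1 := cvgr_lt _ err0 _ ltr01.
  near=> i; have : err i < 1 by near: i; exact: lt1.
  by rewrite /err ltr_pdivrMr ?ds_gt0// mul1r => /ltW.
split.
  apply: (@squeeze_cvge _ _ _ _ (cst 0%E) _
    (fun i => (64 * (err i + 3 * Num.sqrt (ds (D i))))%:E)).
  - near=> i; have H : dx (D i) + dphi (D i) <= ds (D i) by near: i; exact: small.
     rewrite operator_norm_ge0/=.
    exact: operator_norm_error.
  - exact: cvg_cst.
  - apply: cvg_EFin; first exact: nearW.
    rewrite /comp/=; have sq0 : Num.sqrt (ds (D i)) @[i --> F] --> (0 : R).
      rewrite -[X in _ --> X](@sqrtr0 R).
      exact: (@continuous_cvg _ _ _ _ _ _ Num.sqrt _ (@sqrt_continuous R _) ds0).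
    have -> : 0 = 64 * (0 + 3 * 0) :> R by rewrite mulr0 addr0 mulr0.
    by apply: cvgM; [exact: cvg_cst|apply: cvgD => //; apply: cvgM => //; exact: cvg_cst].
move=> eps /andP[eps0 eps2] /eqO_exP[a a0 Oa] /eqO_exP[b b0 Ob].
(* Here a and b bound dphi and dx relative to ds^(1 + eps), and 3 is the coefficient of sqrt ds in
   the operator bound. *)
apply/eqO_exP; exists (64 * (a + b + 3)); first by rewrite mulr_gt0// !addr_gt0.
have ds1 : \forall i \near F, ds (D i) < 1 by exact: cvgr_lt ds0 _ ltr01.
near=> i.
have d0 := ds_gt0 (D i).
have d1 : ds (D i) <= 1 by apply: ltW; near: i; exact: ds1.
have n0 := operator_norm_ge0 (fun f => discrete_radon (D i) f - radon f).
have n1 : (operator_norm (fun f => discrete_radon (D i) f - radon f)%R <=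
   (64 * (err i + 3 * Num.sqrt (ds (D i))))%:E)%E.
  by apply: operator_norm_error; near: i.
rewrite ger0_norm ?fine_ge0// ger0_norm ?powR_ge0//.
apply: (@le_trans _ _ (64 * (err i + 3 * Num.sqrt (ds (D i))))).
  by rewrite -lee_fin fineK// ge0_fin_numE// (le_lt_trans n1)// ltry.
rewrite -mulrA ler_wpM2l// [leRHS]mulrDl lerD//; last first.
  (* For ds <= 1 the condition eps <= 1/2 is exactly what gives sqrt ds <= ds^eps. *)
  rewrite ler_wpM2l// -powR12_sqrt ?(ltW d0)//.
  have d01 : 0 < ds (D i) <= 1 by rewrite d0.
  by apply: (ger_powR d01); rewrite -[leRHS]div1r.
have e1 : ds (D i) `^ (1 + eps) = ds (D i) * ds (D i) `^ eps.
  rewrite powRD; last by rewrite (gt_eqF d0) implybT.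
  by rewrite powRr1// ltW.
rewrite /err ler_pdivrMr// mulrAC mulrC.
have : dphi (D i) <= a * ds (D i) `^ (1 + eps).
  rewrite -(ger0_norm (powR_ge0 _ _)); apply: le_trans (ler_norm _) _; near: i; exact: Oa.
have : dx (D i) <= b * ds (D i) `^ (1 + eps).
  rewrite -(ger0_norm (powR_ge0 _ _)); apply: le_trans (ler_norm _) _; near: i; exact: Ob.
rewrite e1; move: (ds (D i) `^ eps) => z h1 h2.
by rewrite [leRHS]mulrA; nra.
Unshelve. all: by end_near. Qed.
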